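(* Let $(A,\mathscr{A},\mu)$ and $(B,\mathscr{B},\nu)$ be probability spaces, let $\mathscr{F}$ be a sub-$\sigma$-algebra of the product $\sigma$-algebra $\mathscr{A}\times\mathscr{B}$ on $A\times B$, let $1<p,q<\infty$, and let $X$ be a non-zero Banach space. Then the following assertions are equivalent: (1) the conditional expectation operator $\mathbb{E}(\cdot|\mathscr{F})$ restricts to a bounded projection on the space $L^p(\mu;L^q(\nu;X))$; (2) the conditional expectation operator $\mathbb{E}(\cdot|\mathscr{F})$ restricts to a bounded projection on the space $L^{p'}(\mu;L^{q'}(\nu;X))$; (3) the canonical mapping $f\mapsto\phi_f$ induces an isomorphism of Banach spaces $$L^p_{\mathscr{F}}(\mu;L^q(\nu))\simeq \big(L^{p'}_{\mathscr{F}}(\mu;L^{q'}(\nu))\big)^*.$$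
   Context: For a Banach space $X$ and $1\le p,q\le\infty$, $L^p(\mu;L^q(\nu;X))$ is the mixed-norm Lebesgue–Bochner space, and $L^q(\nu)$ is the scalar-valued space. Elements of $L^p(\mu;L^q(\nu;X))$ are identified with elements of $L^1(\mu\times\nu;X)$, i.e. with functions on $A\times B$. The space $L^p_{\mathscr{F}}(\mu;L^q(\nu;X))$ is the closed subspace of $L^p(\mu;L^q(\nu;X))$ consisting of those functions that have a strongly $\mathscr{F}$-measurable representative; when $X$ is the scalar field it is written $L^p_{\mathscr{F}}(\mu;L^q(\nu))$. The conjugate exponents $p',q'$ are defined by $\frac1p+\frac1{p'}=1$ and $\frac1q+\frac1{q'}=1$. For $f\in L^p_{\mathscr{F}}(\mu;L^q(\nu))$, $\phi_f\in (L^{p'}_{\mathscr{F}}(\mu;L^{q'}(\nu)))^*$ is the canonically induced functional $\phi_f(g)=\int_{A\times B} fg\,\mathrm{d}(\mu\times\nu)$; the map $f\mapsto\phi_f$ is contractive. ''Isomorphism of Banach spaces'' means a bounded linear bijection with bounded inverse (not necessarily isometric). $\mathbb{E}(\cdot|\mathscr{F})$ denotes the (Bochner) conditional expectation on $L^1(\mu\times\nu;X)$ with respect to $\mathscr{F}$. *)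

(* Defs.v *)
From HB Require Import structures.
From mathcomp Require Import all_boot all_order all_algebra complex.
From mathcomp Require Import all_classical all_reals all_analysis.

Set Implicit Arguments.
Unset Strict Implicit.
Unset Printing Implicit Defensive.

Import Order.TTheory GRing.Theory Num.Theory.
Import numFieldNormedType.Exports.

Local Open Scope classical_set_scope.
Local Open Scope ring_scope.

(* Banach spaces are over R or over C; the scalar field is a parameter. *)
Variant scalar_kind := RealScalars | ComplexScalars.

Definition scalar_field (R : realType) (k : scalar_kind) : numFieldType :=
  match k with
  | RealScalars => R
  | ComplexScalars => R[i]
  end.

Definition scalar_of_real (R : realType) (k : scalar_kind) :
    R -> scalar_field R k :=
  match k with
  | RealScalars => fun r => r
  | ComplexScalars => fun r => r%:C%C
  end.

Definition real_of_scalar (R : realType) (k : scalar_kind) :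
    scalar_field R k -> R :=
  match k with
  | RealScalars => fun x => x
  | ComplexScalars => fun z => complex.Re z
  end.

(* In a normedModType over K the norm `|x| is an element of K; over R[i] it is
   a nonnegative real sitting inside R[i]. *)
Definition rnorm (R : realType) (k : scalar_kind)
    (X : normedModType (scalar_field R k)) (x : X) : R :=
  real_of_scalar `|x|.

Section strong_measurability.
Context (T : Type) (R : realType) (k : scalar_kind)
  (X : normedModType (scalar_field R k)).

Definition simple_fun (G : set (set T)) (s : T -> X) : Prop :=
  finite_set (range s) /\ forall x : X, G (s @^-1` [set x]).

Definition strongly_measurable (G : set (set T)) (f : T -> X) : Prop :=
  exists s : (T -> X)^nat, (forall n, simple_fun G (s n)) /\
    forall t, s n t @[n --> \oo] --> f t.

End strong_measurability.

Section bochner.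
Context d (T : measurableType d) (R : realType) (k : scalar_kind)
  (X : normedModType (scalar_field R k)) (P : probability T R).

Definition bochner_integrable (f : T -> X) : Prop :=
  strongly_measurable measurable f /\
  (\int[P]_t (rnorm (f t))%:E < +oo)%E.

Definition simple_bochner (s : T -> X) : X :=
  \sum_(x \in range s) scalar_of_real k (fine (P (s @^-1` [set x]))) *: x.

Definition is_bochner (f : T -> X) (y : X) : Prop :=
  exists s : (T -> X)^nat,
  [/\ forall n, simple_fun measurable (s n),
      (\int[P]_t (rnorm (f t - s n t))%:E)%E @[n --> \oo] --> 0%E &
      simple_bochner (s n) @[n --> \oo] --> y].

(* Meaningful when f is bochner_integrable and X is complete. *)
Definition bochner (D : set T) (f : T -> X) : X :=
  xget 0 [set y | is_bochner (patch (cst 0) D f) y].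

Definition is_cond_exp (F : set (set T)) (f g : T -> X) : Prop :=
  [/\ bochner_integrable f, bochner_integrable g, strongly_measurable F g &
      forall D, F D -> bochner D g = bochner D f].

(* A representative of E(f|F), which is unique up to P-a.e. equality. *)
Definition cond_exp (F : set (set T)) (f : T -> X) : T -> X :=
  xget (cst 0) [set g | is_cond_exp F f g].

End bochner.

(* Below, a Banach space of a.e.-equivalence classes is given by the set V of
   the representatives of its elements and by its norm N, a seminorm on V whose
   kernel consists of the functions that vanish a.e. *)
Section operators.
Context d (T : measurableType d) (R : realType) (k : scalar_kind).
Local Notation K := (scalar_field R k).

Definition restricts_to_bounded_projection (X : normedModType K)
    (P : probability T R) (E : (T -> X) -> T -> X)
    (V : set (T -> X)) (N : (T -> X) -> \bar R) : Prop :=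
  [/\ forall f, V f -> V (E f),
      forall (c : K) f g, V f -> V g ->
        E (c *: f + g) = c *: E f + E g %[ae P],
      forall f, V f -> E (E f) = E f %[ae P] &
      exists C : R, forall f, V f -> (N (E f) <= C%:E * N f)%E].

(* Elements of the dual are functions on T -> K of which only the values on V
   matter. *)
Definition dual (V : set (T -> K^o)) (N : (T -> K^o) -> \bar R) :
    set ((T -> K^o) -> K^o) :=
  [set L | (forall (c : K) f g, V f -> V g ->
              L (c *: f + g) = c *: L f + L g) /\
           exists C : R, forall g, V g -> ((rnorm (L g))%:E <= C%:E * N g)%E].

Definition dual_norm (V : set (T -> K^o)) (N : (T -> K^o) -> \bar R)
    (L : (T -> K^o) -> K^o) : \bar R :=
  ereal_sup [set (rnorm (L g))%:E | g in [set g | V g /\ (N g <= 1)%E]].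

Definition isomorphism_onto_dual (P : probability T R)
    (Phi : (T -> K^o) -> (T -> K^o) -> K^o)
    (V : set (T -> K^o)) (N : (T -> K^o) -> \bar R)
    (W : set (T -> K^o)) (M : (T -> K^o) -> \bar R) : Prop :=
  (forall f, V f -> dual W M (Phi f)) /\
  (forall (c : K) f1 f2, V f1 -> V f2 ->
     forall g, W g -> Phi (c *: f1 + f2) g = c *: Phi f1 g + Phi f2 g) /\
  (forall f1 f2, V f1 -> V f2 ->
     (forall g, W g -> Phi f1 g = Phi f2 g) -> f1 = f2 %[ae P]) /\
  (forall L, dual W M L ->
     exists2 f, V f & forall g, W g -> Phi f g = L g) /\
  (exists C : R, forall f, V f -> (dual_norm W M (Phi f) <= C%:E * N f)%E) /\
  (exists C : R, forall f, V f -> (N f <= C%:E * dual_norm W M (Phi f))%E).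

End operators.

Section mixed_norm_spaces.
Context d1 d2 (A : measurableType d1) (B : measurableType d2) (R : realType)
  (mu : probability A R) (nu : probability B R) (k : scalar_kind).
Local Notation K := (scalar_field R k).

(* The elements of L^p(mu; L^q(nu; X)) are taken as functions on A * B. *)
Definition mixed_norm (p q : R) (X : normedModType K) (f : A * B -> X) :
    \bar R :=
  Lnorm mu p%:E (fun a => Lnorm nu q%:E (fun b => (rnorm (f (a, b)))%:E)).

Definition LpLq (p q : R) (X : normedModType K) : set (A * B -> X) :=
  [set f | strongly_measurable measurable f /\ (mixed_norm p q f < +oo)%E].

Definition LpLq_sub (F : set (set (A * B))) (p q : R) (X : normedModType K) :
    set (A * B -> X) :=
  [set f | LpLq p q f /\
     exists2 g, strongly_measurable F g & f = g %[ae (mu \x nu)%E]].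

Definition pairing (f g : A * B -> K^o) : K^o :=
  bochner (mu \x nu)%E setT (fun t => f t * g t : K^o).

End mixed_norm_spaces.

Arguments mixed_norm {d1 d2 A B R} mu nu {k} p q {X} f.
Arguments LpLq {d1 d2 A B R} mu nu {k} p q X.
Arguments LpLq_sub {d1 d2 A B R} mu nu {k} F p q X.
Arguments pairing {d1 d2 A B R} mu nu {k} f g.

(* Main.v *)
Require Import Defs.
From HB Require Import structures.
From mathcomp Require Import all_boot all_order all_algebra complex.
From mathcomp Require Import all_classical all_reals all_analysis.
From mathcomp Require Import measurable_realfun ring lra.

Set Implicit Arguments.
Unset Strict Implicit.
Unset Printing Implicit Defensive.

Import Order.TTheory GRing.Theory Num.Theory.
Import numFieldNormedType.Exports.

Local Open Scope classical_set_scope.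
Local Open Scope ring_scope.

(** Each of the three assertions is equivalent to the boundedness, for the
    mixed norm, of the conditional expectation E acting on nonnegative real
    functions, [rcond_bounded]; neither the Banach space X nor the scalar field
    matters.

    - This property is self-dual, [rcond_bounded_dual]. If g = E(f) is bounded,
      a norming function phi for g, [mnorm_extremal], scaled to norm one, gives
      the norm of g as the integral of g phi, which is that of g E(phi) and of
      f E(phi); the Hoelder inequality for mixed norms, [mnorm_hoelder], and
      the bound for E(phi) with the conjugate exponents conclude. The same
      argument bounds every F-measurable g whose integrals over the sets of F
      are at most those of f, [rcond_dominated].

    - The first assertion implies it, [rcond_bounded_projection], because
      E(f x) = E(f) x for a fixed vector x, and follows from it,
      [projection_rcond_dominated], because the integral of |E(f)| over a set of
      F is at most that of |f|, [le_cond_exp]. By self-duality the first two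
      assertions are equivalent. This part rests on the existence and the
      uniqueness of vector-valued Bochner integrals and conditional
      expectations, [is_bochner_exists], [is_cond_exp_exists] and
      [is_cond_exp_unique].

    - If E is bounded for p' and q', then testing the functional of f on the
      conditional expectation of a norming function for |f|, multiplied by the
      conjugate sign of f, shows that the norm of f is at most a multiple of
      the norm of the functional, [norming] and [le_mixed_norm_dual]. This
      yields injectivity and the bound for the inverse. For surjectivity, a
      functional L defines the measure D |-> L(1_D) on F, whose Radon-Nikodym
      density f represents L on the simple functions; the lower bound, applied
      to truncations of f, shows that f has finite norm, and f represents L by
      density, [functional_represented]. Together this is
      [rcond_bounded_isomorphism].

    - Conversely the lower bound in the third assertion, applied to truncations
      of E(f), bounds the norm of E(f) by the supremum of the integrals of
      |h| E(f), that is, of |h| f, over the F-measurable h of norm at most one;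
      the Hoelder inequality bounds it by the norm of f,
      [iso_rcond_bounded]. *)

(** * Scalars and real-valued norms *)

Section scalars.
Context (R : realType) (k : scalar_kind).
Local Notation K := (scalar_field R k).
Local Notation sr := (@scalar_of_real R k).
Local Notation re := (@real_of_scalar R k).

(** The imaginary part of a scalar; it is zero over the reals. *)
Definition imag_of_scalar : K -> R :=
  match k return scalar_field R k -> R with
  | RealScalars => fun _ => 0
  | ComplexScalars => fun z => complex.Im z
  end.

(** The imaginary unit of the scalar field. Over the reals it is set to zero,
    so that the decomposition of a scalar below is the same for both fields. *)
Definition imag_unit : K :=
  match k return scalar_field R k with
  | RealScalars => 0
  | ComplexScalars => 'i%C
  end.

(** The conjugate of a scalar; over the reals it is the identity. *)
Definition scalar_conj : K -> K :=
  match k return scalar_field R k -> scalar_field R k with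
  | RealScalars => id
  | ComplexScalars => fun z => conjc z
  end.

Lemma re_sr r : re (sr r) = r. Proof. by case: k. Qed.
Lemma sr0 : sr 0 = 0. Proof. by case: k. Qed.
Lemma sr1 : sr 1 = 1. Proof. by case: k. Qed.
Lemma srD r s : sr (r + s) = sr r + sr s.
Proof. by case: k => //=; exact: (rmorphD (real_complex R)). Qed.
Lemma srN r : sr (- r) = - sr r.
Proof. by case: k => //=; exact: (rmorphN (real_complex R)). Qed.
Lemma srB r s : sr (r - s) = sr r - sr s. Proof. by rewrite srD srN. Qed.
Lemma srM r s : sr (r * s) = sr r * sr s.
Proof. by case: k => //=; exact: (rmorphM (real_complex R)). Qed.
Lemma sr_norm r : `|sr r| = sr `|r|.
Proof. by case: k => //=; rewrite normc_def /= expr0n /= addr0 sqrtr_sqr. Qed.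
Lemma sr_le r s : (sr r <= sr s) = (r <= s).
Proof. by case: k => //=; rewrite lecR. Qed.
Lemma sr_lt r s : (sr r < sr s) = (r < s).
Proof. by case: k => //=; rewrite ltcR. Qed.
Lemma sr_eq0 r : (sr r == 0) = (r == 0).
Proof. by rewrite eq_le -sr0 !sr_le -eq_le. Qed.

Lemma ge0_srK (z : K) : 0 <= z -> sr (re z) = z.
Proof.
move: z; rewrite /scalar_of_real /real_of_scalar; case: k => //= -[a b].
by rewrite lecE /= => /andP[/eqP -> _].
Qed.

Lemma scalar_decomp (z : K) : z = sr (re z) + imag_unit * sr (imag_of_scalar z).
Proof.
move: z; rewrite /scalar_of_real /real_of_scalar /imag_unit /imag_of_scalar.
case: k => [z|z] /=; first by rewrite mulr0 addr0.
exact: complexE.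
Qed.

Lemma reD (y z : K) : re (y + z) = re y + re z.
Proof.
by move: y z; rewrite /real_of_scalar; case: k => //= -[a b] [c d].
Qed.
Lemma imD (y z : K) :
  imag_of_scalar (y + z) = imag_of_scalar y + imag_of_scalar z.
Proof.
move: y z; rewrite /imag_of_scalar.
by case: k => [y z|[a b] [c d]] //=; rewrite addr0.
Qed.
Lemma re_srM r (z : K) : re (sr r * z) = r * re z.
Proof.
move: z; rewrite /real_of_scalar /scalar_of_real; case: k => //= -[a b] /=.
by rewrite mul0r subr0.
Qed.
Lemma im_srM r (z : K) : imag_of_scalar (sr r * z) = r * imag_of_scalar z.
Proof.
move: z; rewrite /imag_of_scalar /scalar_of_real.
case: k => /= [z|[a b]] /=; first by rewrite mulr0.
by rewrite mul0r addr0.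
Qed.

End scalars.

Lemma norm_rnorm (R : realType) (k : scalar_kind)
  (X : normedModType (scalar_field R k)) (x : X) :
  `|x| = scalar_of_real k (rnorm x).
Proof. by rewrite /rnorm ge0_srK. Qed.

Section rnorm_theory.
Context (R : realType) (k : scalar_kind).
Local Notation K := (scalar_field R k).
Local Notation sr := (@scalar_of_real R k).
Context (X : normedModType K).
Implicit Types (x y : X) (c : K).

Lemma rnorm_ge0 x : 0 <= rnorm x.
Proof. by rewrite -(sr_le k) -norm_rnorm sr0. Qed.
Hint Resolve rnorm_ge0 : core.

Lemma rnorm0 : rnorm (0 : X) = 0.
Proof. by rewrite /rnorm normr0; case: k. Qed.

Lemma rnorm_eq0 x : (rnorm x == 0) = (x == 0).
Proof. by rewrite -(sr_eq0 k) -norm_rnorm normr_eq0. Qed.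

Lemma rnormN x : rnorm (- x) = rnorm x.
Proof. by rewrite /rnorm normrN. Qed.

Lemma rnormB x y : rnorm (x - y) = rnorm (y - x).
Proof. by rewrite -rnormN opprB. Qed.

Lemma ler_rnormD x y : rnorm (x + y) <= rnorm x + rnorm y.
Proof. by rewrite -(sr_le k) srD -!norm_rnorm ler_normD. Qed.

Lemma ler_rnormB x y : rnorm (x - y) <= rnorm x + rnorm y.
Proof. by rewrite -(rnormN y) ler_rnormD. Qed.

Lemma ler_rnorm_sub x y z : rnorm (x - z) <= rnorm (x - y) + rnorm (y - z).
Proof. by rewrite -[x - z](subrKA y); exact: ler_rnormD. Qed.

Lemma ler_dist_rnorm x y : `|rnorm x - rnorm y| <= rnorm (x - y).
Proof.
have h1 : rnorm x <= rnorm (x - y) + rnorm y by rewrite -{1}[x](subrK y) ler_rnormD.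
have h2 : rnorm y <= rnorm (x - y) + rnorm x.
  by rewrite rnormB -{1}[y](subrK x) ler_rnormD.
by rewrite ler_norml; apply/andP; split; lra.
Qed.

Lemma rnormZ c x : rnorm (c *: x) = rnorm (c : K^o) * rnorm x.
Proof.
apply/eqP; rewrite -subr_eq0 -(sr_eq0 k) srB srM -(norm_rnorm (c *: x)) normrZ.
by rewrite -(norm_rnorm (c : K^o)) -norm_rnorm subrr.
Qed.

Lemma rnormZr r x : rnorm (sr r *: x) = `|r| * rnorm x.
Proof. by rewrite rnormZ /rnorm sr_norm re_sr. Qed.

Lemma rnorm_cvgP (u : X^nat) (x : X) :
  u n @[n --> \oo] --> x <-> rnorm (u n - x) @[n --> \oo] --> (0 : R).
Proof.
split=> [/cvgrPdist_lt h|/cvgr0Pnorm_lt h].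
  apply/cvgr0Pnorm_lt => e e0.
  have /h : 0 < sr e by rewrite -(sr0 _ k) sr_lt.
  by apply: filterS => n; rewrite norm_rnorm sr_lt rnormB ger0_norm.
apply/cvgrPdist_lt => e e0.
have -> : e = sr (real_of_scalar e) by rewrite ge0_srK ?ltW.
have /h : 0 < real_of_scalar e by rewrite -(sr_lt k) ge0_srK ?ltW ?sr0.
by apply: filterS => n; rewrite norm_rnorm sr_lt rnormB ger0_norm.
Qed.

Lemma cvg_rnorm (u : X^nat) x :
  u n @[n --> \oo] --> x -> rnorm (u n) @[n --> \oo] --> rnorm x.
Proof.
move=> /rnorm_cvgP h; apply/subr_cvg0.
apply/norm_cvg0P; apply: (squeeze_cvgr _ _ h); last exact: cvg_cst.
by near=> n; rewrite normr_ge0 ler_dist_rnorm.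
Unshelve. all: by end_near. Qed.

Lemma rnorm_cvg_unique (u : X^nat) x y : rnorm (u n - x) @[n --> \oo] --> (0:R) ->
  rnorm (u n - y) @[n --> \oo] --> (0:R) -> x = y.
Proof.
move=> /rnorm_cvgP ux /rnorm_cvgP uy; exact: (cvg_unique _ ux uy).
Qed.

(** Completeness of a normed space, expressed with the real-valued norm. *)
Definition rcomplete := forall u : X^nat,
  (forall e : R, 0 < e -> exists N, forall m n, (N <= m)%N -> (N <= n)%N ->
     rnorm (u m - u n) < e) ->
  exists x : X, u n @[n --> \oo] --> x.

End rnorm_theory.
#[global] Hint Extern 0 (is_true (0 <= rnorm _)) => solve [apply: rnorm_ge0] : core.

Lemma complete_rcomplete (R : realType) (k : scalar_kind)
  (X : completeNormedModType (scalar_field R k)) : rcomplete X.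
Proof.
move=> u uc; suff /cauchy_cvgP : cauchy (u n @[n --> \oo]).
  by move=> /cvg_ex[x ux]; exists x.
apply/cauchy_ballP => e e0.
have re0 : 0 < real_of_scalar e by rewrite -(sr_lt k) ge0_srK ?ltW ?sr0.
have [N Nu] := uc _ re0.
rewrite near_map2; exists ([set n | (N <= n)%N], [set n | (N <= n)%N]).
  by split; exists N.
move=> [m n] /= [Nm Nn]; rewrite -ball_normE /= norm_rnorm.
by rewrite -[ltRHS]ge0_srK ?ltW// sr_lt Nu.
Qed.

Section scalar_norm.
Context (R : realType) (k : scalar_kind).
Local Notation K := (scalar_field R k).
Local Notation sr := (@scalar_of_real R k).
Local Notation re := (@real_of_scalar R k).

Lemma rnorm_sr r : rnorm (sr r : K^o) = `|r|.
Proof. by rewrite /rnorm sr_norm re_sr. Qed.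

Lemma rnormM (y z : K^o) : rnorm (y * z : K^o) = rnorm y * rnorm z.
Proof. by rewrite -rnormZ. Qed.

Lemma ler_re_rnorm (z : K^o) : `|re z| <= rnorm z.
Proof.
move: z; rewrite /rnorm /real_of_scalar; case: k => //= z.
by rewrite -lecR (le_trans (normc_ge_Re z))// {1}normc_def /= normc_def.
Qed.

Lemma ler_im_rnorm (z : K^o) : `|imag_of_scalar z| <= rnorm z.
Proof.
move: z; rewrite /rnorm /imag_of_scalar /real_of_scalar; case: k => /= z.
  by rewrite normr0.
by case: z => a b /=; rewrite -sqrtr_sqr ler_wsqrtr// lerDr sqr_ge0.
Qed.

Lemma rnorm_imag_unit : rnorm (imag_unit R k : K^o) <= 1.
Proof.
rewrite /rnorm /imag_unit /real_of_scalar; case: k => /=; first by rewrite normr0.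
by rewrite expr0n /= add0r expr1n sqrtr1.
Qed.

Lemma scalar_conjD (y z : K) : scalar_conj (y + z) = scalar_conj y + scalar_conj z.
Proof.
move: y z; rewrite /scalar_conj; case: k => //= y z; exact: (rmorphD (@conjc R)).
Qed.
Lemma scalar_conjN (y : K) : scalar_conj (- y) = - scalar_conj y.
Proof.
move: y; rewrite /scalar_conj; case: k => //= y; exact: (rmorphN (@conjc R)).
Qed.

Lemma rnorm_conj (z : K^o) : rnorm (scalar_conj z : K^o) = rnorm z.
Proof.
move: z; rewrite /scalar_conj /rnorm; case: k => //= -[a b].
by rewrite /= sqrrN.
Qed.

Lemma mul_conj (z : K^o) : z * scalar_conj z = sr (rnorm z ^+ 2).
Proof.
move: z; rewrite /scalar_conj /rnorm /scalar_of_real; case: k => /= z.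
  by rewrite real_normK ?num_real// expr2.
case: z => a b /=.
by rewrite sqr_sqrtr ?addr_ge0 ?sqr_ge0//; apply/eqP; rewrite eq_complex /=;
   apply/andP; split; apply/eqP; ring.
Qed.

Lemma scalar_rcomplete : rcomplete (K^o : normedModType K).
Proof.
move=> u uc.
have cf (f : K -> R) : (forall y z, f (y + z) = f y + f z) ->
    (forall z : K^o, `|f z| <= rnorm z) -> (forall y, f (- y) = - f y) ->
    exists l : R, f (u n) @[n --> \oo] --> l.
  move=> fD fle fN; apply/cvg_ex/cauchy_cvgP/cauchy_ballP => e e0.
  have [N Nu] := uc _ e0.
  rewrite near_map2; exists ([set n | (N <= n)%N], [set n | (N <= n)%N]).
    by split; exists N.
  move=> [m n] /= [Nm Nn]; rewrite -ball_normE /= -fN -fD.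
  exact: le_lt_trans (fle _) (Nu _ _ Nm Nn).
have [] := cf re; [exact: reD|exact: ler_re_rnorm| |move=> a ha].
  by move=> y; rewrite -mulN1r -(sr1 R k) -srN re_srM mulN1r.
have [] := cf (@imag_of_scalar R k); [exact: imD|exact: ler_im_rnorm| |move=> b hb].
  by move=> y; rewrite -mulN1r -(sr1 R k) -srN im_srM mulN1r.
exists (sr a + imag_unit R k * sr b); apply/rnorm_cvgP.
have h : `|re (u n) - a| + `|imag_of_scalar (u n) - b| @[n --> \oo] --> (0 : R).
  rewrite -[X in _ --> X]addr0.
  by apply: cvgD; apply/norm_cvg0P; apply/subr_cvg0.
apply: (squeeze_cvgr _ _ h); last exact: cvg_cst.
near=> n; rewrite rnorm_ge0 /= [X in X - _]scalar_decomp opprD addrACA -srB.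
rewrite -mulrBr -srB (le_trans (ler_rnormD _ _))// rnorm_sr lerD2l rnormM rnorm_sr.
by rewrite ler_piMl// rnorm_imag_unit.
Unshelve. all: by end_near. Qed.

End scalar_norm.

(** * Strong measurability *)

Section simple_functions.
Context d (T : measurableType d).

(** A function with finite range and measurable fibres, with values in any
    type. *)
Let simple (I : Type) (s : T -> I) :=
  finite_set (range s) /\ forall x, measurable (s @^-1` [set x]).

Lemma simple_preimage (I : choiceType) (s : T -> I) : simple s ->
  forall Y : set I, measurable (s @^-1` Y).
Proof.
move=> [fs ms] Y.
have -> : s @^-1` Y = \bigcup_(x in range s `&` Y) (s @^-1` [set x]).
  apply/seteqP; split=> [t Yt|t [x [_ Yx] /= sx]]; last by rewrite /= sx.
  by exists (s t) => //; split=> //; exists t.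
by apply: fin_bigcup_measurable => //; exact: finite_setIl.
Qed.

(** A function that depends on t through the value of a simple function and,
    for each of these values, measurably on t, is measurable. *)
Lemma simple_dependent_measurable (I : choiceType) d' (U : measurableType d')
    (s : T -> I) (g : I -> T -> U) : simple s ->
  (forall x, measurable_fun setT (g x)) ->
  measurable_fun setT (fun t => g (s t) t).
Proof.
move=> ss mg _ Y mY; rewrite setTI.
have -> : (fun t => g (s t) t) @^-1` Y =
    \bigcup_(x in range s) (s @^-1` [set x] `&` (g x @^-1` Y)).
  apply/seteqP; split=> [t Yt|t [x _ [/= <-]]]//.
  by exists (s t) => //; exists t.
apply: fin_bigcup_measurable => [|x _]; first by case: ss.
apply: measurableI; first by case: ss.
by rewrite -[X in measurable X]setTI; exact: mg.
Qed.

Lemma simple_pair (I J : choiceType) (s : T -> I) (u : T -> J) :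
  simple s -> simple u -> simple (fun t => (s t, u t)).
Proof.
move=> ss su; split.
  apply: (@sub_finite_set _ _ (range s `*` range u)); last first.
    by apply: finite_setX; [case: ss|case: su].
  by move=> _ [t _ <-]; split; exists t.
move=> [x y].
have -> : (fun t => (s t, u t)) @^-1` [set (x, y)] =
    s @^-1` [set x] `&` u @^-1` [set y].
  by apply/seteqP; split=> t /= [-> ->].
by apply: measurableI; [case: ss|case: su].
Qed.

Lemma simple_comp (I J : choiceType) (s : T -> I) (h : I -> J) :
  simple s -> simple (h \o s).
Proof.
move=> ss; split; last first.
  by move=> y; rewrite comp_preimage; exact: simple_preimage.
by rewrite -(image_comp s h); apply: finite_image; have [] := ss.
Qed.

Lemma simple_cst (I : Type) (x : I) : simple (cst x).
Proof.
split; last by move=> y; rewrite preimage_cst; case: ifP.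
by apply: (@sub_finite_set _ _ [set x]) => // _ [t _ <-].
Qed.

Lemma simple_if (I : choiceType) (D : set T) (s u : T -> I) : measurable D ->
  simple s -> simple u -> simple (fun t => if t \in D then s t else u t).
Proof.
move=> mD ss su.
have sD : simple (fun t => t \in D).
  split; first exact: finite_finset.
  move=> [].
    have -> : (fun t => t \in D) @^-1` [set true] = D.
      by apply/seteqP; split=> t /=; [exact: set_mem|exact: mem_set].
    by [].
  have -> : (fun t => t \in D) @^-1` [set false] = ~` D.
    apply/seteqP; split=> t /=; first by move=> + /mem_set Dt; rewrite Dt.
    by move=> Dt; apply/negbTE/negP => /set_mem.
  exact: measurableC.
have := simple_comp (fun z : bool * (I * I) => if z.1 then z.2.1 else z.2.2)
  (simple_pair sD (simple_pair ss su)).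
exact.
Qed.

End simple_functions.

Section strongly_measurable_theory.
Context d (T : measurableType d) (R : realType).
Local Notation sm := (strongly_measurable (@measurable d T)).

Section one_space.
Context (k : scalar_kind) (X : normedModType (scalar_field R k)).
Implicit Types f g : T -> X.

Lemma sm_simple f : simple_fun measurable f -> sm f.
Proof. by move=> sf; exists (fun _ => f); split=> // t; exact: cvg_cst. Qed.

Lemma sm_cst (x : X) : sm (cst x).
Proof. by apply: sm_simple; exact: simple_cst. Qed.

Lemma sm_rnormB f x : sm f -> measurable_fun setT (fun t => rnorm (f t - x)).
Proof.
move=> [s [ss sf]].
apply: (measurable_fun_cvg (h := fun n t => rnorm (s n t - x))) => [n|t _].
  apply: (simple_dependent_measurable (g := fun y _ => rnorm (y - x)) (ss n)).
  by move=> y; exact: measurable_cst.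
apply: cvg_rnorm; apply: cvgB; [exact: sf|exact: cvg_cst].
Qed.

Lemma sm_rnorm f : sm f -> measurable_fun setT (fun t => rnorm (f t)).
Proof.
move=> /(sm_rnormB 0); apply: eq_measurable_fun => t _; by rewrite subr0.
Qed.

(** A strongly measurable function has its values in the closure of a
    countable set: the values of the approximating simple functions. *)
Lemma sm_dense f : sm f -> exists x_ : nat -> X,
  forall t (e : R), 0 < e -> exists i, rnorm (f t - x_ i) < e.
Proof.
move=> [s [ss sf]].
have /choice[r rE] : forall n, exists r : seq X, range (s n) = [set` r].
  by move=> n; apply/finite_seqP; case: (ss n).
exists (fun i => if unpickle i is Some ni then nth 0 (r ni.1) ni.2 else 0) => t e e0.
have /rnorm_cvgP/cvgr0Pnorm_lt/(_ e e0)[n _ /(_ n (leqnn n)) /=] := sf t.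
rewrite ger0_norm// rnormB => ne.
have : s n t \in r n by have : range (s n) (s n t) by []; rewrite rE.
move=> /(nthP 0)[i _ sE]; exists (pickle (n, i)).
by rewrite pickleK /= sE.
Qed.

(** Pettis' criterion: separability of the range and measurability of the
    distances to fixed points imply strong measurability. Both properties
    pass to pointwise limits. *)
Lemma sm_of_dense f (x_ : nat -> X) :
  (forall x, measurable_fun setT (fun t => rnorm (f t - x))) ->
  (forall t (e : R), 0 < e -> exists i, rnorm (f t - x_ i) < e) -> sm f.
Proof.
move=> mf fx.
(* s n t is the best approximation of f t among x_ 0, ..., x_ n. *)
pose fix s n : T -> X := if n is m.+1 then
  (fun t => if t \in [set t | rnorm (f t - x_ n) < rnorm (f t - s m t)]
     then x_ n else s m t) else cst (x_ 0%N).
have ss n : simple_fun measurable (s n).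
  elim: n => [|n ih]; first exact: simple_cst.
  apply: (@simple_if _ _ X _ (cst (x_ n.+1)) (s n)) => //; last exact: simple_cst.
  rewrite -[X in measurable X]setTI; apply: measurable_fun_ltr => //.
  exact: (simple_dependent_measurable (g := fun y t => rnorm (f t - y)) ih).
have sle n i t : (i <= n)%N -> rnorm (f t - s n t) <= rnorm (f t - x_ i).
  elim: n => [|n ih]; first by rewrite leqn0 => /eqP ->.
  rewrite leq_eqVlt ltnS /= => /predU1P[->|/ih le_i].
    by case: ifPn => //; rewrite notin_setE /= => /negP; rewrite -leNgt.
  case: ifPn => //; rewrite inE /= => /ltW h; exact: le_trans h le_i.
exists s; split=> // t; apply/rnorm_cvgP/cvgr0Pnorm_lt => e /(fx t)[i ie].
exists i => // n /= /(sle _ _ t) ni.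
by rewrite ger0_norm// rnormB (le_lt_trans ni).
Qed.

Lemma sm_limit (f_ : (T -> X)^nat) f : (forall n, sm (f_ n)) ->
  (forall t, f_ n t @[n --> \oo] --> f t) -> sm f.
Proof.
move=> sf cf.
have /choice[r rE] := fun n => sm_dense (sf n).
apply: (@sm_of_dense f
  (* The union of the countable dense sets of all the f_ n. *)
  (fun i => if unpickle i is Some ni then r ni.1 ni.2 else 0)).
  move=> x; apply: (measurable_fun_cvg (h := fun n t => rnorm (f_ n t - x))).
    by move=> n; exact: sm_rnormB.
  by move=> t _; apply: cvg_rnorm; apply: cvgB; [exact: cf|exact: cvg_cst].
move=> t e e0; have e20 : 0 < e / 2 by rewrite divr_gt0.
have /rnorm_cvgP/cvgr0Pnorm_lt/(_ _ e20)[n _ /(_ n (leqnn n)) /=] := cf t.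
rewrite ger0_norm// => ne.
have [i ie] := rE n t _ e20.
exists (pickle (n, i)); rewrite pickleK /=.
apply: (le_lt_trans (ler_rnorm_sub _ (f_ n t) _)).
by rewrite [ltRHS](splitr e) ltrD// rnormB.
Qed.

End one_space.

Lemma sm_comp2 (k1 k2 k3 : scalar_kind) (X : normedModType (scalar_field R k1))
    (Y : normedModType (scalar_field R k2)) (Z : normedModType (scalar_field R k3))
    (h : X -> Y -> Z) (f : T -> X) (g : T -> Y) :
  (forall (u : X^nat) (v : Y^nat) x y, u n @[n --> \oo] --> x ->
     v n @[n --> \oo] --> y -> h (u n) (v n) @[n --> \oo] --> h x y) ->
  sm f -> sm g -> sm (fun t => h (f t) (g t)).
Proof.
move=> ch [s [ss sf]] [u [su ug]].
exists (fun n t => h (s n t) (u n t)); split=> [n|t]; last exact: ch.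
exact: (simple_comp (fun z => h z.1 z.2) (simple_pair (ss n) (su n))).
Qed.

Lemma sm_comp (k1 k3 : scalar_kind) (X : normedModType (scalar_field R k1))
    (Z : normedModType (scalar_field R k3)) (h : X -> Z) (f : T -> X) :
  (forall (u : X^nat) x, u n @[n --> \oo] --> x ->
     h (u n) @[n --> \oo] --> h x) ->
  sm f -> sm (fun t => h (f t)).
Proof.
move=> ch sf; apply: (@sm_comp2 _ _ _ X X Z (fun x _ => h x) f f) => //.
by move=> u _ x _ ux _; exact: ch.
Qed.

Section operations.
Context (k : scalar_kind) (X : normedModType (scalar_field R k)).
Implicit Types f g : T -> X.

Lemma smD f g : sm f -> sm g -> sm (fun t => f t + g t).
Proof. by apply: (@sm_comp2 _ _ _ X X X) => u v x y ux vy; exact: cvgD. Qed.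

Lemma smN f : sm f -> sm (fun t => - f t).
Proof. by apply: (@sm_comp _ _ X X) => u x ux; exact: cvgN. Qed.

Lemma smB f g : sm f -> sm g -> sm (fun t => f t - g t).
Proof. by move=> sf sg; exact: smD (smN sg). Qed.

Lemma smZ (c : T -> (scalar_field R k)^o) f :
  sm c -> sm f -> sm (fun t => c t *: f t).
Proof.
by apply: (@sm_comp2 _ _ _ (scalar_field R k)^o X X) => u v x y ux vy; exact: cvgZ.
Qed.

Lemma sm_sr (r : T -> R) : measurable_fun setT r ->
  sm (fun t => scalar_of_real k (r t) : (scalar_field R k)^o).
Proof.
move=> mr.
pose RR := (scalar_field R RealScalars)^o : normedModType (scalar_field R RealScalars).
apply: (@sm_comp _ _ RR (scalar_field R k)^o (@scalar_of_real R k)).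
  move=> u x /rnorm_cvgP h; apply/rnorm_cvgP.
  by under eq_fun do rewrite -srB rnorm_sr.
apply: (@sm_of_dense _ RR _ (fun i => if unpickle i is Some q then ratr q else 0)).
  by move=> x; apply: measurableT_comp => //; exact: measurable_funB.
move=> t e e0; have : r t - e < r t + e by lra.
move=> /rat_in_itvoo[q]; rewrite in_itv /= => /andP[q1 q2].
by exists (pickle q); rewrite pickleK /rnorm /= ltr_norml; apply/andP; split; lra.
Qed.

Lemma sm_if (D : set T) f g : measurable D -> sm f -> sm g ->
  sm (fun t => if t \in D then f t else g t).
Proof.
move=> mD [s [ss sf]] [u [su ug]].
exists (fun n t => if t \in D then s n t else u n t); split=> [n|t].
  exact: (simple_if mD (ss n) (su n)).
by case: ifP.
Qed.

Lemma sm_patch (D : set T) f : measurable D -> sm f -> sm (patch (cst 0) D f).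
Proof. by move=> mD sf; apply: sm_if => //; exact: sm_cst. Qed.

End operations.

End strongly_measurable_theory.

(** * The Bochner integral *)

Section ereal_limits.
Context (R : realType).
Local Open Scope ereal_scope.

(** Convergence to zero of nonnegative extended reals, without any assumption
    of finiteness. *)
Lemma ge0_cvge0P (u : (\bar R)^nat) : (forall n, 0 <= u n) ->
  u n @[n --> \oo] --> 0 <->
  forall e : R, (0 < e)%R -> \forall n \near \oo, u n <= e%:E.
Proof.
move=> u0; split.
  move=> /fine_cvgP[fu /cvgr0Pnorm_le h] e /h he.
  near=> n.
  have fn : u n \is a fin_num by near: n.
  rewrite -(fineK fn) lee_fin -[leLHS]ger0_norm ?fine_ge0//.
  by near: n.
move=> h; apply/fine_cvgP; split.
  apply: filterS (h 1%R ltr01) => n un.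
  by rewrite ge0_fin_numE// (le_lt_trans un)// ltry.
apply/cvgr0Pnorm_le => e /h; apply: filterS => n un /=.
rewrite ger0_norm ?fine_ge0// -lee_fin fineK//.
by rewrite ge0_fin_numE// (le_lt_trans un)// ltry.
Unshelve. all: by end_near. Qed.

End ereal_limits.

Section simple_bochner.
Context d (T : measurableType d) (R : realType) (P : probability T R).

Lemma integral_simple (I : choiceType) (u : T -> I) (c : I -> R) :
  finite_set (range u) -> (forall i, measurable (u @^-1` [set i])) ->
  (\int[P]_t (c (u t))%:E =
   (\sum_(i \in range u) fine (P (u @^-1` [set i])) * c i)%:E)%E.
Proof.
move=> fu mu; set r := finmap.enum_fset (fset_set (range u)).
have rP t : u t \in r by rewrite in_fset_set// inE; exists t.
transitivity (\int[P]_t \sum_(i <- r) ((c i)%:E * (\1_(u @^-1` [set i]) t)%:E))%E.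
  apply: eq_integral => t _; rewrite (bigD1_seq (u t)) ?finmap.fset_uniq//=.
  rewrite indicE mem_set//= mule1 big1_seq ?adde0// => i /andP[iu _].
  by rewrite indicE memNset ?mule0//= => ui; rewrite ui eqxx in iu.
have int1 i : P.-integrable setT (fun t => (\1_(u @^-1` [set i]) t)%:E : \bar R).
  exact: integrable_indic.
rewrite integral_sum//; last by move=> i; exact: integrableZl.
rewrite fsbig_finite//= -sumEFin; apply: eq_bigr => i _.
rewrite integralZl// integral_indic// setIT muleC EFinM fineK//.
exact: fin_num_measure.
Qed.

Section one_space.
Context (k : scalar_kind) (X : normedModType (scalar_field R k)).
Local Notation sr := (@scalar_of_real R k).

(** The integral of a simple function may be computed from any finite
    measurable partition on which the function is constant. *)
Lemma simple_bochner_comp (I : choiceType) (u : T -> I) (phi : I -> X) :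
  finite_set (range u) -> (forall i, measurable (u @^-1` [set i])) ->
  simple_bochner P (phi \o u) =
  \sum_(i \in range u) sr (fine (P (u @^-1` [set i]))) *: phi i.
Proof.
move=> fu mu; set r := finmap.enum_fset (fset_set (range u)).
have rP t : u t \in r by rewrite in_fset_set// inE; exists t.
have fphi : finite_set (range (phi \o u)).
  by rewrite -(image_comp u phi); exact: finite_image.
have PE x : fine (P ((phi \o u) @^-1` [set x])) =
    \sum_(i <- r) if phi i == x then fine (P (u @^-1` [set i])) else 0.
  have := integral_simple (fun i => (phi i == x)%:R) fu mu.
  have -> : (\int[P]_t ((phi (u t) == x)%:R)%:E)%E = P ((phi \o u) @^-1` [set x]).
    rewrite -[in RHS](setIT (_ @^-1` _)) -integral_indic//; last first.
      exact: (simple_preimage (conj fu mu) (phi @^-1` [set x])).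
    apply: eq_integral => t _; rewrite indicE.
    by case: eqP => h; [rewrite mem_set|rewrite memNset].
  move=> ->; rewrite /= fsbig_finite//=; apply: eq_bigr => i _.
  by case: eqP; rewrite ?mulr1 ?mulr0.
rewrite /simple_bochner fsbig_finite//= [in RHS]fsbig_finite//=.
under eq_bigr do rewrite PE (big_morph _ (srD k) (sr0 R k)) scaler_suml.
rewrite exchange_big/=; apply: eq_big_seq => i ir.
rewrite (bigD1_seq (phi i)) ?finmap.fset_uniq//=; last first.
  move: ir; rewrite in_fset_set// inE => -[t _ <-].
  by rewrite in_fset_set// inE; exists t.
rewrite eqxx big1 ?addr0// => x /negbTE; rewrite eq_sym => ->.
by rewrite sr0 scale0r.
Qed.

Lemma le_simple_bochner (s : T -> X) : simple_fun measurable s ->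
  ((rnorm (simple_bochner P s))%:E <= \int[P]_t (rnorm (s t))%:E)%E.
Proof.
move=> [fs ms]; rewrite (integral_simple (@rnorm R k X) fs ms) lee_fin.
rewrite /simple_bochner !fsbig_finite//=.
elim/big_ind2 : _ => [|x1 x2 y1 y2 le1 le2|x _]; first by rewrite rnorm0.
  by rewrite (le_trans (ler_rnormD _ _))// lerD.
by rewrite rnormZr ger0_norm// fine_ge0.
Qed.

Lemma simple_bochnerD (s u : T -> X) :
  simple_fun measurable s -> simple_fun measurable u ->
  simple_bochner P (fun t => s t + u t) = simple_bochner P s + simple_bochner P u.
Proof.
move=> ss su; have [fsu msu] := simple_pair ss su.
have /= -> := simple_bochner_comp (fun z : X * X => z.1 + z.2) fsu msu.
have /= -> := simple_bochner_comp (fun z : X * X => z.1) fsu msu.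
have /= -> := simple_bochner_comp (fun z : X * X => z.2) fsu msu.
rewrite -fsbig_split//=; apply: eq_fsbigr => z _; exact: scalerDr.
Qed.

End one_space.

Lemma simple_bochner_linear (k1 k2 : scalar_kind)
    (X : normedModType (scalar_field R k1)) (Y : normedModType (scalar_field R k2))
    (h : X -> Y) (s : T -> X) :
  (forall x y, h (x + y) = h x + h y) ->
  (forall r x, h (scalar_of_real k1 r *: x) = scalar_of_real k2 r *: h x) ->
  simple_fun measurable s ->
  simple_bochner P (fun t => h (s t)) = h (simple_bochner P s).
Proof.
move=> hD hZ [fs ms].
have /= -> := simple_bochner_comp h fs ms.
have h0 : h 0 = 0 by apply: (addrI (h 0)); rewrite -hD !addr0.
rewrite /simple_bochner !fsbig_finite//= (big_morph _ hD h0).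
by apply: eq_bigr => x _; rewrite hZ.
Qed.

End simple_bochner.

(** A strongly measurable function is the limit of simple functions that it
    dominates, up to a factor two. *)
Lemma sm_dominated d (T : measurableType d) (R : realType) (k : scalar_kind)
    (X : normedModType (scalar_field R k)) (f : T -> X) :
  strongly_measurable measurable f -> exists s : (T -> X)^nat,
  [/\ forall n, simple_fun measurable (s n),
      forall n t, rnorm (s n t) <= 2 * rnorm (f t) &
      forall t, s n t @[n --> \oo] --> f t].
Proof.
move=> smf; have [s [ss sf]] := smf.
pose D n := [set t | rnorm (s n t) <= 2 * rnorm (f t)].
exists (fun n t => if t \in D n then s n t else 0); split.
- move=> n; apply: (simple_if (u := cst (0 : X)) _ (ss n)); last exact: simple_cst.
  rewrite /D -[X in measurable X]setTI.
  apply: measurable_fun_ler => //.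
  + by apply: sm_rnorm; exact: sm_simple.
  + by apply: measurable_funM => //; exact: sm_rnorm.
- move=> n t; case: ifPn => [|_]; first by rewrite inE.
  by rewrite rnorm0 mulr_ge0.
- move=> t; have [ft0|ft0] := eqVneq (f t) 0.
    rewrite ft0; apply: (@cvg_trans _ (cst (0 : X) @ \oo)); last exact: cvg_cst.
    apply: near_eq_cvg; apply: nearW => n /=; case: ifPn => //.
    rewrite inE /D /= ft0 rnorm0 mulr0 => h; apply/esym/eqP.
    by rewrite -rnorm_eq0 eq_le h rnorm_ge0.
  apply: cvg_trans (sf t); apply: near_eq_cvg.
  have ft_gt0 : 0 < rnorm (f t) by rewrite lt_def rnorm_eq0 ft0 rnorm_ge0.
  have /rnorm_cvgP/cvgr0Pnorm_lt/(_ _ ft_gt0) := sf t.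
  apply: filterS => n; rewrite ger0_norm// => h.
  rewrite mem_set// /D /= -[s n t](subrK (f t)).
  by rewrite (le_trans (ler_rnormD _ _))// mulr_natl mulr2n lerD2r ltW.
Qed.

Section measurable_integrals.
Context d (T : measurableType d) (R : realType) (P : probability T R).
Local Open Scope ereal_scope.

Lemma int_rnorm_ge0 (k : scalar_kind) (X : normedModType (scalar_field R k))
  (f : T -> X) : 0 <= \int[P]_t (rnorm (f t))%:E.
Proof. by apply: integral_ge0 => t _; rewrite lee_fin. Qed.

Lemma int_rnormD (k : scalar_kind) (X : normedModType (scalar_field R k))
    (f g h : T -> X) : strongly_measurable measurable f ->
    strongly_measurable measurable g -> strongly_measurable measurable h ->
  \int[P]_t (rnorm (f t - h t)%R)%:E <=
  \int[P]_t (rnorm (f t - g t)%R)%:E + \int[P]_t (rnorm (g t - h t)%R)%:E.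
Proof.
move=> sf sg sh.
rewrite -ge0_integralD//; last 4 first.
- by move=> t _; rewrite lee_fin.
- by apply/measurable_EFinP; apply: sm_rnorm; exact: smB.
- by move=> t _; rewrite lee_fin.
- by apply/measurable_EFinP; apply: sm_rnorm; exact: smB.
apply: ge0_le_integral => //.
- by move=> t _; rewrite lee_fin.
- by apply/measurable_EFinP; apply: sm_rnorm; exact: smB.
- by apply: emeasurable_funD; apply/measurable_EFinP; apply: sm_rnorm; exact: smB.
- by move=> t _; rewrite -EFinD lee_fin ler_rnorm_sub.
Qed.

End measurable_integrals.

Section bochner_integral.
Context d (T : measurableType d) (R : realType) (P : probability T R).
Local Notation sm := (strongly_measurable (@measurable d T)).
Local Open Scope ereal_scope.

(** The Bochner integral over the whole space. *)
Definition Bint (k : scalar_kind) (X : normedModType (scalar_field R k))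
  (f : T -> X) : X := xget 0%R [set y | is_bochner P f y].

Section one_space.
Context (k : scalar_kind) (X : normedModType (scalar_field R k)).
Implicit Types f g : T -> X.

Lemma bochnerE (D : set T) f : bochner P D f = Bint (patch (cst 0%R) D f).
Proof. by []. Qed.

Lemma bochner_integrable_approx f : bochner_integrable P f ->
  exists s : (T -> X)^nat, (forall n, simple_fun measurable (s n)) /\
    \int[P]_t (rnorm (f t - s n t)%R)%:E @[n --> \oo] --> 0.
Proof.
move=> [smf intf]; have [s [ss sle sf]] := sm_dominated smf.
exists s; split=> //.
have mf : measurable_fun setT (fun t => (rnorm (f t))%:E).
  by apply/measurable_EFinP; exact: sm_rnorm.
have [|||||_ _] := @dominated_convergence _ _ _ P setT measurableT
    (fun n t => (rnorm (f t - s n t)%R)%:E) (cst 0) (fun t => (3 * rnorm (f t))%:E).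
- move=> n; apply/measurable_EFinP; apply: sm_rnorm; apply: smB => //.
  exact: sm_simple.
- exact: measurable_cst.
- apply: nearW => t _; apply: cvg_EFin; first by apply: nearW.
  have /rnorm_cvgP := sf t.
  by under eq_fun do rewrite rnormB.
- under eq_fun do rewrite EFinM; apply: integrableZl => //; apply/integrableP.
  by split=> //; under eq_integral do rewrite gee0_abs ?lee_fin//.
- apply: nearW => t n _; rewrite gee0_abs ?lee_fin//.
  rewrite (le_trans (ler_rnormB _ _))//; have := sle n t; lra.
- by rewrite integral0.
Qed.

(** All the properties of the Bochner integral follow from this estimate of
    its distance to the integral of a simple function. *)
Lemma is_bochner_dist f y (s : T -> X) : sm f -> is_bochner P f y ->
  simple_fun measurable s ->
  (rnorm (y - simple_bochner P s)%R)%:E <= \int[P]_t (rnorm (f t - s t)%R)%:E.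
Proof.
move=> smf [u [su /ge0_cvge0P hu uy]] ss.
apply/lee_addgt0Pr => e e0.
have e20 : (0 < e / 2)%R by rewrite divr_gt0.
have /rnorm_cvgP/cvgr0Pnorm_lt/(_ _ e20) h1 := uy.
have h2 := hu (fun n => int_rnorm_ge0 P _) _ e20.
have /filter_ex[n [{}h1 {}h2]] : \forall n \near \oo,
    (rnorm (simple_bochner P (u n) - y) < e / 2)%R /\
    \int[P]_t (rnorm (f t - u n t)%R)%:E <= (e / 2)%:E.
  by apply: filterS2 h1 h2 => n; rewrite ger0_norm.
have sumB : simple_bochner P (fun t => u n t - s t)%R =
    (simple_bochner P (u n) - simple_bochner P s)%R.
  have sN : simple_fun measurable (fun t => - s t)%R := simple_comp -%R ss.
  rewrite simple_bochnerD//.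
  rewrite (@simple_bochner_linear _ _ _ P _ _ X X -%R)//.
    by move=> x z; rewrite opprD.
  by move=> r x; rewrite scalerN.
apply: (@le_trans _ _ ((e / 2)%:E + (\int[P]_t (rnorm (u n t - f t)%R)%:E
    + \int[P]_t (rnorm (f t - s t)%R)%:E))).
  apply: le_trans; last first.
    apply: leeD; first exact: lexx.
    apply: int_rnormD => //; exact: sm_simple.
  apply: (@le_trans _ _ ((e / 2)%:E +
      (rnorm (simple_bochner P (u n) - simple_bochner P s)%R)%:E)).
    rewrite -EFinD lee_fin (le_trans (ler_rnorm_sub _ (simple_bochner P (u n)) _))//.
    by rewrite lerD2r rnormB ltW.
  rewrite leeD2l// -sumB le_simple_bochner//.
  exact: (simple_comp (fun z : X * X => z.1 - z.2)%R (simple_pair (su n) ss)).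
rewrite addeA [leRHS]addeC leeD2r// [in leRHS](splitr e) EFinD leeD2l//.
by under eq_integral do rewrite rnormB.
Qed.

Lemma le_is_bochner f y : sm f -> is_bochner P f y ->
  (rnorm y)%:E <= \int[P]_t (rnorm (f t))%:E.
Proof.
move=> sf fy; have := is_bochner_dist sf fy (simple_cst T (0 : X)%R).
have -> : simple_bochner P (cst (0 : X)%R) = 0%R.
  apply/eqP; rewrite -rnorm_eq0 eq_le rnorm_ge0 andbT -lee_fin.
  rewrite (le_trans (le_simple_bochner P (simple_cst T (0 : X)%R)))//.
  by under eq_integral do rewrite /= rnorm0; rewrite integral0.
by rewrite subr0; under eq_integral do rewrite subr0.
Qed.

Lemma is_bochner_of f y (s : (T -> X)^nat) : sm f ->
  (forall n, simple_fun measurable (s n)) ->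
  \int[P]_t (rnorm (f t - s n t)%R)%:E @[n --> \oo] --> 0 ->
  (forall n, (rnorm (y - simple_bochner P (s n))%R)%:E <=
     \int[P]_t (rnorm (f t - s n t)%R)%:E) ->
  is_bochner P f y.
Proof.
move=> sf ss hs le_y; exists s; split=> //.
apply/rnorm_cvgP/cvgr0Pnorm_le => e e0.
move/ge0_cvge0P in hs.
apply: filterS (hs (fun n => int_rnorm_ge0 P _) _ e0) => n.
by rewrite ger0_norm// rnormB -lee_fin; exact: le_trans (le_y n).
Qed.

Lemma is_bochner_unique f y z : sm f ->
  is_bochner P f y -> is_bochner P f z -> y = z.
Proof.
move=> sf fy [s [ss /ge0_cvge0P hs sz]].
apply: (rnorm_cvg_unique (u := fun n => simple_bochner P (s n))); last exact/rnorm_cvgP.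
apply/cvgr0Pnorm_le => e e0.
apply: filterS (hs (fun n => int_rnorm_ge0 P _) _ e0) => n.
by rewrite ger0_norm// rnormB -lee_fin; exact: le_trans (is_bochner_dist sf fy (ss n)).
Qed.

Lemma Bint_unique f y : sm f -> is_bochner P f y -> Bint f = y.
Proof.
by move=> sf fy; apply: (is_bochner_unique sf) => //; exact: xgetI fy.
Qed.

(** The integrals of simple functions that approximate f in L^1 form a Cauchy
    sequence. *)
Lemma is_bochner_exists f : rcomplete X -> bochner_integrable P f ->
  exists y, is_bochner P f y.
Proof.
move=> cX bf; have [s [ss hs]] := bochner_integrable_approx bf.
have [sf _] := bf.
have ms n : is_bochner P (s n) (simple_bochner P (s n)).
  apply: (@is_bochner_of _ _ (fun=> s n)) => //; first exact: sm_simple.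
    by under eq_fun do under eq_integral do rewrite subrr rnorm0;
      under eq_fun do rewrite integral0; exact: cvg_cst.
  by move=> _; rewrite subrr rnorm0 integral_ge0// => t _; rewrite lee_fin.
have hs' := hs; move/ge0_cvge0P in hs'.
have {}hs' := hs' (fun n => int_rnorm_ge0 P _).
suff [y sy] : exists y : X, simple_bochner P (s n) @[n --> \oo] --> y.
  by exists y; exists s.
apply: cX => e e0; have e30 : (0 < e / 3)%R by rewrite divr_gt0.
have [N _ hN] := hs' _ e30; exists N => m n Nm Nn.
rewrite -lte_fin (le_lt_trans (is_bochner_dist (sm_simple (ss m)) (ms m) (ss n)))//.
apply: (@le_lt_trans _ _ ((e / 3)%:E + (e / 3)%:E)); last first.
  by rewrite -EFinD lte_fin; lra.
apply: (le_trans (int_rnormD P (sm_simple (ss m)) sf (sm_simple (ss n)))).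
apply: leeD; last exact: hN.
by under eq_integral do rewrite rnormB; exact: hN.
Qed.

Lemma BintP f : rcomplete X -> bochner_integrable P f -> is_bochner P f (Bint f).
Proof.
by move=> cX /(is_bochner_exists cX)[y fy]; exact: xgetI fy.
Qed.

Lemma le_Bint f : rcomplete X -> bochner_integrable P f ->
  (rnorm (Bint f))%:E <= \int[P]_t (rnorm (f t))%:E.
Proof.
by move=> cX bf; apply: le_is_bochner (BintP cX bf); case: bf.
Qed.

Lemma is_bochnerD f g y z : sm f -> sm g -> is_bochner P f y ->
  is_bochner P g z -> is_bochner P (fun t => f t + g t)%R (y + z)%R.
Proof.
move=> sf sg [s [ss hs sy]] [u [su hu uz]].
exists (fun n t => s n t + u n t)%R; split.
- by move=> n; exact: (simple_comp (fun z => z.1 + z.2)%R (simple_pair (ss n) (su n))).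
- have h : \int[P]_t (rnorm (f t - s n t)%R)%:E + \int[P]_t (rnorm (g t - u n t)%R)%:E
      @[n --> \oo] --> 0 by rewrite -[X in _ --> X]adde0; exact: cvgeD.
  apply: squeeze_cvge h; last exact: cvg_cst.
  near=> n; rewrite int_rnorm_ge0 /=.
  have ms1 := sm_simple (ss n); have mu1 := sm_simple (su n).
  rewrite -ge0_integralD//; last 4 first.
  + by move=> t _; rewrite lee_fin.
  + by apply/measurable_EFinP; apply: sm_rnorm; exact: smB.
  + by move=> t _; rewrite lee_fin.
  + by apply/measurable_EFinP; apply: sm_rnorm; exact: smB.
  apply: ge0_le_integral => //.
  + by move=> t _; rewrite lee_fin.
  + by apply/measurable_EFinP; apply: sm_rnorm; apply: smB; exact: smD.
  + by apply: emeasurable_funD; apply/measurable_EFinP; apply: sm_rnorm; exact: smB.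
  + by move=> t _; rewrite -EFinD lee_fin opprD addrACA ler_rnormD.
- under eq_fun do rewrite simple_bochnerD//.
  exact: cvgD.
Unshelve. all: by end_near. Qed.

End one_space.

(** Bounded real-linear maps commute with the Bochner integral. The two
    spaces need not have the same scalar field: the map may be the embedding
    of the real line into X, as r |-> r x. *)
Lemma is_bochner_linear (k1 k2 : scalar_kind)
    (X : normedModType (scalar_field R k1)) (Y : normedModType (scalar_field R k2))
    (h : X -> Y) (C : R) (f : T -> X) (y : X) :
  (forall x y, h (x + y) = h x + h y)%R ->
  (forall r x, h (scalar_of_real k1 r *: x) = scalar_of_real k2 r *: h x)%R ->
  (forall x, (rnorm (h x) <= C * rnorm x)%R) ->
  sm f -> is_bochner P f y -> sm (fun t => h (f t)) /\
    is_bochner P (fun t => h (f t)) (h y).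
Proof.
move=> hD hZ hC sf [s [ss hs sy]].
have h0 : h 0%R = 0%R by apply: (addrI (h 0%R)); rewrite -hD !addr0.
have hB x z : (h x - h z = h (x - z))%R.
  by apply: (addIr (h z)); rewrite subrK -hD subrK.
(* The constant is enlarged to be positive. *)
wlog C0 : C hC / (0 < C)%R.
  move=> /(_ (`|C| + 1)%R); apply => [x|]; last by rewrite ltr_wpDl.
  by rewrite (le_trans (hC x))// ler_wpM2r// (le_trans (ler_norm C))// lerDl.
have hcvg (u : X^nat) x : u n @[n --> \oo] --> x -> h (u n) @[n --> \oo] --> h x.
  move=> /rnorm_cvgP/cvgr0Pnorm_le ux; apply/rnorm_cvgP/cvgr0Pnorm_le => e e0.
  have eC0 : (0 < C^-1 * e)%R by rewrite mulr_gt0// invr_gt0.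
  apply: filterS (ux _ eC0) => n; rewrite !ger0_norm// hB => le_e.
  by rewrite (le_trans (hC _))// -ler_pdivlMl.
have smh (g : T -> X) : sm g -> sm (fun t => h (g t)) by exact: sm_comp.
split; first exact: smh.
exists (fun n t => h (s n t)); split.
- by move=> n; exact: (simple_comp h (ss n)).
- have hC' : C%:E * \int[P]_t (rnorm (f t - s n t)%R)%:E @[n --> \oo] --> 0.
    by rewrite -(mule0 C%:E); apply: cvgeZl.
  apply: squeeze_cvge hC'; last exact: cvg_cst.
  near=> n; rewrite int_rnorm_ge0 /=.
  have sn := sm_simple (ss n).
  have mfs : measurable_fun setT (fun t => (rnorm (f t - s n t)%R)%:E).
    by apply/measurable_EFinP; apply: sm_rnorm; exact: smB.
  rewrite -ge0_integralZl_EFin//; [|by move=> t _; rewrite lee_fin|exact: ltW].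
  apply: ge0_le_integral => //.
  + by move=> t _; rewrite lee_fin.
  + by apply/measurable_EFinP; apply: sm_rnorm; apply: smB; exact: smh.
  + exact: measurable_funeM.
  + by move=> t _; rewrite -EFinM lee_fin hB.
- under eq_fun do rewrite simple_bochner_linear//.
  exact: hcvg.
Unshelve. all: by end_near. Qed.

(** For real functions the Bochner and the Lebesgue integrals agree. *)
Lemma is_bochner_real (f : T -> R) : P.-integrable setT (EFin \o f) ->
  is_bochner P (f : T -> (scalar_field R RealScalars)^o) (fine (\int[P]_t (f t)%:E)).
Proof.
move=> intf; pose RR := (scalar_field R RealScalars)^o : normedModType (scalar_field R RealScalars).
have mf : measurable_fun setT f by apply/measurable_EFinP; case/integrableP: intf.
have smf : sm (f : T -> RR) := sm_sr RealScalars mf.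
have bf : bochner_integrable P (f : T -> RR) by split=> //; case/integrableP: intf.
have [s [ss hs]] := bochner_integrable_approx bf.
apply: (is_bochner_of smf ss hs) => n.
have sE : (\int[P]_t ((s n t : R))%:E)%E = (simple_bochner P (s n) : R)%:E.
  have [fs ms] := ss n.
  exact: (integral_simple P (id : R -> R) fs ms).
have ints : P.-integrable setT (EFin \o (s n : T -> R)).
  apply/integrableP; split.
    apply/measurable_EFinP.
    exact: (simple_dependent_measurable (g := fun y _ => (y : R)) (ss n)).
  have [fs ms] := ss n.
  by rewrite (integral_simple P (fun x : R => `|x|%R) fs ms) ltry.
have -> : (rnorm ((fine (\int[P]_t (f t)%:E) : RR) - simple_bochner P (s n))%R)%:E =
    `|\int[P]_t (f t)%:E - \int[P]_t ((s n t : R))%:E|.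
  rewrite sE -[in RHS](fineK (integrable_fin_num measurableT intf)) -EFinB.
  by [].
rewrite -integralB// -/RR; apply: (le_trans (le_abse_integral _ _ _)) => //.
by apply: emeasurable_funB; [case/integrableP: intf|case/integrableP: ints].
Qed.

End bochner_integral.

(** * Mixed Lebesgue norms *)

Section poweR_lemmas.
Context (R : realType).
Local Open Scope ereal_scope.

Lemma le_poweR (r : R) (x y : \bar R) : (0 <= r)%R -> 0 <= x -> x <= y ->
  x `^ r <= y `^ r.
Proof.
move=> r0 x0 xy; apply: gt0_ler_poweR => //; rewrite in_itv /= leey andbT//.
exact: le_trans xy.
Qed.

Lemma poweRK (r : R) (x : \bar R) : r != 0%R -> 0 <= x -> (x `^ r) `^ r^-1 = x.
Proof. by move=> r0 x0; rewrite -poweRrM mulfV// poweRe1. Qed.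

Lemma poweRVK (r : R) (x : \bar R) : r != 0%R -> 0 <= x -> (x `^ r^-1) `^ r = x.
Proof. by move=> r0 x0; rewrite -poweRrM mulVf// poweRe1. Qed.

Lemma cvge0_poweR (r : R) (u : (\bar R)^nat) : (0 < r)%R -> (forall n, 0 <= u n) ->
  u n @[n --> \oo] --> 0 -> u n `^ r @[n --> \oo] --> 0.
Proof.
move=> r0 u0 /(ge0_cvge0P u0) h; apply/ge0_cvge0P; first by move=> n; exact: poweR_ge0.
move=> e e0; apply: filterS (h (e `^ r^-1)%R _) => [n un|]; last exact: powR_gt0.
have e0' := ltW e0; rewrite -[leRHS](@poweRVK r) ?gt_eqF ?lee_fin//.
by apply: le_poweR => //; exact: ltW.
Qed.

Lemma nd_cvg_poweR (r : R) (u : (\bar R)^nat) (l : \bar R) : (0 < r)%R ->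
  (forall n, 0 <= u n) -> nondecreasing_seq u -> u n @[n --> \oo] --> l ->
  u n `^ r @[n --> \oo] --> l `^ r.
Proof.
move=> r0 u0 nd ul.
have le_ul n : u n <= l.
  have -> : l = ereal_sup (range u).
    by apply: (cvg_unique _ ul) => //; exact: ereal_nondecreasing_cvgn.
  by apply: ereal_sup_ubound; exists n.
have ndr : nondecreasing_seq (fun n => u n `^ r).
  by move=> i j ij; apply: le_poweR; [exact: ltW|exact: u0|exact: nd].
have := ereal_nondecreasing_cvgn ndr; set S := ereal_sup _.
have S0 : 0 <= S by apply: le_trans (ereal_sup_ubound (ex_intro2 _ _ 0%N I erefl)); exact: poweR_ge0.
suff -> : S = l `^ r by [].
apply/eqP; rewrite eq_le; apply/andP; split.
  apply: ge_ereal_sup => _ [n _ <-]; by apply: le_poweR; [exact: ltW|exact: u0|].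
rewrite -[leRHS](@poweRVK r) ?gt_eqF//; apply: le_poweR; first exact: ltW.
  exact: le_trans (le_ul 0%N).
rewrite -(cvg_lim _ ul)//; apply: lime_le; first by apply/cvg_ex; exists l.
apply: nearW => n; rewrite -[leLHS](@poweRK r) ?gt_eqF//; apply: le_poweR.
- by rewrite invr_ge0 ltW.
- exact: poweR_ge0.
- by apply: ereal_sup_ubound; exists n.
Qed.

End poweR_lemmas.

Section Lnorm_lemmas.
Context d (T : measurableType d) (R : realType) (m : {measure set T -> \bar R}).
Local Open Scope ereal_scope.
Implicit Types (f g : T -> \bar R) (p : R).

Lemma measurable_abse_poweR f p : measurable_fun setT f ->
  measurable_fun setT (fun x => `|f x| `^ p).
Proof.
move=> mf; apply: (@measurableT_comp _ _ _ _ _ _ (fun x => x `^ p)) => //=.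
  exact: (measurableT_comp (measurable_poweR _)).
exact: measurableT_comp.
Qed.

Lemma ae_le_Lnorm f g p : (0 < p)%R -> measurable_fun setT f ->
  measurable_fun setT g -> {ae m, forall x, `|f x| <= `|g x|} ->
  Lnorm m p%:E f <= Lnorm m p%:E g.
Proof.
move=> p0 mf mg fg; rewrite unlock; apply: le_poweR.
- by rewrite invr_ge0 ltW.
- by apply: integral_ge0 => x _; exact: poweR_ge0.
apply: ae_ge0_le_integral => //.
- by move=> x _; exact: poweR_ge0.
- exact: measurable_abse_poweR.
- by move=> x _; exact: poweR_ge0.
- exact: measurable_abse_poweR.
by apply: filterS fg => x fg _; apply: le_poweR => //; exact: ltW.
Qed.

Lemma le_Lnorm f g p : (0 < p)%R -> measurable_fun setT f ->
  measurable_fun setT g -> (forall x, `|f x| <= `|g x|) ->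
  Lnorm m p%:E f <= Lnorm m p%:E g.
Proof. by move=> p0 mf mg fg; apply: ae_le_Lnorm => //; exact: nearW. Qed.

Lemma Lnorm_cvg (f_ : (T -> \bar R)^nat) f p : (0 < p)%R ->
  (forall n, measurable_fun setT (f_ n)) -> (forall n x, 0 <= f_ n x) ->
  (forall x, nondecreasing_seq (f_ ^~ x)) ->
  (forall x, f_ n x @[n --> \oo] --> f x) ->
  Lnorm m p%:E (f_ n) @[n --> \oo] --> Lnorm m p%:E f.
Proof.
move=> p0 mf f0 nd fl.
have fl0 x : 0 <= f x.
  by apply: (cvge_ge _ (fl x)); apply: nearW => n; exact: f0.
rewrite unlock; apply: nd_cvg_poweR.
- by rewrite invr_gt0.
- by move=> n; apply: integral_ge0 => x _; exact: poweR_ge0.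
- move=> i j ij; apply: ge0_le_integral => //.
  + by move=> x _; exact: poweR_ge0.
  + exact: measurable_abse_poweR.
  + exact: measurable_abse_poweR.
  + by move=> x _; apply: le_poweR; [exact: ltW| |rewrite !gee0_abs//; exact: nd].
have -> : (\int[m]_x `|f x| `^ p = \int[m]_x limn (fun n => `|f_ n x| `^ p))%E.
  apply: eq_integral => x _; apply/esym/cvg_lim => //; rewrite gee0_abs//.
  by under eq_fun do rewrite gee0_abs//; exact: nd_cvg_poweR.
apply: cvg_monotone_convergence => //.
- by move=> n; exact: measurable_abse_poweR.
- by move=> n x _; exact: poweR_ge0.
- move=> x _ i j ij.
  by apply: le_poweR; [exact: ltW| |rewrite !gee0_abs//; exact: nd].
Qed.

Lemma Lnorm_integrable f p : (0 < p)%R -> measurable_fun setT f ->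
  Lnorm m p%:E f < +oo -> m.-integrable setT (fun x => `|f x| `^ p).
Proof.
move=> p0 mf fp; apply/integrableP; split; first exact: measurable_abse_poweR.
under eq_integral do rewrite gee0_abs ?poweR_ge0//.
move: fp; rewrite unlock; apply: lty_poweRy; by rewrite invr_eq0 gt_eqF.
Qed.

Lemma Lnorm_ae_fin f p : (0 < p)%R -> measurable_fun setT f ->
  Lnorm m p%:E f < +oo -> {ae m, forall x, f x \is a fin_num}.
Proof.
move=> p0 mf /(Lnorm_integrable p0 mf)/integrable_ae => /(_ measurableT).
apply: filterS => x /(_ I) h; rewrite -abse_fin_num ge0_fin_numE//.
apply: (@lty_poweRy _ _ p); first by rewrite gt_eqF.
by rewrite -ge0_fin_numE// poweR_ge0.
Qed.

Lemma Lnorm_dominated_cvg0 (f_ : (T -> \bar R)^nat) g p : (0 < p)%R ->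
  (forall n, measurable_fun setT (f_ n)) -> measurable_fun setT g ->
  (forall n x, 0 <= f_ n x <= g x) -> Lnorm m p%:E g < +oo ->
  {ae m, forall x, f_ n x @[n --> \oo] --> 0} ->
  Lnorm m p%:E (f_ n) @[n --> \oo] --> 0.
Proof.
move=> p0 mf mg fg gp f0; rewrite unlock; apply: cvge0_poweR.
- by rewrite invr_gt0.
- by move=> n; apply: integral_ge0 => x _; exact: poweR_ge0.
have [|||||_ _] := @dominated_convergence _ _ _ m setT measurableT
    (fun n x => `|f_ n x| `^ p) (cst 0) (fun x => `|g x| `^ p).
- by move=> n; exact: measurable_abse_poweR.
- exact: measurable_cst.
- apply: filterS f0 => x fx _; apply: cvge0_poweR => //.
  by under eq_fun do rewrite gee0_abs ?(andP (fg _ x)).1//.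
- exact: Lnorm_integrable.
- apply: nearW => x n _; have /andP[f1 f2] := fg n x.
  rewrite gee0_abs ?poweR_ge0//; apply: le_poweR; [exact: ltW|by []|].
  by rewrite !gee0_abs// (le_trans f1).
- by rewrite integral0.
Qed.

Lemma LnormZ f p (c : R) : (0 < p)%R -> (0 <= c)%R -> measurable_fun setT f ->
  Lnorm m p%:E (fun x => c%:E * f x) = c%:E * Lnorm m p%:E f.
Proof.
move=> p0 c0 mf; rewrite unlock.
under eq_integral do rewrite abseM poweRM// poweR_EFin ger0_norm//.
rewrite ge0_integralZl_EFin ?powR_ge0//; last 2 first.
- by move=> x _; exact: poweR_ge0.
- exact: measurable_abse_poweR.
rewrite poweRM ?lee_fin ?powR_ge0//; last first.
  by apply: integral_ge0 => x _; exact: poweR_ge0.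
by rewrite -poweR_EFin poweRK ?gt_eqF.
Qed.

(** The Hoelder inequality for nonnegative extended-valued functions: infinite
    values are allowed on both sides. *)
Lemma integral_hoelder f g p q : (0 < p)%R -> (0 < q)%R -> (p^-1 + q^-1 = 1)%R ->
  measurable_fun setT f -> measurable_fun setT g ->
  (forall x, 0 <= f x) -> (forall x, 0 <= g x) ->
  \int[m]_x (f x * g x) <= Lnorm m p%:E f * Lnorm m q%:E g.
Proof.
move=> p0 q0 pq mf mg f0 g0.
have mfg : measurable_fun setT (fun x => f x * g x) by exact: emeasurable_funM.
have zero (h : T -> \bar R) r : (0 < r)%R -> measurable_fun setT h ->
    (forall x, h x = 0 -> f x * g x = 0) -> Lnorm m r%:E h = 0 ->
    \int[m]_x (f x * g x) = 0.
  move=> r0 mh h0 /(Lnorm_eq0_eq0 mh) hr.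
  rewrite (ge0_ae_eq_integral _ mfg (g := cst 0))//.
  - by rewrite integral0.
  - by move=> x _; rewrite mule_ge0.
  - have := hr; rewrite lte_fin => /(_ r0); apply: filterS => x h1 _.
    by rewrite h0// h1.
have [f00|f00] := eqVneq (Lnorm m p%:E f) 0.
  by rewrite (zero f p)// ?f00 ?mul0e// => x ->; rewrite mul0e.
have [g00|g00] := eqVneq (Lnorm m q%:E g) 0.
  by rewrite (zero g q)// ?g00 ?mule0// => x ->; rewrite mule0.
have {f00} fpos : 0 < Lnorm m p%:E f by rewrite lt0e f00 Lnorm_ge0.
have {g00} gpos : 0 < Lnorm m q%:E g by rewrite lt0e g00 Lnorm_ge0.
have [foo|] := eqVneq (Lnorm m p%:E f) +oo; first by rewrite foo gt0_mulye ?leey.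
have [goo|] := eqVneq (Lnorm m q%:E g) +oo; first by rewrite goo gt0_muley ?leey.
rewrite -!ltey => gfin ffin.
have aef := Lnorm_ae_fin p0 mf ffin.
have aeg := Lnorm_ae_fin q0 mg gfin.
have mff : measurable_fun setT (fine \o f) by exact: measurableT_comp.
have mgf : measurable_fun setT (fine \o g) by exact: measurableT_comp.
have := hoelder m mff mgf p0 q0 pq; rewrite Lnorm1.
have fine_le (h : T -> \bar R) r : (0 < r)%R -> measurable_fun setT h ->
    Lnorm m r%:E (EFin \o (fine \o h)) <= Lnorm m r%:E h.
  move=> r0 mh; apply: le_Lnorm => //.
    by apply/measurable_EFinP; exact: measurableT_comp.
  by move=> x /=; case: (h x) => [z| |] //=; rewrite normr0 ?leey.
move=> h; apply: le_trans (lee_pmul (Lnorm_ge0 _ _ _) (Lnorm_ge0 _ _ _)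
  (fine_le f p p0 mf) (fine_le g q q0 mg)).
apply: le_trans h; apply: ae_ge0_le_integral => //.
- by move=> x _; rewrite mule_ge0.
- by apply: measurableT_comp => //; apply/measurable_EFinP; exact: measurable_funM.
apply: filterS2 aef aeg => x fx gx _ /=.
by rewrite ger0_norm ?mulr_ge0 ?fine_ge0// EFinM !fineK.
Qed.

End Lnorm_lemmas.

(** Almost all sections of a null set of the product are null sets. *)
Lemma ae_product d1 d2 (A : measurableType d1) (B : measurableType d2)
    (R : realType) (mu : probability A R) (nu : probability B R)
    (Q : A * B -> Prop) : {ae (mu \x nu)%E, forall z, Q z} ->
  {ae mu, forall a, {ae nu, forall b, Q (a, b)}}.
Proof.
move=> [N [mN N0 QN]].
have mf : measurable_fun setT (fun a => nu (xsection N a)).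
  exact: measurable_fun_xsection.
have : (\int[mu]_a `|nu (xsection N a)| = 0)%E.
  by under eq_integral do rewrite gee0_abs//.
move=> /(ae_eq_integral_abs mu measurableT mf); apply: filterS => a /= /(_ I) Na.
exists (xsection N a); split=> //; first exact: measurable_xsection.
by move=> b /= Qab; rewrite /xsection /= inE; exact: QN.
Qed.

Section mixed_norm_lemmas.
Context d1 d2 (A : measurableType d1) (B : measurableType d2) (R : realType)
  (mu : probability A R) (nu : probability B R).
Local Open Scope ereal_scope.
Local Notation P := (mu \x nu).
Implicit Types (f g h : A * B -> \bar R) (p q : R).

(** The mixed norm of a function with extended real values. *)
Definition mnorm p q f : \bar R :=
  Lnorm mu p%:E (fun a => Lnorm nu q%:E (fun b => f (a, b))).

Lemma mnorm_ge0 p q f : 0 <= mnorm p q f. Proof. exact: Lnorm_ge0. Qed.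

Lemma measurable_section f a : measurable_fun setT f ->
  measurable_fun setT (fun b => f (a, b)).
Proof. by move=> mf; exact: measurableT_comp. Qed.

Lemma measurable_inner_norm f q : measurable_fun setT f ->
  measurable_fun setT (fun a => Lnorm nu q%:E (fun b => f (a, b))).
Proof.
move=> mf; rewrite unlock.
apply: (@measurableT_comp _ _ _ _ _ _ (fun x => x `^ q^-1)) => //=.
  exact: (measurableT_comp (measurable_poweR _)).
apply: (measurable_fun_fubini_tonelli_F (fun z => `|f z| `^ q)).
  exact: measurable_abse_poweR.
by move=> z; exact: poweR_ge0.
Qed.

Lemma ae_le_mnorm f g p q : (0 < p)%R -> (0 < q)%R -> measurable_fun setT f ->
  measurable_fun setT g -> {ae P, forall z, `|f z| <= `|g z|} ->
  mnorm p q f <= mnorm p q g.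
Proof.
move=> p0 q0 mf mg /ae_product fg; apply: ae_le_Lnorm => //.
- exact: measurable_inner_norm.
- exact: measurable_inner_norm.
apply: filterS fg => a fg; rewrite !gee0_abs ?Lnorm_ge0//.
by apply: ae_le_Lnorm => //; exact: measurable_section.
Qed.

Lemma le_mnorm f g p q : (0 < p)%R -> (0 < q)%R -> measurable_fun setT f ->
  measurable_fun setT g -> (forall z, `|f z| <= `|g z|) ->
  mnorm p q f <= mnorm p q g.
Proof. by move=> p0 q0 mf mg fg; apply: ae_le_mnorm => //; exact: nearW. Qed.

Lemma mnorm_cvg (f_ : (A * B -> \bar R)^nat) f p q : (0 < p)%R -> (0 < q)%R ->
  (forall n, measurable_fun setT (f_ n)) -> (forall n z, 0 <= f_ n z) ->
  (forall z, nondecreasing_seq (f_ ^~ z)) ->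
  (forall z, f_ n z @[n --> \oo] --> f z) ->
  mnorm p q (f_ n) @[n --> \oo] --> mnorm p q f.
Proof.
move=> p0 q0 mf f0 nd fl; apply: Lnorm_cvg => //.
- by move=> n; exact: measurable_inner_norm.
- by move=> n a; exact: Lnorm_ge0.
- move=> a m n mn; apply: le_Lnorm => //; try exact: measurable_section.
  by move=> b; rewrite !gee0_abs//; exact: nd.
- by move=> a; apply: Lnorm_cvg => // n; exact: measurable_section.
Qed.

(** The mixed norm of an increasing limit is the limit of the mixed norms, by
    monotone convergence in both variables. *)
Lemma mnorm_sup_le (f_ : (A * B -> \bar R)^nat) f p q (M : \bar R) :
  (0 < p)%R -> (0 < q)%R ->
  (forall n, measurable_fun setT (f_ n)) -> (forall n z, 0 <= f_ n z) ->
  (forall z, nondecreasing_seq (f_ ^~ z)) ->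
  (forall z, f_ n z @[n --> \oo] --> f z) ->
  (forall n, mnorm p q (f_ n) <= M) -> mnorm p q f <= M.
Proof.
move=> p0 q0 mf f0 nd fl le_M.
by apply: (cvge_le _ (mnorm_cvg p0 q0 mf f0 nd fl)); exact: nearW.
Qed.

(** Dominated convergence for the mixed norm: the inner norms tend to zero for
    almost all a, and they are dominated by the inner norms of g. *)
Lemma mnorm_dominated_cvg0 (f_ : (A * B -> \bar R)^nat) g p q :
  (0 < p)%R -> (0 < q)%R ->
  (forall n, measurable_fun setT (f_ n)) -> measurable_fun setT g ->
  (forall n z, 0 <= f_ n z <= g z) -> mnorm p q g < +oo ->
  (forall z, f_ n z @[n --> \oo] --> 0) ->
  mnorm p q (f_ n) @[n --> \oo] --> 0.
Proof.
move=> p0 q0 mf mg fg gfin f0.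
have mig := measurable_inner_norm q mg.
apply: (Lnorm_dominated_cvg0 (g := fun a => Lnorm nu q%:E (fun b => g (a, b)))) => //.
- by move=> n; exact: measurable_inner_norm.
- move=> n a; rewrite Lnorm_ge0/=; apply: le_Lnorm => //; try exact: measurable_section.
  by move=> b; have /andP[f1 f2] := fg n (a, b); rewrite !gee0_abs// (le_trans f1).
apply: filterS (Lnorm_ae_fin p0 mig gfin) => a ga.
apply: (Lnorm_dominated_cvg0 (g := fun b => g (a, b))) => //.
- by move=> n; exact: measurable_section.
- exact: measurable_section.
- by rewrite -ge0_fin_numE// Lnorm_ge0.
- exact: nearW.
Qed.

Lemma mnormZ f p q (c : R) : (0 < p)%R -> (0 < q)%R -> (0 <= c)%R ->
  measurable_fun setT f ->
  mnorm p q (fun z => c%:E * f z) = c%:E * mnorm p q f.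
Proof.
move=> p0 q0 c0 mf; rewrite /mnorm -LnormZ//; last exact: measurable_inner_norm.
congr Lnorm; apply/funext => a; rewrite LnormZ//; exact: measurable_section.
Qed.

(** The Hoelder inequality in b, and then in a. *)
Lemma mnorm_hoelder f g p q p' q' : (0 < p)%R -> (0 < q)%R -> (0 < p')%R ->
  (0 < q')%R -> (p^-1 + p'^-1 = 1)%R -> (q^-1 + q'^-1 = 1)%R ->
  measurable_fun setT f -> measurable_fun setT g ->
  (forall z, 0 <= f z) -> (forall z, 0 <= g z) ->
  \int[P]_z (f z * g z) <= mnorm p q f * mnorm p' q' g.
Proof.
move=> p0 q0 p'0 q'0 pp qq mf mg f0 g0.
have mfg : measurable_fun setT (fun z => f z * g z) by exact: emeasurable_funM.
rewrite fubini_tonelli1//; last by move=> z; exact: mule_ge0.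
apply: (@le_trans _ _ (\int[mu]_a (Lnorm nu q%:E (fun b => f (a, b)) *
    Lnorm nu q'%:E (fun b => g (a, b))))); last first.
  apply: integral_hoelder => //; try exact: measurable_inner_norm.
    by move=> a; exact: Lnorm_ge0.
  by move=> a; exact: Lnorm_ge0.
apply: ge0_le_integral => //.
- by move=> a _; apply: integral_ge0 => b _; exact: mule_ge0.
- apply: measurable_fun_fubini_tonelli_F => // z; exact: mule_ge0.
- by apply: emeasurable_funM; exact: measurable_inner_norm.
by move=> a _; apply: integral_hoelder => //; exact: measurable_section.
Qed.

Lemma mnorm_cst1 p q : mnorm p q (cst 1) = 1.
Proof.
have L1 d (T : measurableType d) (m : probability T R) r : Lnorm m r%:E (cst 1) = 1.
  by rewrite Lnorm_cst1 [X in X `^ _](probability_setT m) poweR1r.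
by rewrite /mnorm (_ : (fun a => _) = cst 1) ?L1//; apply/funext => a; exact: L1.
Qed.

Lemma mnorm_cst (c : R) p q : (0 < p)%R -> (0 < q)%R -> (0 <= c)%R ->
  mnorm p q (cst c%:E) = c%:E.
Proof.
move=> p0 q0 c0; have -> : cst c%:E = (fun z : A * B => c%:E * (cst 1 z : \bar R)).
  by apply/funext => z /=; rewrite mule1.
by rewrite mnormZ// mnorm_cst1 [LHS]mule1.
Qed.

(** On probability spaces the mixed norm dominates the norm of L^1: this is
    the Hoelder inequality with the constant function 1. *)
Lemma integral_le_mnorm f p q p' q' : (0 < p)%R -> (0 < q)%R -> (0 < p')%R ->
  (0 < q')%R -> (p^-1 + p'^-1 = 1)%R -> (q^-1 + q'^-1 = 1)%R ->
  measurable_fun setT f -> (forall z, 0 <= f z) ->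
  \int[P]_z f z <= mnorm p q f.
Proof.
move=> p0 q0 p'0 q'0 pp qq mf f0.
have := mnorm_hoelder p0 q0 p'0 q'0 pp qq mf (measurable_cst (1 : \bar R)) f0.
by under eq_integral do rewrite mule1; rewrite mnorm_cst1 mule1; apply.
Qed.

End mixed_norm_lemmas.

Lemma integral_prob_cst d (T : measurableType d) (R : realType)
  (m : probability T R) (x : \bar R) : (\int[m]__ x = x)%E.
Proof. by rewrite integral_cst// [X in (_ * X)%E](probability_setT m) mule1. Qed.

Section extremal.
Context d1 d2 (A : measurableType d1) (B : measurableType d2) (R : realType)
  (mu : probability A R) (nu : probability B R).
Local Notation P := (mu \x nu)%E.

Lemma mul_powR_div (c p q : R) : 0 <= c -> 0 < p -> 0 < q ->
  c * c `^ ((p - q) / q) = c `^ (p / q).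
Proof.
move=> c0 p0 q0; have [->|cn0] := eqVneq c 0.
  by rewrite mul0r powR0// mulf_neq0 ?invr_eq0 ?gt_eqF.
rewrite -{1}(powRr1 c0) -powRD; last by rewrite cn0 implybT.
by congr (_ `^ _); field; rewrite gt_eqF.
Qed.

(** Norming functions: for a bounded f, the function
    phi = f ^ (q - 1) * c ^ ((p - q) / q), where c(a) is the integral of
    f(a, .) ^ q, attains equality in the Hoelder inequality for mixed norms. *)
Lemma mnorm_extremal (f : A * B -> R) (M p q p' q' : R) :
  1 < p -> 1 < q -> p^-1 + p'^-1 = 1 -> q^-1 + q'^-1 = 1 ->
  measurable_fun setT f -> (forall z, 0 <= f z <= M) ->
  exists phi : A * B -> R, exists J : R,
  [/\ measurable_fun setT phi, forall z, 0 <= phi z, 0 <= J &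
   [/\ (\int[P]_z (f z * phi z)%:E = J%:E)%E,
      mnorm mu nu p q (EFin \o f) = (J `^ p^-1)%:E &
      mnorm mu nu p' q' (EFin \o phi) = (J `^ p'^-1)%:E]].
Proof.
move=> p1 q1 pp qq mf fM.
have p0 : 0 < p := lt_trans ltr01 p1.
have q0 : 0 < q := lt_trans ltr01 q1.
have p'E : p' = p / (p - 1).
  apply: invr_inj; rewrite invf_div -[p'^-1](addKr p^-1) pp; field.
  by rewrite !gt_eqF// subr_gt0.
have q'E : q' = q / (q - 1).
  apply: invr_inj; rewrite invf_div -[q'^-1](addKr q^-1) qq; field.
  by rewrite !gt_eqF// subr_gt0.
have p'0 : 0 < p' by rewrite p'E divr_gt0// subr_gt0.
have q'0 : 0 < q' by rewrite q'E divr_gt0// subr_gt0.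
have f0 z : 0 <= f z by case/andP: (fM z).
have fleM z : f z <= M by case/andP: (fM z).
have mfq r : measurable_fun setT (fun z => f z `^ r).
  exact: (@measurableT_comp _ _ _ _ _ _ (@powR R ^~ r)).
pose C a := (\int[nu]_b (f (a, b) `^ q)%:E)%E.
have C0 a : (0 <= C a)%E by apply: integral_ge0 => b _; rewrite lee_fin powR_ge0.
have CM a : (C a <= (M `^ q)%:E)%E.
  have -> : (M `^ q)%:E = (\int[nu]_b (M `^ q)%:E)%E.
    by rewrite integral_prob_cst.
  apply: ge0_le_integral => //.
  - by move=> b _; rewrite lee_fin powR_ge0.
  - by apply: (@measurable_section _ _ A B R (fun z => (f z `^ q)%:E)); exact/measurable_EFinP.
  - move=> b _; rewrite lee_fin ge0_ler_powR ?nnegrE ?(ltW q0)//.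
    exact: le_trans (fleM (a, b)).
pose c a := fine (C a).
have cE a : C a = (c a)%:E.
  by rewrite fineK// ge0_fin_numE// (le_lt_trans (CM a))// ltry.
have c0 a : 0 <= c a by rewrite fine_ge0.
have mC : measurable_fun setT C.
  apply: (measurable_fun_fubini_tonelli_F (fun z => (f z `^ q)%:E)).
    exact/measurable_EFinP.
  by move=> z; rewrite lee_fin powR_ge0.
have mc : measurable_fun setT c by exact: measurableT_comp.
have mcr r : measurable_fun setT (fun a => c a `^ r).
  exact: (@measurableT_comp _ _ _ _ _ _ (@powR R ^~ r)).
pose phi (z : A * B) := f z `^ (q - 1) * c z.1 `^ ((p - q) / q).
have mphi : measurable_fun setT phi.
  apply: measurable_funM => //; exact: (measurableT_comp (mcr _)).
pose J := fine (\int[mu]_a (c a `^ (p / q))%:E)%E.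
have JE : (\int[mu]_a (c a `^ (p / q))%:E)%E = J%:E.
  rewrite fineK// ge0_fin_numE; last first.
    by apply: integral_ge0 => a _; rewrite lee_fin powR_ge0.
  apply: (@le_lt_trans _ _ (((M `^ q) `^ (p / q))%:E)); last exact: ltry.
  have -> : ((M `^ q) `^ (p / q))%:E = (\int[mu]_b ((M `^ q) `^ (p / q))%:E)%E.
    by rewrite integral_prob_cst.
  apply: ge0_le_integral => //.
  - by move=> b _; rewrite lee_fin powR_ge0.
  - exact/measurable_EFinP.
  - move=> a _; rewrite lee_fin ge0_ler_powR ?nnegrE ?powR_ge0//.
      by rewrite divr_ge0 ?ltW.
    by rewrite -lee_fin -cE.
have mfa a r : measurable_fun setT (fun b => (f (a, b) `^ r)%:E).
  by apply: (@measurable_section _ _ A B R (fun z => (f z `^ r)%:E)); exact/measurable_EFinP.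
(* Homogeneity in a factor r, which is a nonnegative power below. *)
have intq a r : (\int[nu]_b (f (a, b) `^ q * r)%:E)%E = (c a * r)%:E \/ r < 0.
  have [r0|] := leP 0 r; [left|by right].
  under eq_integral do rewrite EFinM.
  rewrite ge0_integralZr// -/(C a) ?cE//.
  by move=> b _; rewrite lee_fin powR_ge0.
exists phi, J; split => //.
- by move=> z; rewrite mulr_ge0 ?powR_ge0.
- by rewrite fine_ge0// integral_ge0// => a _; rewrite lee_fin powR_ge0.
split.
- rewrite fubini_tonelli1; last 2 first.
  + by apply/measurable_EFinP; exact: measurable_funM.
  + by move=> z; rewrite lee_fin mulr_ge0// mulr_ge0 ?powR_ge0.
  rewrite -JE; apply: eq_integral => a _; rewrite /fubini_F.
  transitivity (\int[nu]_b (f (a, b) `^ q * c a `^ ((p - q) / q))%:E)%E.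
    by apply: eq_integral => b _; rewrite /phi mulrA mulr_powRB1.
  have [->|] := intq a (c a `^ ((p - q) / q)); first by rewrite mul_powR_div.
  by rewrite ltNge powR_ge0.
- have inner a : Lnorm nu q%:E (fun b => (EFin \o f) (a, b)) = (c a `^ q^-1)%:E.
    rewrite unlock; under eq_integral do rewrite /= ger0_norm//.
    by rewrite -/(C a) cE.
  rewrite /mnorm (funext inner) unlock.
  under eq_integral => a _ do rewrite abse_EFin ger0_norm ?powR_ge0// poweR_EFin -powRrM [(q^-1 * p)%R]mulrC.
  by rewrite JE.
- have inner a : Lnorm nu q'%:E (fun b => (EFin \o phi) (a, b)) =
      (c a `^ ((p - 1) / q))%:E.
    rewrite unlock.
    transitivity ((\int[nu]_b (f (a, b) `^ q * c a `^ ((p - q) / q * q'))%:E) `^ q'^-1)%E.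
      congr (_ `^ _)%E; apply: eq_integral => b _ /=.
      rewrite /phi/= ger0_norm ?mulr_ge0 ?powR_ge0// powRM ?powR_ge0// -!powRrM.
      congr (_ `^ _ * _)%:E; rewrite q'E; field; by rewrite gt_eqF// subr_gt0.
    have [->|] := intq a (c a `^ ((p - q) / q * q')); last by rewrite ltNge powR_ge0.
    rewrite poweR_EFin powRM ?powR_ge0// -powRrM mulfK ?gt_eqF//; congr _%:E.
    (* Zero is treated apart: exponents of a zero base do not add up. *)
    have [->|cn0] := eqVneq (c a) 0.
      rewrite powR0 ?invr_eq0 ?gt_eqF// mul0r powR0// mulf_neq0 ?invr_eq0 ?gt_eqF//.
      by rewrite subr_gt0.
    rewrite -powRD; last by rewrite cn0 implybT.
    congr (_ `^ _); rewrite q'E; field; by rewrite !gt_eqF// subr_gt0.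
  rewrite /mnorm (funext inner) unlock.
  under eq_integral => a _ do rewrite abse_EFin ger0_norm ?powR_ge0// poweR_EFin -powRrM.
  have -> : ((p - 1) / q * p' = p / q)%R.
    by rewrite p'E; field; rewrite !gt_eqF// subr_gt0.
  by rewrite JE.
Qed.

End extremal.

(** * Sub-sigma-algebras and real conditional expectations *)

Section sub_sigma_algebra.
Context d (T : measurableType d) (R : realType) (P : probability T R)
  (F : set (set T)) (Fs : sigma_algebra [set: T] F) (FT : F `<=` measurable).
Local Notation TF := (g_sigma_algebraType F).

(** Measurability of functions with respect to the sub-sigma-algebra F. *)
Definition sub_measurable d' (U : measurableType d') (f : T -> U) :=
  measurable_fun setT (f : TF -> U).

Lemma measurable_subE : (@measurable _ TF) = F.
Proof. exact: measurable_g_measurableTypeE. Qed.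

Lemma sub_measurable_setP (D : set T) : @measurable _ TF D <-> F D.
Proof. by rewrite measurable_subE. Qed.

Lemma sub_measurableW d' (U : measurableType d') (f : T -> U) :
  sub_measurable f -> measurable_fun setT f.
Proof.
move=> mf _ Y mY; apply: FT; rewrite -measurable_subE.
exact: (mf (@measurableT _ TF) Y mY).
Qed.

Lemma strongly_measurable_sub (k : scalar_kind)
    (X : normedModType (scalar_field R k)) (f : T -> X) :
  strongly_measurable F f = strongly_measurable (@measurable _ TF) f.
Proof. by rewrite measurable_subE. Qed.

Lemma simple_fun_subW (k : scalar_kind)
    (X : normedModType (scalar_field R k)) (f : T -> X) :
  simple_fun F f -> simple_fun measurable f.
Proof. by move=> [ff mf]; split=> // x; apply: FT; exact: mf. Qed.

Lemma strongly_measurable_subW (k : scalar_kind)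
    (X : normedModType (scalar_field R k)) (f : T -> X) :
  strongly_measurable F f -> strongly_measurable measurable f.
Proof.
by move=> [s [ss sf]]; exists s; split=> // n; exact: simple_fun_subW.
Qed.

(** The restriction of the probability measure P to F. The two hypotheses on F
    are arguments so that it can be declared to be a probability measure. *)
Definition subP of sigma_algebra [set: T] F & F `<=` measurable : set TF -> \bar R :=
  P.
Local Notation PF := (subP Fs FT).

Let PF0 : PF set0 = 0%E. Proof. exact: measure0. Qed.
Let PF_ge0 A : (0 <= PF A)%E. Proof. exact: measure_ge0. Qed.
Let PF_sigma_additive : semi_sigma_additive PF.
Proof.
move=> G mG tG mUG; apply: (@measure_semi_sigma_additive _ _ _ P G) => //.
  by move=> i; apply: FT; rewrite -measurable_subE; exact: mG.
by apply: FT; rewrite -measurable_subE.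
Qed.
HB.instance Definition _ := isMeasure.Build _ TF R PF PF0 PF_ge0 PF_sigma_additive.
Let PFT : PF setT = 1%E. Proof. exact: probability_setT. Qed.
HB.instance Definition _ := Measure_isProbability.Build _ TF R PF PFT.

(** P restricted to F is the image of P under the identity, which is measurable
    into the smaller sigma-algebra. *)
Lemma measurable_id_sub : measurable_fun setT (id : T -> TF).
Proof. by apply: sub_measurableW; exact: measurable_id. Qed.

Lemma ge0_integral_sub (D : set T) (f : T -> \bar R) : F D ->
  sub_measurable f -> (forall t, (0 <= f t)%E) ->
  (\int[PF]_(t in D) f t = \int[P]_(t in D) f t)%E.
Proof.
move=> FD mf f0.
have mD : measurable (D : set TF) by rewrite measurable_subE.
apply: (ge0_integral_pushforward measurable_id_sub P mD) => //.
exact: (measurable_funS measurableT).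
Qed.

Lemma integrable_sub (f : T -> \bar R) : sub_measurable f ->
  PF.-integrable setT f <-> P.-integrable setT f.
Proof.
move=> mf; have FTT : F setT by rewrite -measurable_subE; exact: measurableT.
have E : (\int[PF]_t `|f t| = \int[P]_t `|f t|)%E.
  by apply: (ge0_integral_sub FTT) => //; exact: (measurableT_comp _ mf).
split=> /integrableP[_ h]; apply/integrableP; split=> //.
- exact: sub_measurableW.
- by rewrite -E.
- by rewrite E.
Qed.

Lemma integral_sub (D : set T) (f : T -> \bar R) : F D ->
  sub_measurable f -> P.-integrable setT f ->
  (\int[PF]_(t in D) f t = \int[P]_(t in D) f t)%E.
Proof.
move=> FD mf intf.
have mD : measurable (D : set TF) by rewrite measurable_subE.
apply: (integral_pushforward measurable_id_sub) => //.
by apply: (integrableS measurableT) => //; apply: FT.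
Qed.

(** The Radon-Nikodym theorem on the sub-sigma-algebra F. *)
Lemma Radon_Nikodym_sub (l : set T -> R) : l set0 = 0 ->
  (forall G : (set T)^nat, (forall i, F (G i)) -> trivIset setT G ->
     (\sum_(0 <= i < n) l (G i))%R @[n --> \oo] --> l (\bigcup_i G i)) ->
  (forall D, F D -> P D = 0%E -> l D = 0) ->
  exists a : T -> R, [/\ sub_measurable a, P.-integrable setT (EFin \o a) &
    forall D, F D -> ((l D)%:E = \int[P]_(t in D) (a t)%:E)%E].
Proof.
move=> l0 lsa lac.
pose la (A : set TF) : \bar R := (l A)%:E.
have la0 : la set0 = 0%E by rewrite /la l0.
have lafin A : measurable A -> la A \is a fin_num by [].
have lasa : semi_sigma_additive la.
  move=> G mG tG mUG; rewrite /la.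
  under eq_fun do rewrite sumEFin; apply: cvg_EFin; first exact: nearW.
  by apply: lsa => // i; rewrite -measurable_subE; exact: mG.
pose lc : {charge set TF -> \bar R} :=
  HB.pack la (isCharge.Build _ TF R la la0 lafin lasa).
have lcP : lc `<< PF.
  apply/null_content_dominatesP => D mD PD; rewrite /lc/= /la lac//.
  by rewrite -measurable_subE.
pose a := Radon_Nikodym lc PF.
have afin t : a t \is a fin_num by exact: Radon_Nikodym_fin_num.
have inta : PF.-integrable setT a by exact: Radon_Nikodym_integrable.
have ma : sub_measurable a by case/integrableP: inta.
have aE : EFin \o (fine \o a) = a by apply/funext => t /=; rewrite fineK.
exists (fine \o a); split.
- by rewrite /sub_measurable; exact: measurableT_comp.
- by rewrite aE; exact/integrable_sub.
- move=> D FD; have mD : measurable (D : set TF) by rewrite measurable_subE.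
  rewrite -[LHS]/(lc D) (Radon_Nikodym_integral lcP mD) -/a.
  rewrite (integral_sub FD ma); last exact/integrable_sub.
  by apply: eq_integral => t _; rewrite fineK.
Qed.

(** g is a (nonnegative) conditional expectation of f. *)
Definition rcond_exp (f g : T -> R) := [/\ sub_measurable g, forall t, 0 <= g t &
  forall D, F D -> (\int[P]_(t in D) (g t)%:E = \int[P]_(t in D) (f t)%:E)%E].

Lemma rcond_exp_exists (f : T -> R) : measurable_fun setT f ->
  (forall t, 0 <= f t) -> (\int[P]_t (f t)%:E < +oo)%E -> exists g, rcond_exp f g.
Proof.
move=> mf f0 fy.
have mfE D : measurable D -> measurable_fun D (EFin \o f).
  by move=> mD; apply/measurable_EFinP; exact: (measurable_funS measurableT).
have int0 D : (0 <= \int[P]_(t in D) (f t)%:E)%E by apply: integral_ge0 => t _; rewrite lee_fin.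
have intfin D : F D -> (\int[P]_(t in D) (f t)%:E)%E \is a fin_num.
  move=> FD; rewrite ge0_fin_numE//; apply: le_lt_trans fy.
  apply: ge0_subset_integral => //; [exact: FT|exact: mfE|].
  by move=> t _; rewrite lee_fin.
pose l (D : set T) := fine (\int[P]_(t in D) (f t)%:E)%E.
have [a [ma inta aE]] : exists a : T -> R,
    [/\ sub_measurable a, P.-integrable setT (EFin \o a) &
    forall D, F D -> ((l D)%:E = \int[P]_(t in D) (a t)%:E)%E].
  apply: Radon_Nikodym_sub.
  - by rewrite /l integral_set0.
  - move=> G FG tG.
    have mG i : measurable (G i) by exact: FT.
    have FU : F (\bigcup_i G i).
      rewrite -measurable_subE; apply: bigcup_measurable => i _.
      by rewrite measurable_subE.
    have UE : (\int[P]_(t in \bigcup_i G i) (f t)%:E =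
        \sum_(0 <= i <oo) \int[P]_(t in G i) (f t)%:E)%E.
      apply: ge0_integral_bigcup => //; first exact/mfE/FT.
      by move=> t _; rewrite lee_fin.
    rewrite /l UE.
    have c : (\sum_(0 <= i < n) \int[P]_(t in G i) (f t)%:E)%E @[n --> \oo] -->
       (\sum_(0 <= i <oo) \int[P]_(t in G i) (f t)%:E)%E.
      by apply: is_cvg_nneseries => i _ _; exact: int0.
    have sfin : (\sum_(0 <= i <oo) \int[P]_(t in G i) (f t)%:E)%E \is a fin_num.
      by rewrite -UE intfin.
    rewrite -(fineK sfin) in c.
    rewrite (_ : (fun n => _) =
      fine \o (fun n => \sum_(0 <= i < n) \int[P]_(t in G i) (f t)%:E)%E).
      exact: fine_cvg c.
    apply/funext => n /=.
    by under [in RHS]eq_bigr => i _ do rewrite -(fineK (intfin _ (FG i))); rewrite sumEFin.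
  - by move=> D FD PD; rewrite /l null_set_integral//; [exact: FT|exact/mfE/FT].
have lE D : F D -> (l D)%:E = (\int[P]_(t in D) (f t)%:E)%E.
  by move=> FD; rewrite /l fineK// intfin.
(* The density may be negative on a null set, hence its positive part. *)
exists (fun t => Num.max (a t) 0); split.
- by apply: measurable_maxr => //; exact: measurable_cst.
- by move=> t; rewrite le_max lexx orbT.
move=> D FD.
(* The positive part integrates over D to the integral of a over D'. *)
pose D' := D `&` [set t | 0 <= a t].
have FD' : F D'.
  rewrite -measurable_subE; apply: measurableI; first by rewrite measurable_subE.
  rewrite -[X in measurable X]setTI; apply: measurable_fun_ler => //.
have mmax : measurable_fun setT (fun t => (Num.max (a t) 0)%:E).
  by apply/measurable_EFinP; apply: measurable_maxr => //; exact: sub_measurableW.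
apply/eqP; rewrite eq_le; apply/andP; split.
  apply: (@le_trans _ _ (\int[P]_(t in D') (a t)%:E)%E).
    rewrite [leLHS]integral_mkcond [leRHS]integral_mkcond le_eqVlt; apply/orP; left.
    apply/eqP/eq_integral => t _; rewrite !patchE /D' in_setI.
    case: (t \in D) => //=; case: ifPn => [|]; first by rewrite inE /= => /max_l ->.
    by rewrite notin_setE /= => /negP; rewrite -ltNge => /ltW/max_r ->.
  rewrite -aE// lE//; apply: ge0_subset_integral => //.
  - exact: FT.
  - exact: FT.
  - exact/mfE/FT.
  - by move=> t _; rewrite lee_fin.
  - exact: subIsetl.
rewrite -lE// aE//.
have mD := FT FD.
apply: le_integral => //.
- exact: (integrableS measurableT).
- apply: (le_integrable mD _ _ (integrableS measurableT mD (@subsetT _ _) inta)).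
    exact: (measurable_funS measurableT).
  move=> t _ /=; rewrite lee_fin; case: (leP 0 (a t)) => h.
    by [].
  by rewrite normr0.
by move=> t _; rewrite lee_fin le_max lexx.
Qed.

Import HBNNSimple.

(** An inequality between integrals over the sets of F extends to integrals
    against nonnegative F-measurable weights k, by approximation of k from
    below by simple functions. It is applied in both directions to a function
    and its conditional expectation. *)
Lemma le_integral_sub_mul (f g k : T -> R) : measurable_fun setT f ->
  measurable_fun setT g -> sub_measurable k -> (forall t, 0 <= f t) ->
  (forall t, 0 <= g t) -> (forall t, 0 <= k t) ->
  (forall D, F D -> (\int[P]_(t in D) (g t)%:E <= \int[P]_(t in D) (f t)%:E)%E) ->
  (\int[P]_t (k t * g t)%:E <= \int[P]_t (k t * f t)%:E)%E.
Proof.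
move=> mf mg mk f0 g0 k0 gf.
have mkE : measurable_fun setT (EFin \o (k : TF -> R)) by exact/measurable_EFinP.
pose kn := nnsfun_approx (@measurableT _ TF) mkE.
have mkn n : measurable_fun setT (kn n : T -> R).
  by apply: sub_measurableW; exact: measurable_funP.
have lim (h : T -> R) : measurable_fun setT h -> (forall t, 0 <= h t) ->
    (\int[P]_t (kn n t * h t)%:E)%E @[n --> \oo] --> (\int[P]_t (k t * h t)%:E)%E.
  move=> mh h0.
  have -> : (\int[P]_t (k t * h t)%:E = \int[P]_t limn (fun n => (kn n t * h t)%:E))%E.
    apply: eq_integral => t _; apply/esym/cvg_lim => //; under eq_fun do rewrite EFinM.
    rewrite EFinM; apply: cvgeZr => //.
    by apply: (cvg_nnsfun_approx (@measurableT _ TF) mkE) => // x _; rewrite lee_fin.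
  apply: cvg_monotone_convergence => //.
  - by move=> n; apply/measurable_EFinP; exact: measurable_funM.
  - by move=> n t _; rewrite lee_fin mulr_ge0.
  - move=> t _ i j ij; rewrite lee_fin ler_wpM2r//.
    by have /lefP/(_ t) := nd_nnsfun_approx (@measurableT _ TF) mkE ij.
have simp n (h : T -> R) : measurable_fun setT h -> (forall t, 0 <= h t) ->
    (\int[P]_t (kn n t * h t)%:E = \sum_(x \in range (kn n))
      (x%:E * \int[P]_(t in kn n @^-1` [set x]) (h t)%:E))%E.
  move=> mh h0.
  have mfib x : measurable (kn n @^-1` [set x] : set T).
    by apply/FT/sub_measurable_setP; exact: measurable_sfunP.
  transitivity (\int[P]_t \sum_(x \in range (kn n))
     (x%:E * ((h t)%:E * (\1_(kn n @^-1` [set x]) t)%:E)))%E.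
    apply: eq_integral => t _; rewrite fimfunE.
    rewrite [in LHS]mulr_fsuml -fsumEFin//; apply: eq_fsbigr => x _.
    by rewrite -!EFinM; congr (_%:E); ring.
  rewrite ge0_integral_fsum//.
  - apply: eq_fsbigr => x; rewrite inE => -[t _ xt].
    rewrite ge0_integralZl//.
    + congr (_ * _)%E; rewrite [in RHS]integral_mkcond; apply: eq_integral => u _.
      by rewrite patchE indicE; case: ifP; rewrite ?mule1 ?mule0.
    + apply/measurable_EFinP; apply: measurable_funM => //.
    + by move=> u _; rewrite -EFinM lee_fin mulr_ge0.
    + by rewrite lee_fin -xt.
  - by move=> x; apply/measurable_EFinP; do 2 apply: measurable_funM => //.
  - move=> x t _; rewrite -!EFinM lee_fin indicE.
    have [|] := boolP (t \in _); last by rewrite !mulr0.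
    by rewrite inE => /= <-; rewrite mulr1 mulr_ge0.
rewrite -(cvg_lim _ (lim f mf f0))// -(cvg_lim _ (lim g mg g0))//.
apply: lee_lim; [exact: cvgP (lim g mg g0)|exact: cvgP (lim f mf f0)|].
apply: nearW => n; rewrite !simp// !fsbig_finite//=.
rewrite big_seq [leRHS]big_seq; apply: lee_sum => x.
rewrite in_fset_set// inE => -[t _ <-].
rewrite lee_wpmul2l ?lee_fin//; apply: gf; apply/sub_measurable_setP.
exact: measurable_sfunP.
Qed.

End sub_sigma_algebra.

(** * Vector-valued conditional expectations *)

Section bochner_over_sets.
Context d (T : measurableType d) (R : realType) (P : probability T R).
Local Notation sm := (strongly_measurable (@measurable d T)).

(** The Bochner integral of r x, for a real function r and a fixed vector x. *)
Lemma is_bochner_scale (k : scalar_kind) (X : normedModType (scalar_field R k))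
    (r : T -> R) (x : X) : P.-integrable setT (EFin \o r) ->
  sm (fun t => scalar_of_real k (r t) *: x) /\
  is_bochner P (fun t => scalar_of_real k (r t) *: x)
    (scalar_of_real k (fine (\int[P]_t (r t)%:E)) *: x).
Proof.
move=> intr.
have mr : measurable_fun setT r by apply/measurable_EFinP; case/integrableP: intr.
pose RR := (scalar_field R RealScalars)^o : normedModType (scalar_field R RealScalars).
apply: (@is_bochner_linear _ _ _ P RealScalars k RR X
  (fun r : R => scalar_of_real k r *: x) (rnorm x)).
- by move=> y z; rewrite srD scalerDl.
- by move=> y z; rewrite [RHS]scalerA -srM.
- by move=> y; rewrite rnormZr mulrC.
- exact: (@sm_sr _ _ _ RealScalars _ mr).
- exact: is_bochner_real.
Qed.

Local Open Scope ereal_scope.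

Lemma bochner_integrable_scale (k : scalar_kind)
    (X : normedModType (scalar_field R k)) (r : T -> R) (x : X) :
  P.-integrable setT (EFin \o r) ->
  bochner_integrable P (fun t => scalar_of_real k (r t) *: x)%R.
Proof.
move=> intr; have [sr _] := is_bochner_scale x intr; split=> //.
under eq_integral do rewrite rnormZr EFinM.
have [mr ir] := integrableP _ _ _ intr.
rewrite ge0_integralZr//.
- by rewrite muleC lte_mul_pinfty// lee_fin.
- by apply/measurable_EFinP; apply: measurableT_comp => //; exact/measurable_EFinP.
- by rewrite lee_fin.
Qed.

Lemma bochner_scale (k : scalar_kind) (X : normedModType (scalar_field R k))
    (r : T -> R) (x : X) (D : set T) : measurable D ->
  P.-integrable setT (EFin \o r) ->
  bochner P D (fun t => scalar_of_real k (r t) *: x)%R =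
  (scalar_of_real k (fine (\int[P]_(t in D) (r t)%:E)) *: x)%R.
Proof.
move=> mD intr.
have intrD : P.-integrable setT (EFin \o (r \_ D)).
  rewrite -restrict_EFin; apply/(integrable_restrict _ mD) => //.
  by rewrite setTI; exact: (integrableS measurableT).
have [s1 s2] := is_bochner_scale x intrD.
rewrite bochnerE [in RHS]integral_mkcond restrict_EFin -(Bint_unique s1 s2).
congr (Bint P _); apply/funext => t; rewrite /patch.
by case: ifP => //; rewrite sr0 scale0r.
Qed.

Context (k : scalar_kind) (X : normedModType (scalar_field R k)).
Implicit Types f g : T -> X.

Lemma measurable_rnorm_EFin f : sm f -> measurable_fun setT (fun t => (rnorm (f t))%:E).
Proof. by move=> sf; apply/measurable_EFinP; exact: sm_rnorm. Qed.

Lemma bochner_integrable_le f g : sm f -> bochner_integrable P g ->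
  (forall t, (rnorm (f t) <= rnorm (g t))%R) -> bochner_integrable P f.
Proof.
move=> sf [sg ig] fg; split=> //; apply: le_lt_trans ig.
apply: ge0_le_integral => //.
- by move=> t _; rewrite lee_fin.
- exact: measurable_rnorm_EFin.
- exact: measurable_rnorm_EFin.
- by move=> t _; rewrite lee_fin.
Qed.

Lemma bochner_integrable_patch D f : measurable D -> bochner_integrable P f ->
  bochner_integrable P (patch (cst 0%R) D f).
Proof.
move=> mD bf; apply: (bochner_integrable_le _ bf).
  by apply: sm_patch => //; case: bf.
by move=> t; rewrite /patch; case: ifP => // _; rewrite rnorm0.
Qed.

Lemma bochner_integrableD f g : bochner_integrable P f -> bochner_integrable P g ->
  bochner_integrable P (fun t => f t + g t)%R.
Proof.
move=> [sf intf] [sg intg]; split; first exact: smD.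
apply: (@le_lt_trans _ _ (\int[P]_t ((rnorm (f t))%:E + (rnorm (g t))%:E))).
  apply: ge0_le_integral => //.
  - by move=> t _; rewrite lee_fin.
  - by apply: measurable_rnorm_EFin; exact: smD.
  - by apply: emeasurable_funD; exact: measurable_rnorm_EFin.
  - by move=> t _; rewrite -EFinD lee_fin ler_rnormD.
rewrite ge0_integralD//; first exact: lte_add_pinfty.
- by move=> t _; rewrite lee_fin.
- exact: measurable_rnorm_EFin.
- by move=> t _; rewrite lee_fin.
- exact: measurable_rnorm_EFin.
Qed.

Lemma bochner_integrableZ (c : scalar_field R k) f : bochner_integrable P f ->
  bochner_integrable P (fun t => c *: f t)%R.
Proof.
move=> [sf intf]; split; first by apply: smZ => //; exact: sm_cst.
under eq_integral do rewrite rnormZ EFinM.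
rewrite ge0_integralZl_EFin//.
- by rewrite lte_mul_pinfty// lee_fin.
- by move=> t _; rewrite lee_fin.
- exact: measurable_rnorm_EFin.
Qed.

Lemma bochner_integrableN f : bochner_integrable P f ->
  bochner_integrable P (fun t => - f t)%R.
Proof.
move=> [sf intf]; split; first exact: smN.
by under eq_integral do rewrite rnormN.
Qed.

Lemma bochner_integrableB f g : bochner_integrable P f -> bochner_integrable P g ->
  bochner_integrable P (fun t => f t - g t)%R.
Proof. by move=> bf bg; apply: bochner_integrableD => //; exact: bochner_integrableN. Qed.

Lemma bochner_setT f : bochner P setT f = Bint P f.
Proof. by rewrite bochnerE; congr (Bint P _); apply/funext => t; rewrite /patch in_setT. Qed.

Hypothesis cX : rcomplete X.

Lemma bochnerP D f : measurable D -> bochner_integrable P f ->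
  is_bochner P (patch (cst 0%R) D f) (bochner P D f).
Proof.
by move=> mD bf; apply: BintP => //; exact: bochner_integrable_patch.
Qed.

Lemma le_bochner D f : measurable D -> bochner_integrable P f ->
  (rnorm (bochner P D f))%:E <= \int[P]_(t in D) (rnorm (f t))%:E.
Proof.
move=> mD bf; rewrite (le_trans (le_Bint cX (bochner_integrable_patch mD bf)))//.
rewrite [leRHS]integral_mkcond le_eqVlt; apply/orP; left; apply/eqP.
by apply: eq_integral => t _; rewrite /patch; case: ifP => // _; rewrite rnorm0.
Qed.

Lemma bochnerD D f g : measurable D -> bochner_integrable P f ->
  bochner_integrable P g ->
  bochner P D (fun t => f t + g t)%R = (bochner P D f + bochner P D g)%R.
Proof.
move=> mD bf bg; apply: Bint_unique.
  by apply: sm_patch => //; case: (bochner_integrableD bf bg).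
have [sf _] := bochner_integrable_patch mD bf.
have [sg _] := bochner_integrable_patch mD bg.
have := is_bochnerD sf sg (bochnerP mD bf) (bochnerP mD bg).
congr (is_bochner _ _ _); apply/funext => t; rewrite /patch.
by case: ifP => // _; rewrite addr0.
Qed.

Lemma bochner_linear (k' : scalar_kind) (Y : normedModType (scalar_field R k'))
    (h : X -> Y) (C : R) D f :
  (forall x y, h (x + y) = h x + h y)%R ->
  (forall r x, h (scalar_of_real k r *: x) = scalar_of_real k' r *: h x)%R ->
  (forall x, (rnorm (h x) <= C * rnorm x)%R) ->
  measurable D -> bochner_integrable P f ->
  bochner P D (fun t => h (f t)) = h (bochner P D f).
Proof.
move=> hD hZ hC mD bf; have h0 : h 0%R = 0%R by apply: (addrI (h 0%R)); rewrite -hD !addr0.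
have [sf _] := bochner_integrable_patch mD bf.
have [] := is_bochner_linear hD hZ hC sf (bochnerP mD bf).
have -> : (fun t => h (patch (cst 0%R) D f t)) = patch (cst 0%R) D (fun t => h (f t)).
  by apply/funext => t; rewrite /patch; case: ifP.
exact: Bint_unique.
Qed.

Lemma bochnerZ (c : scalar_field R k) D f : measurable D -> bochner_integrable P f ->
  bochner P D (fun t => c *: f t)%R = (c *: bochner P D f)%R.
Proof.
move=> mD bf; apply: (bochner_linear (h := fun x : X => c *: x)
  (C := rnorm (c : (scalar_field R k)^o))) => //.
- by move=> x y; exact: scalerDr.
- by move=> r x; rewrite !scalerA mulrC.
- by move=> x; rewrite rnormZ.
Qed.

Lemma bochnerB D f g : measurable D -> bochner_integrable P f ->
  bochner_integrable P g ->
  bochner P D (fun t => f t - g t)%R = (bochner P D f - bochner P D g)%R.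
Proof.
move=> mD bf bg; rewrite bochnerD//; last exact: bochner_integrableN.
have -> : (fun t => - g t)%R = (fun t => (-1) *: g t)%R.
  by apply/funext => t; rewrite scaleN1r.
by rewrite bochnerZ// scaleN1r.
Qed.

Lemma bochner_dist D f g : measurable D -> bochner_integrable P f ->
  bochner_integrable P g ->
  (rnorm (bochner P D f - bochner P D g)%R)%:E <= \int[P]_t (rnorm (f t - g t)%R)%:E.
Proof.
move=> mD bf bg; have bfg := bochner_integrableB bf bg.
rewrite -bochnerB// (le_trans (le_bochner mD bfg))//.
apply: ge0_subset_integral => //.
- by apply: measurable_rnorm_EFin; case: bfg.
- by move=> t _; rewrite lee_fin.
Qed.

Lemma int_rnorm_ae_eq f g : sm f -> sm g -> f = g %[ae P] ->
  \int[P]_t (rnorm (f t - g t)%R)%:E = 0.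
Proof.
move=> sf sg fg; have sfg := smB sf sg.
rewrite (ge0_ae_eq_integral (g := cst 0)) ?integral0//.
- exact: measurable_rnorm_EFin.
- by move=> t _; rewrite lee_fin.
- by apply: filterS fg => t /(_ I) /= -> _; rewrite subrr rnorm0.
Qed.

Lemma ae_eq_of_int_rnorm f g : sm f -> sm g ->
  \int[P]_t (rnorm (f t - g t)%R)%:E <= 0 -> f = g %[ae P].
Proof.
move=> sf sg fg0; have sfg := smB sf sg.
have : \int[P]_t `|(rnorm (f t - g t)%R)%:E| = 0.
  apply/eqP; rewrite eq_le integral_ge0 ?andbT//.
  by under eq_integral do rewrite gee0_abs ?lee_fin//.
move=> /(ae_eq_integral_abs P measurableT (measurable_rnorm_EFin sfg)).
apply: filterS => t /= /(_ I)/eqP; rewrite eqe rnorm_eq0 subr_eq0 => /eqP h _.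
exact: h.
Qed.

Lemma bochner_ae_eq D f g : measurable D -> bochner_integrable P f ->
  bochner_integrable P g -> f = g %[ae P] -> bochner P D f = bochner P D g.
Proof.
move=> mD bf bg fg; apply/eqP; rewrite -subr_eq0 -rnorm_eq0 eq_le rnorm_ge0 andbT.
rewrite -lee_fin (le_trans (bochner_dist mD bf bg))// int_rnorm_ae_eq//.
  by case: bf.
by case: bg.
Qed.

End bochner_over_sets.

Lemma ge0_integral_fibres d (T : measurableType d) (R : realType)
    (P : probability T R) (I : choiceType) (s : T -> I) (D : set T) (f : T -> \bar R) :
  measurable D -> finite_set (range s) -> (forall x, measurable (s @^-1` [set x])) ->
  measurable_fun setT f -> (forall t, 0 <= f t)%E ->
  (\int[P]_(t in D) f t =
   \sum_(x \in range s) \int[P]_(t in D `&` s @^-1` [set x]) f t)%E.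
Proof.
move=> mD fs ms mf f0; set r := finmap.enum_fset (fset_set (range s)).
have rP t : s t \in r by rewrite in_fset_set// inE; exists t.
transitivity (\int[P]_t (\sum_(x \in range s) (f \_ (D `&` s @^-1` [set x])) t))%E.
  rewrite integral_mkcond; apply: eq_integral => t _.
  rewrite fsbig_finite//= (bigD1_seq (s t)) ?finmap.fset_uniq//=.
  rewrite big1_seq ?adde0.
    rewrite !patchE in_setI; have -> : t \in s @^-1` [set s t] by rewrite inE.
    by rewrite andbT.
  move=> x /andP[xs _]; rewrite patchE memNset// => -[_ /= sx].
  by rewrite sx eqxx in xs.
rewrite ge0_integral_fsum//.
- by apply: eq_fsbigr => x _; rewrite -integral_mkcond.
- move=> x; apply/(measurable_restrictT _ (measurableI _ _ mD (ms x))).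
  exact: (measurable_funS measurableT).
- by move=> x t _; rewrite patchE; case: ifP.
Qed.

Section vector_cond_exp.
Context d (T : measurableType d) (R : realType) (P : probability T R)
  (F : set (set T)) (Fs : sigma_algebra [set: T] F) (FT : F `<=` measurable).
Local Notation TF := (g_sigma_algebraType F).
Local Notation PF := (subP P Fs FT).
Context (k : scalar_kind) (X : normedModType (scalar_field R k)) (cX : rcomplete X).
Implicit Types f g : T -> X.
Local Open Scope ereal_scope.

(** The simple functions that approximate an F-measurable function in L^1 can
    be chosen to be F-measurable. *)
Lemma sub_simple_approx g : strongly_measurable F g -> bochner_integrable P g ->
  exists s : (T -> X)^nat, (forall n, simple_fun F (s n)) /\
    \int[P]_t (rnorm (g t - s n t)%R)%:E @[n --> \oo] --> 0.
Proof.
move=> sg bg; have sgF := sg; rewrite (strongly_measurable_sub Fs) in sgF.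
have FTT : F setT by apply/(sub_measurable_setP Fs); exact: measurableT.
have mrn (h : T -> X) : strongly_measurable (@measurable _ TF) h ->
    sub_measurable F (fun t => (rnorm (h t))%:E).
  by move=> sh; apply/measurable_EFinP; exact: sm_rnorm.
have bgF : bochner_integrable PF (g : TF -> X).
  split=> //; rewrite (ge0_integral_sub P Fs FT FTT); last 2 first.
  - exact: mrn.
  - by move=> t; rewrite lee_fin.
  by case: bg.
have [s [ss hs]] := bochner_integrable_approx bgF.
exists s; split; first by move=> n; have := ss n; rewrite (measurable_subE Fs).
have <- : (fun n => \int[PF]_t (rnorm (g t - s n t)%R)%:E) =
    (fun n => \int[P]_t (rnorm (g t - s n t)%R)%:E); last exact: hs.
apply/funext => n; rewrite (ge0_integral_sub P Fs FT FTT)//; last by move=> t; rewrite lee_fin.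
apply: (mrn (fun t => g t - s n t)%R); apply: smB => //.
exact: sm_simple.
Qed.

Lemma bochner_simple_fibre (s : T -> X) (D : set T) x : simple_fun measurable s ->
  measurable D -> bochner P (D `&` s @^-1` [set x]) s =
    (scalar_of_real k (fine (P (D `&` s @^-1` [set x]))) *: x)%R.
Proof.
move=> [fs ms] mD; set E := D `&` _.
have mE : measurable E by apply: measurableI.
have [sE] := is_bochner_scale x (integrable_indic P mE).
rewrite integral_indic// setIT => h; rewrite bochnerE.
have -> : patch (cst 0%R) E s = (fun t => scalar_of_real k (\1_E t) *: x)%R.
  apply/funext => t; rewrite /patch indicE; case: ifPn.
    by rewrite inE => -[_ /= ->]; rewrite sr1 scale1r.
  by rewrite sr0 scale0r.
exact: Bint_unique.
Qed.

(** Conditional expectations are contractive, on every set of F. The function g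
    is close in L^1 to an F-measurable simple function, for which the claim
    is the estimate of the integrals over its fibres. *)
Lemma le_cond_exp f g D : is_cond_exp P F f g -> F D ->
  \int[P]_(t in D) (rnorm (g t))%:E <= \int[P]_(t in D) (rnorm (f t))%:E.
Proof.
move=> [bf bg sg fg] FD; have mD := FT FD.
have [smf _] := bf; have [smg _] := bg.
have [s [ss /ge0_cvge0P hs]] := sub_simple_approx sg bg.
have {}hs := hs (fun n => int_rnorm_ge0 P _).
apply/lee_addgt0Pr => e e0; have e20 : (0 < e / 2)%R by rewrite divr_gt0.
have [n le_e] := filter_ex (hs _ e20).
have [fs ms] := ss n; have ssn := simple_fun_subW FT (ss n).
have sms := sm_simple ssn.
have bs : bochner_integrable P (s n).
  split=> //; rewrite (integral_simple P (@rnorm R k X) fs); first exact: ltry.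
  by move=> x; apply: FT.
have msn x : measurable (s n @^-1` [set x]) by exact: FT.
have FE x : F (D `&` s n @^-1` [set x]).
  apply/(sub_measurable_setP Fs); apply: measurableI.
    exact/(sub_measurable_setP Fs).
  exact/(sub_measurable_setP Fs).
have mrn (h : T -> X) : strongly_measurable measurable h ->
    measurable_fun setT (fun t => (rnorm (h t))%:E).
  exact: measurable_rnorm_EFin.
have gsn : strongly_measurable measurable (fun t => g t - s n t)%R by exact: smB.
(* Both sides are additive over the fibres of the simple function s n. *)
have key : \int[P]_(t in D) (rnorm (s n t))%:E <=
    \int[P]_(t in D) (rnorm (f t))%:E + \int[P]_(t in D) (rnorm (g t - s n t)%R)%:E.
  rewrite !(ge0_integral_fibres P mD fs msn)//; try (by move=> t; rewrite lee_fin);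
    try exact: mrn.
  rewrite -fsbig_split//= !fsbig_finite//=.
  apply: lee_sum => x _; have mE := FT (FE x).
  have -> : \int[P]_(t in D `&` s n @^-1` [set x]) (rnorm (s n t))%:E =
      (rnorm (bochner P (D `&` s n @^-1` [set x]) (s n)))%:E.
    rewrite bochner_simple_fibre// rnormZr.
    transitivity (\int[P]_(t in D `&` s n @^-1` [set x]) (cst (rnorm x)%:E t)).
      by apply: eq_integral => t; rewrite inE => -[_ /= ->].
    rewrite integral_cst// muleC ger0_norm ?fine_ge0// EFinM fineK//.
    exact: fin_num_measure.
  have -> : bochner P (D `&` s n @^-1` [set x]) (s n) =
     (bochner P (D `&` s n @^-1` [set x]) f -
      bochner P (D `&` s n @^-1` [set x]) (fun t => g t - s n t))%R.
    by rewrite bochnerB// fg// subKr.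
  apply: (@le_trans _ _ ((rnorm (bochner P (D `&` s n @^-1` [set x]) f))%:E +
     (rnorm (bochner P (D `&` s n @^-1` [set x]) (fun t => g t - s n t)%R))%:E)).
    by rewrite -EFinD lee_fin ler_rnormB.
  apply: leeD; apply: le_bochner => //.
  exact: bochner_integrableB.
have le_D : \int[P]_(t in D) (rnorm (g t - s n t)%R)%:E <= (e / 2)%:E.
  apply: le_trans le_e; apply: ge0_subset_integral => //; first exact: mrn.
  by move=> t _; rewrite lee_fin.
apply: (@le_trans _ _ (\int[P]_(t in D) (rnorm (s n t))%:E +
    \int[P]_(t in D) (rnorm (g t - s n t)%R)%:E)).
  rewrite -ge0_integralD//; first last.
  - by apply: (measurable_funS measurableT) => //; exact: mrn.
  - by move=> t _; rewrite lee_fin.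
  - by apply: (measurable_funS measurableT) => //; exact: mrn.
  - by move=> t _; rewrite lee_fin.
  apply: ge0_le_integral => //.
  - by move=> t _; rewrite lee_fin.
  - by apply: (measurable_funS measurableT) => //; exact: mrn.
  - by apply: (measurable_funS measurableT) => //; apply: emeasurable_funD; exact: mrn.
  - move=> t _; rewrite -EFinD lee_fin -{1}[g t](subrKC (s n t)).
    exact: ler_rnormD.
have -> : e%:E = (e / 2)%:E + (e / 2)%:E by rewrite -EFinD -splitr.
rewrite [leRHS]addeA; apply: leeD; last exact: le_D.
by apply: (le_trans key); apply: leeD.
Qed.

Lemma is_cond_exp_linear (c : scalar_field R k) f1 f2 g1 g2 :
  is_cond_exp P F f1 g1 -> is_cond_exp P F f2 g2 ->
  is_cond_exp P F (fun t => c *: f1 t + f2 t)%R (fun t => c *: g1 t + g2 t)%R.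
Proof.
move=> [bf1 bg1 sg1 fg1] [bf2 bg2 sg2 fg2].
have bcf := bochner_integrableZ c bf1; have bcg := bochner_integrableZ c bg1.
split.
- exact: bochner_integrableD.
- exact: bochner_integrableD.
- move: sg1 sg2; rewrite !(strongly_measurable_sub Fs) => sg1 sg2.
  by apply: smD => //; apply: smZ => //; exact: sm_cst.
- move=> D FD; have mD := FT FD.
  rewrite (bochnerD cX mD bcg bg2) (bochnerD cX mD bcf bf2).
  by rewrite (bochnerZ cX c mD bg1) (bochnerZ cX c mD bf1) (fg1 _ FD) (fg2 _ FD).
Qed.

Lemma is_cond_expB f1 f2 g1 g2 :
  is_cond_exp P F f1 g1 -> is_cond_exp P F f2 g2 ->
  is_cond_exp P F (fun t => f1 t - f2 t)%R (fun t => g1 t - g2 t)%R.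
Proof.
move=> h1 h2; have := is_cond_exp_linear (-1) h2 h1.
by congr is_cond_exp; apply/funext => t; rewrite scaleN1r addrC.
Qed.

(** Two conditional expectations differ by a conditional expectation of zero,
    which vanishes by contractivity. *)
Lemma is_cond_exp_unique f g1 g2 :
  is_cond_exp P F f g1 -> is_cond_exp P F f g2 -> g1 = g2 %[ae P].
Proof.
move=> h1 h2; have [_ [sg1 _] _ _] := h1; have [_ [sg2 _] _ _] := h2.
apply: ae_eq_of_int_rnorm => //.
have FTT : F setT by apply/(sub_measurable_setP Fs); exact: measurableT.
rewrite (le_trans (le_cond_exp (is_cond_expB h1 h2) FTT))//.
by under eq_integral do rewrite subrr rnorm0; rewrite integral0.
Qed.

Lemma is_cond_exp_scale (r1 r2 : T -> R) (x : X) :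
  P.-integrable setT (EFin \o r1) -> sub_measurable F r2 ->
  P.-integrable setT (EFin \o r2) ->
  (forall D, F D -> \int[P]_(t in D) (r2 t)%:E = \int[P]_(t in D) (r1 t)%:E) ->
  is_cond_exp P F (fun t => scalar_of_real k (r1 t) *: x)%R
    (fun t => scalar_of_real k (r2 t) *: x)%R.
Proof.
move=> int1 m2 int2 rE.
split; [exact: bochner_integrable_scale|exact: bochner_integrable_scale| |].
- rewrite (strongly_measurable_sub Fs).
  by apply: smZ; [exact: sm_sr|exact: sm_cst].
- by move=> D FD; have mD := FT FD; rewrite !bochner_scale// rE.
Qed.

(** A simple function is a sum of vectors x multiplied by indicator functions;
    the conditional expectations of the latter are real functions. *)
Lemma is_cond_exp_simple (s : T -> X) : simple_fun measurable s ->
  exists g, is_cond_exp P F s g.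
Proof.
move=> [fs ms]; set r := finmap.enum_fset (fset_set (range s)).
have rP t : s t \in r by rewrite in_fset_set// inE; exists t.
have sE : s = (fun t => \sum_(x <- r) scalar_of_real k (\1_(s @^-1` [set x]) t) *: x)%R.
  apply/funext => t; rewrite (bigD1_seq (s t)) ?finmap.fset_uniq//=.
  rewrite indicE mem_set// sr1 scale1r big1_seq ?addr0// => x /andP[xs _].
  rewrite indicE memNset ?sr0 ?scale0r// => /= sx.
  by rewrite sx eqxx in xs.
rewrite sE; elim: r {rP sE} => [|x r [g ih]].
  exists (cst 0%R).
  have := @is_cond_exp_scale (cst 0%R) (cst 0%R) 0%R.
  rewrite (_ : (fun t => _ *: 0)%R = cst 0%R); last by apply/funext => t; rewrite scaler0.
  rewrite (_ : (fun t : T => \sum_(y <- [::]) _)%R = cst 0%R); last by apply/funext => t; rewrite big_nil.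
  apply => //; [exact: integrable0|exact: measurable_cst|exact: integrable0].
set E := s @^-1` [set x].
have mE : measurable E by exact: ms.
have intE : P.-integrable setT (EFin \o (\1_E : T -> R)) by exact: (integrable_indic P mE).
have [h [mh h0 hE]] : exists h, rcond_exp P F (\1_E : T -> R) h.
  apply: rcond_exp_exists => //.
  by rewrite integral_indic// setIT (le_lt_trans (probability_le1 P _))// ltry.
have FTT : F setT by apply/(sub_measurable_setP Fs); exact: measurableT.
have inth : P.-integrable setT (EFin \o h).
  apply/integrableP; split; first exact/measurable_EFinP/(sub_measurableW Fs FT).
  under eq_integral do rewrite gee0_abs ?lee_fin//.
  rewrite hE// integral_indic// setIT (le_lt_trans (probability_le1 P _))// ltry.
  by [].
exists (fun t => 1 *: (scalar_of_real k (h t) *: x) + g t)%R.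
have := is_cond_exp_linear 1 (is_cond_exp_scale x intE mh inth hE) ih.
congr is_cond_exp; apply/funext => t; by rewrite big_cons scale1r.
Qed.

End vector_cond_exp.

Section cond_exp_exists.
Context d (T : measurableType d) (R : realType) (P : probability T R)
  (F : set (set T)) (Fs : sigma_algebra [set: T] F) (FT : F `<=` measurable).
Local Notation TF := (g_sigma_algebraType F).
Context (k : scalar_kind) (X : normedModType (scalar_field R k)) (cX : rcomplete X).
Local Open Scope ereal_scope.

Let half_gt0 n : (0 < 2^-1 ^+ n :> R)%R. Proof. by rewrite exprn_gt0// invr_gt0. Qed.

Let half_small (C e : R) : (0 < e)%R -> exists n, (C * 2^-1 ^+ n <= e)%R.
Proof.
move=> e0.
have h : (C * 2^-1 ^+ n)%R @[n --> \oo] --> (0 : R)%R.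
  rewrite -[X in _ --> X](mulr0 C); apply: cvgMr; apply: cvg_expr.
  by rewrite ger0_norm ?invr_ge0// invf_lt1// ltr1n.
move/cvgr0Pnorm_le : h => /(_ e e0)/filter_ex[n hn]; exists n.
exact: le_trans (ler_norm _) hn.
Qed.

(** Simple functions s n with distance at most 2^-n from f in L^1 have
    conditional expectations g n which, by contractivity, satisfy that the
    sum of the norms of g n.+1 - g n is integrable. Hence the sequence g n
    converges almost everywhere, on a set D of F, and dominated convergence
    shows that its limit is a conditional expectation of f. *)
Lemma is_cond_exp_exists (f : T -> X) : bochner_integrable P f ->
  exists g, is_cond_exp P F f g.
Proof.
move=> bf; have [smf _] := bf.
have FTT : F setT by apply/(sub_measurable_setP Fs); exact: measurableT.
have /choice[s hs] : forall n, exists s : T -> X, simple_fun measurable s /\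
    \int[P]_t (rnorm (f t - s t)%R)%:E <= (2^-1 ^+ n)%:E.
  move=> n; have [u [su /ge0_cvge0P hu]] := bochner_integrable_approx bf.
  have [m hm] := filter_ex (hu (fun n => int_rnorm_ge0 P _) _ (half_gt0 n)).
  by exists (u m).
have ss n : simple_fun measurable (s n) by case: (hs n).
have sms n := sm_simple (ss n).
have le_s n : \int[P]_t (rnorm (f t - s n t)%R)%:E <= (2^-1 ^+ n)%:E by case: (hs n).
have /choice[g gE] : forall n, exists g, is_cond_exp P F (s n) g.
  by move=> n; exact: is_cond_exp_simple.
have sgF n : strongly_measurable (@measurable _ TF) (g n).
  by rewrite -(strongly_measurable_sub Fs); case: (gE n).
have sg n : strongly_measurable measurable (g n) by case: (gE n) => _ [].
have bs n : bochner_integrable P (s n) by case: (gE n).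
have bg n : bochner_integrable P (g n) by case: (gE n).
(* The sequence g is Cauchy in L^1, at a geometric rate. *)
have dg m n : \int[P]_t (rnorm (g m t - g n t)%R)%:E <= (2^-1 ^+ m + 2^-1 ^+ n)%:E.
  apply: (le_trans (le_cond_exp Fs FT cX (is_cond_expB Fs FT cX (gE m) (gE n)) FTT)).
  apply: (le_trans (int_rnormD P (sms m) smf (sms n))).
  rewrite EFinD; apply: leeD; last exact: le_s.
  by under eq_integral do rewrite rnormB; exact: le_s.
pose h n t := rnorm (g n.+1 t - g n t)%R.
have h0 n t : (0 <= h n t)%R by exact: rnorm_ge0.
have mhF n : sub_measurable F (h n).
  by apply: (@sm_rnorm _ TF _ _ _ (fun t => g n.+1 t - g n t)%R); exact: smB.
pose H t := \sum_(n <oo) (h n t)%:E.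
have mHF : sub_measurable F H.
  apply: (@ge0_emeasurable_sum _ TF _ setT (fun n t => (h n t)%:E) xpredT) => //.
    by move=> n t _ _; rewrite lee_fin h0.
  by move=> n _; apply/measurable_EFinP; exact: mhF.
have H0 t : 0 <= H t by apply: nneseries_ge0 => n _ _; rewrite lee_fin h0.
have intH : P.-integrable setT H.
  apply/integrableP; split; first exact: sub_measurableW mHF.
  under eq_integral do rewrite gee0_abs//.
  rewrite integral_nneseries//; first last.
  - by move=> n t _; rewrite lee_fin h0.
  - by move=> n; apply/measurable_EFinP; exact: (sub_measurableW Fs FT (mhF n)).
  apply: (@le_lt_trans _ _ 4%:E); last exact: ltry.
  apply: lime_le.
    by apply: is_cvg_nneseries => n _ _; exact: int_rnorm_ge0.
  apply: nearW => n; apply: (@le_trans _ _ (\sum_(0 <= i < n) (2 * 2^-1 ^+ i)%:E)).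
    apply: lee_sum => i _; apply: le_trans (dg i.+1 i) _; rewrite lee_fin exprS.
    by have := half_gt0 i; lra.
  rewrite sumEFin lee_fin.
  suff -> : (\sum_(0 <= i < n) (2 * 2^-1 ^+ i) = 4 - 4 * 2^-1 ^+ n :> R)%R.
    by have := half_gt0 n; lra.
  elim: n => [|n ih]; first by rewrite big_geq// expr0; lra.
  by rewrite big_nat_recr//= ih exprS; lra.
pose D := [set t | H t < +oo].
have FD : F D.
  apply/(sub_measurable_setP Fs); rewrite -[X in measurable X]setTI.
  exact: emeasurable_fun_infty_o.
have mD := FT FD.
have aeD : {ae P, forall t, D t}.
  apply: filterS (integrable_ae measurableT intH) => t /(_ I).
  by rewrite ge0_fin_numE.
pose S t n := (\sum_(0 <= i < n) h i t)%R.
have S_le t n : (S t n)%:E <= H t.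
  rewrite /S -sumEFin; apply: nneseries_lim_ge => i _.
  by rewrite lee_fin h0.
have S_nd t : nondecreasing_seq (S t).
  by apply/nondecreasing_seqP => n; rewrite /S big_nat_recr//= lerDl h0.
have gS t m n : (n <= m)%N -> (rnorm (g m t - g n t) <= S t m - S t n)%R.
  elim: m => [|m ih]; first by rewrite leqn0 => /eqP ->; rewrite !subrr rnorm0.
  rewrite leq_eqVlt => /predU1P[->|]; first by rewrite !subrr rnorm0.
  rewrite ltnS => /ih {}ih.
  rewrite (le_trans (ler_rnorm_sub _ (g m t) _))// /S big_nat_recr//= -/(S t m) -/(h m t).
  by rewrite [leRHS]addrAC [leRHS]addrC lerD2l.
(* Outside D the functions are set to zero, which makes them converge everywhere
   without changing their class. *)
pose g' n : T -> X := patch (cst 0%R) D (g n).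
have /choice[G hG] : forall t, exists l : X, g' n t @[n --> \oo] --> l.
  move=> t; case: (boolP (t \in D)) => tD; last first.
    exists 0%R; rewrite /g' /patch (negbTE tD); exact: cvg_cst.
  rewrite /g' /patch tD; apply: cX => e e0.
  have Hfin : H t \is a fin_num by rewrite ge0_fin_numE//; move: tD; rewrite inE.
  have /cvg_ex[L] : cvgn (S t).
    apply: nondecreasing_is_cvgn => //; exists (fine (H t)) => _ [n _ <-].
    by rewrite -lee_fin fineK.
  have e20 : (0 < e / 2)%R by rewrite divr_gt0.
  move=> /cvgrPdist_lt/(_ _ e20)[N _ hN].
  have close m n : (N <= m)%N -> (N <= n)%N -> (n <= m)%N ->
      (rnorm (g m t - g n t) < e)%R.
    move=> Nm Nn nm; apply: (le_lt_trans (gS t m n nm)).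
    have /= := hN m Nm; have /= := hN n Nn.
    by rewrite !ltr_norml => /andP[? ?] /andP[? ?]; lra.
  exists N => m n Nm Nn; have [nm|/ltnW mn] := leqP n m; first exact: close.
  by rewrite rnormB; exact: close.
have sg'F n : strongly_measurable (@measurable _ TF) (g' n).
  by apply: sm_patch => //; exact/(sub_measurable_setP Fs).
have sGF : strongly_measurable F G.
  by rewrite (strongly_measurable_sub Fs); exact: (@sm_limit _ TF R k X g' G sg'F hG).
have sG := strongly_measurable_subW FT sGF.
have bg' n : bochner_integrable P (g' n) by exact: bochner_integrable_patch.
have sg' n : strongly_measurable measurable (g' n) by case: (bg' n).
have mrn (u v : T -> X) : strongly_measurable measurable u ->
    strongly_measurable measurable v ->
    measurable_fun setT (fun t => (rnorm (u t - v t)%R)%:E).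
  by move=> su sv; apply: measurable_rnorm_EFin; exact: smB.
have dG n : \int[P]_t (rnorm (G t - g' n t)%R)%:E <= (2 * 2^-1 ^+ n)%:E.
  have [||||| _ _ cv] := @dominated_convergence _ _ _ P setT measurableT
     (fun m t => (rnorm (g' m t - g' n t)%R)%:E)
     (fun t => (rnorm (G t - g' n t)%R)%:E) H.
  - by move=> m; exact: mrn.
  - exact: mrn.
  - apply: nearW => t _; apply: cvg_EFin; first exact: nearW.
    by apply: cvg_rnorm; apply: cvgB; [exact: hG|exact: cvg_cst].
  - exact: intH.
  - apply: nearW => t m _; rewrite gee0_abs ?lee_fin// /g' /patch.
    case: ifPn => tD; last by rewrite subrr rnorm0.
    wlog nm : m n / (n <= m)%N => [hwlog|].
      have [nm|/ltnW mn] := leqP n m; first exact: hwlog.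
      by rewrite rnormB; exact: hwlog.
    apply: le_trans (S_le t m); rewrite lee_fin (le_trans (gS t m n nm))//.
    by rewrite gerBl /S sumr_ge0// => i _; exact: h0.
  apply: (cvge_le _ cv); exists n => // m /= nm.
  apply: (@le_trans _ _ (\int[P]_t (rnorm (g m t - g n t)%R)%:E)).
    apply: ge0_le_integral => //.
    - by move=> t _; rewrite lee_fin.
    - exact: mrn.
    - exact: mrn.
    - move=> t _; rewrite lee_fin /g' /patch; case: ifP => // _.
      by rewrite subrr rnorm0.
  apply: (le_trans (dg m n)); rewrite lee_fin.
  have : (2^-1 ^+ m <= 2^-1 ^+ n :> R)%R.
    by rewrite ler_wiXn2l// ?invr_ge0// invf_le1// ler1n.
  by lra.
have bG : bochner_integrable P G.
  have -> : G = (fun t => (G t - g' 0%N t) + g' 0%N t)%R.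
    by apply/funext => t; rewrite subrK.
  apply: bochner_integrableD => //; split; first exact: smB.
  by rewrite (le_lt_trans (dG 0%N))// ltry.
exists G; split; [exact: bf|exact: bG|exact: sGF|move=> E FE; have mE := FT FE].
apply/eqP; rewrite -subr_eq0 -rnorm_eq0 eq_le rnorm_ge0 andbT.
apply/ler_addgt0Pr => e /(half_small 3)[n le_e]; rewrite add0r.
have gsE : bochner P E (g' n) = bochner P E (s n).
  have [_ _ _ gsn] := gE n; rewrite -(gsn E FE).
  apply: (bochner_ae_eq cX mE (bg' n) (bg n)).
  by apply: filterS aeD => t Dt _; rewrite /g' /patch mem_set.
apply: le_trans le_e.
have h1 := bochner_dist cX mE bG (bg' n).
have h2 := bochner_dist cX mE (bs n) bf.
have {}h1 := le_trans h1 (dG n).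
have {}h2 : (rnorm (bochner P E (s n) - bochner P E f)%R)%:E <= (2^-1 ^+ n)%:E.
  apply: (le_trans h2); apply: le_trans (le_s n).
  by under eq_integral do rewrite rnormB.
rewrite -gsE in h2; apply: le_trans (ler_rnorm_sub _ (bochner P E (g' n)) _) _.
have -> : (3 * 2^-1 ^+ n = 2 * 2^-1 ^+ n + 2^-1 ^+ n :> R)%R by ring.
by apply: lerD.
Qed.

(** cond_exp selects a conditional expectation. *)
Lemma cond_expP (f : T -> X) : bochner_integrable P f ->
  is_cond_exp P F f (cond_exp P F f).
Proof. by move=> /is_cond_exp_exists[g fg]; exact: xgetI fg. Qed.

End cond_exp_exists.

(** * Boundedness of the conditional expectation and duality *)

Lemma conjugate_gt1 (R : realType) (p p' : R) : 1 < p -> p^-1 + p'^-1 = 1 -> 1 < p'.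
Proof.
move=> p1 pp; have p0 : 0 < p := lt_trans ltr01 p1.
have ip1 : p^-1 < 1 by rewrite invf_lt1.
have ip0 : 0 < p^-1 by rewrite invr_gt0.
have ip'0 : 0 < p'^-1 by lra.
have p'0 : 0 < p' by rewrite -invr_gt0.
by rewrite -(invf_lt1 p'0); lra.
Qed.

(** If J <= a J^(1/p), then J^(1/p') <= a; J = 0 is the case in which one may
    not divide. *)
Lemma powR_conjugate_le (R : realType) (J a p p' : R) : 0 <= J -> 0 <= a ->
  1 < p' -> p^-1 + p'^-1 = 1 -> J <= a * J `^ p^-1 -> J `^ p'^-1 <= a.
Proof.
move=> J0 a0 p'1 pp; have [->|Jn0] := eqVneq J 0.
  by move=> _; rewrite powR0// invr_eq0 gt_eqF// (lt_trans ltr01).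
have Jgt0 : 0 < J by rewrite lt_def Jn0.
rewrite -{1}(powRr1 J0) -pp powRD; last by rewrite Jn0 implybT.
by rewrite [leLHS]mulrC ler_pM2r// powR_gt0.
Qed.

Section duality.
Context d1 d2 (A : measurableType d1) (B : measurableType d2) (R : realType)
  (mu : probability A R) (nu : probability B R)
  (F : set (set (A * B))) (Fs : sigma_algebra [set: A * B] F)
  (FT : F `<=` measurable).
Local Notation P := (mu \x nu)%E.
Local Notation norm p q f := (mnorm mu nu p q (EFin \o f)).

(** The conditional expectation of nonnegative functions is bounded by C for
    the mixed norm with exponents p and q. *)
Definition rcond_bounded (p q C : R) := forall f g : A * B -> R,
  measurable_fun setT f -> (forall z, 0 <= f z) -> rcond_exp P F f g ->
  (norm p q f < +oo)%E -> (norm p q g <= C%:E * norm p q f)%E.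

(** The same bound for all F-measurable functions g whose integrals over the
    sets of F are at most those of f. The norm of a vector-valued conditional
    expectation is of this kind, but it is not a conditional expectation. *)
Definition rcond_dominated (p q C : R) := forall f g : A * B -> R,
  measurable_fun setT f -> (forall z, 0 <= f z) ->
  sub_measurable F g -> (forall z, 0 <= g z) ->
  (forall D, F D -> \int[P]_(z in D) (g z)%:E <= \int[P]_(z in D) (f z)%:E)%E ->
  (norm p q f < +oo)%E -> (norm p q g <= C%:E * norm p q f)%E.

Lemma rcond_dominated_bounded p q C : rcond_dominated p q C -> rcond_bounded p q C.
Proof.
move=> h f g mf f0 [mg g0 fg]; apply: h => // D FD.
by rewrite fg.
Qed.

(** Functions of finite mixed norm have a conditional expectation, because they
    are integrable. *)
Lemma norm_rcond_exp (p q p' q' : R) (phi : A * B -> R) : 1 < p -> 1 < q ->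
  p^-1 + p'^-1 = 1 -> q^-1 + q'^-1 = 1 -> measurable_fun setT phi ->
  (forall z, 0 <= phi z) -> (norm p q phi < +oo)%E -> exists psi, rcond_exp P F phi psi.
Proof.
move=> p1 q1 pp qq mphi phi0 phiN; apply: rcond_exp_exists => //.
apply: le_lt_trans phiN.
apply: (@integral_le_mnorm _ _ _ _ _ mu nu _ p q p' q') => //.
- exact: lt_trans p1.
- exact: lt_trans q1.
- exact: lt_trans (conjugate_gt1 p1 pp).
- exact: lt_trans (conjugate_gt1 q1 qq).
- exact/measurable_EFinP.
Qed.

(** Duality: if g is bounded, J = norm g ^ p' is the integral of g * phi for a
    norming function phi, hence of g * E(phi), because g is F-measurable. It is
    at most the integral of f * E(phi), which the Hoelder inequality
    estimates. *)
Lemma rcond_bounded_dual (p q p' q' C : R) : 1 < p -> 1 < q -> 0 <= C ->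
  p^-1 + p'^-1 = 1 -> q^-1 + q'^-1 = 1 ->
  rcond_bounded p q C -> rcond_dominated p' q' C.
Proof.
move=> p1 q1 C0 pp qq bC f g mf f0 mg g0 gf fN.
have p'1 := conjugate_gt1 p1 pp; have q'1 := conjugate_gt1 q1 qq.
have p0 : 0 < p := lt_trans ltr01 p1; have q0 : 0 < q := lt_trans ltr01 q1.
have p'0 : 0 < p' := lt_trans ltr01 p'1; have q'0 : 0 < q' := lt_trans ltr01 q'1.
have p'p : p'^-1 + p^-1 = 1 by rewrite addrC.
have q'q : q'^-1 + q^-1 = 1 by rewrite addrC.
have mgT := sub_measurableW Fs FT mg.
(* Norming functions exist for bounded functions. *)
pose gn n z := Num.min (g z) n%:R.
have gn0 n z : 0 <= gn n z by rewrite /gn le_min g0 ler0n.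
have mgn n : sub_measurable F (gn n).
  by apply: measurable_minr => //; exact: measurable_cst.
have mgnT n := sub_measurableW Fs FT (mgn n).
apply: (mnorm_sup_le (f_ := fun n => EFin \o gn n)) => //.
- by move=> n; exact/measurable_EFinP.
- move=> z i j ij; rewrite /= lee_fin /gn le_min ge_min lexx/=.
  by rewrite ge_min ler_nat ij orbT.
- move=> z; apply: cvg_EFin; first exact: nearW.
  apply: (@cvg_trans _ (cst (g z) @ \oo)); last exact: cvg_cst.
  apply: near_eq_cvg; exists (Num.bound (g z)) => // n /= zn.
  rewrite /gn min_l//; apply: ltW; apply: lt_le_trans (archi_boundP (g0 z)) _.
  by rewrite ler_nat.
move=> n.
have gnb z : 0 <= gn n z <= n%:R by rewrite gn0 /gn ge_min lexx orbT.
have [phi [J [mphi phi0 J0 [gphi gnN phiN]]]] := @mnorm_extremal _ _ A B R mu nu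
  (gn n) n%:R p' q' p q p'1 q'1 p'p q'q (mgnT n) gnb.
rewrite gnN.
have phifin : (norm p q phi < +oo)%E by rewrite phiN ltry.
have [psi psiE] := norm_rcond_exp p1 q1 pp qq mphi phi0 phifin.
have [mpsi psi0 phipsi] := psiE.
have mpsiT := sub_measurableW Fs FT mpsi.
have fge0 : (0 <= norm p' q' f)%E by exact: mnorm_ge0.
have ffin : norm p' q' f \is a fin_num by rewrite ge0_fin_numE.
have le_J : (J%:E <= C%:E * norm p q phi * norm p' q' f)%E.
  apply: (@le_trans _ _ (norm p q psi * norm p' q' f)%E); last first.
    by rewrite lee_wpmul2r// bC.
  apply: (@le_trans _ _ (\int[P]_z ((psi z)%:E * (f z)%:E))%E); last first.
    by apply: mnorm_hoelder => //; exact/measurable_EFinP.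
  under eq_integral do rewrite -EFinM.
  apply: (@le_trans _ _ (\int[P]_z (psi z * gn n z)%:E)%E); last first.
    apply: (le_integral_sub_mul Fs FT) => // D FD.
    apply: le_trans (gf D FD); apply: ge0_le_integral => //.
    - exact: FT.
    - by move=> z _; rewrite lee_fin.
    - by apply: (measurable_funS measurableT) => //; exact/measurable_EFinP.
    - by apply: (measurable_funS measurableT) => //; exact/measurable_EFinP.
    - by move=> z _; rewrite lee_fin /gn ge_min lexx.
  rewrite -gphi; under [leRHS]eq_integral do rewrite mulrC.
  by apply: (le_integral_sub_mul Fs FT) => // D FD; rewrite phipsi.
rewrite -(fineK ffin) -EFinM lee_fin; apply: (powR_conjugate_le (p := p)) => //.
  by rewrite mulr_ge0// fine_ge0.
by move: le_J; rewrite phiN -(fineK ffin) -!EFinM lee_fin mulrAC.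
Qed.

Context (k : scalar_kind).

Section projection.
Context (X : normedModType (scalar_field R k)) (cX : rcomplete X).

Lemma mixed_normE p q (f : A * B -> X) :
  mixed_norm mu nu p q f = norm p q (fun z => rnorm (f z)).
Proof. by []. Qed.

Lemma mixed_norm_ge0 p q (f : A * B -> X) : (0 <= mixed_norm mu nu p q f)%E.
Proof. exact: Lnorm_ge0. Qed.

Lemma LpLq_bochner_integrable (p q p' q' : R) (f : A * B -> X) : 1 < p -> 1 < q ->
  p^-1 + p'^-1 = 1 -> q^-1 + q'^-1 = 1 ->
  LpLq mu nu p q X f -> bochner_integrable P f.
Proof.
move=> p1 q1 pp qq [sf fN]; split=> //; apply: le_lt_trans fN.
rewrite mixed_normE; apply: (@integral_le_mnorm _ _ _ _ _ mu nu _ p q p' q') => //.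
- exact: lt_trans p1.
- exact: lt_trans q1.
- exact: lt_trans (conjugate_gt1 p1 pp).
- exact: lt_trans (conjugate_gt1 q1 qq).
- exact: measurable_rnorm_EFin.
- by move=> z; rewrite lee_fin.
Qed.

(** For a vector x other than zero, the conditional expectation of f x is
    E(f) x. *)
Lemma rcond_bounded_projection (p q p' q' : R) : 1 < p -> 1 < q ->
  p^-1 + p'^-1 = 1 -> q^-1 + q'^-1 = 1 -> (exists x : X, x != 0) ->
  restricts_to_bounded_projection P (cond_exp P F) (LpLq mu nu p q X)
    (mixed_norm mu nu p q) ->
  exists2 C, 0 <= C & rcond_bounded p q C.
Proof.
move=> p1 q1 pp qq [x x0] [VE _ _ [C0 hC0]].
have p0 : 0 < p := lt_trans ltr01 p1; have q0 : 0 < q := lt_trans ltr01 q1.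
pose C := Num.max C0 0.
have hC f : LpLq mu nu p q X f ->
    (mixed_norm mu nu p q (cond_exp P F f) <= C%:E * mixed_norm mu nu p q f)%E.
  move=> Vf; rewrite (le_trans (hC0 f Vf))// lee_wpmul2r//.
    exact: mixed_norm_ge0.
  by rewrite lee_fin /C le_max lexx.
exists C; first by rewrite /C le_max lexx orbT.
move=> f g mf f0 [mg g0 fg] fN.
have mgT := sub_measurableW Fs FT mg.
have FTT : F setT by apply/(sub_measurable_setP Fs); exact: measurableT.
have intf : P.-integrable setT (EFin \o f).
  apply/integrableP; split; first exact/measurable_EFinP.
  under eq_integral do rewrite gee0_abs ?lee_fin//.
  apply: le_lt_trans fN; apply: (@integral_le_mnorm _ _ _ _ _ mu nu _ p q p' q') => //.
  - exact: lt_trans (conjugate_gt1 p1 pp).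
  - exact: lt_trans (conjugate_gt1 q1 qq).
  - exact/measurable_EFinP.
have intg : P.-integrable setT (EFin \o g).
  apply/integrableP; split; first exact/measurable_EFinP.
  under eq_integral do rewrite gee0_abs ?lee_fin//.
  rewrite fg//; have [_] := integrableP _ _ _ intf.
  by under eq_integral do rewrite gee0_abs ?lee_fin//.
pose emb (r : A * B -> R) : A * B -> X := fun z => scalar_of_real k (r z) *: x.
have fgX : is_cond_exp P F (emb f) (emb g) by exact: is_cond_exp_scale.
have embN (r : A * B -> R) : measurable_fun setT r -> (forall z, 0 <= r z) ->
    mixed_norm mu nu p q (emb r) = ((rnorm x)%:E * norm p q r)%E.
  move=> mr r0; rewrite -mnormZ//; last exact/measurable_EFinP.
  rewrite mixed_normE; congr mnorm; apply/funext => z /=.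
  by rewrite /emb rnormZr ger0_norm// EFinM muleC.
have [[sf _] [sg _] _ _] := fgX.
have Vf : LpLq mu nu p q X (emb f).
  by split=> //; rewrite embN// lte_mul_pinfty// lee_fin.
have ffin : norm p q f \is a fin_num by rewrite ge0_fin_numE// mnorm_ge0.
have Ef := cond_expP Fs FT cX (LpLq_bochner_integrable p1 q1 pp qq Vf).
have [_ [sEf _] _ _] := Ef.
have eq_ae := is_cond_exp_unique Fs FT cX fgX Ef.
have : (mixed_norm mu nu p q (emb g) <= C%:E * mixed_norm mu nu p q (emb f))%E.
  apply: le_trans (hC _ Vf); rewrite !mixed_normE; apply: ae_le_mnorm => //.
  - exact: measurable_rnorm_EFin.
  - exact: measurable_rnorm_EFin.
  - by apply: filterS eq_ae => z /(_ I) /= ->.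
rewrite !embN// muleCA lee_pmul2l ?fin_numE//.
by rewrite lte_fin lt_def rnorm_eq0 x0 rnorm_ge0.
Qed.

(** By contractivity, the norms of f and E(f) satisfy the hypothesis of the
    domination bound. *)
Lemma projection_rcond_dominated (p q p' q' C : R) : 1 < p -> 1 < q ->
  p^-1 + p'^-1 = 1 -> q^-1 + q'^-1 = 1 -> rcond_dominated p q C ->
  restricts_to_bounded_projection P (cond_exp P F) (LpLq mu nu p q X)
    (mixed_norm mu nu p q).
Proof.
move=> p1 q1 pp qq hC.
have bi f : LpLq mu nu p q X f -> bochner_integrable P f.
  exact: (LpLq_bochner_integrable p1 q1 pp qq).
have cE f : LpLq mu nu p q X f -> is_cond_exp P F f (cond_exp P F f).
  by move=> /bi; exact: cond_expP.
have leE f : LpLq mu nu p q X f ->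
    (mixed_norm mu nu p q (cond_exp P F f) <= C%:E * mixed_norm mu nu p q f)%E.
  move=> Vf; have [[sf _] [sg _] sgF _] := cE f Vf; rewrite !mixed_normE.
  apply: hC => //.
  - exact: sm_rnorm.
  - rewrite (strongly_measurable_sub Fs) in sgF; exact: sm_rnorm sgF.
  - by move=> D FD; exact: (le_cond_exp Fs FT cX (cE f Vf) FD).
  - by case: Vf.
split.
- move=> f Vf; split; first by case: (cE f Vf) => _ [].
  apply: le_lt_trans (leE f Vf) _; have [_ fN] := Vf.
  have ffin : mixed_norm mu nu p q f \is a fin_num by rewrite ge0_fin_numE// mixed_norm_ge0.
  by rewrite -(fineK ffin) -EFinM ltry.
- move=> c f g Vf Vg.
  have fg := is_cond_exp_linear Fs FT cX c (cE f Vf) (cE g Vg).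
  apply: (is_cond_exp_unique Fs FT cX _ fg); apply: cond_expP => //.
  by case: fg.
- move=> f Vf; have [_ bg sg _] := cE f Vf.
  by apply: (is_cond_exp_unique Fs FT cX (cond_expP Fs FT cX bg)).
- by exists C.
Qed.

End projection.

End duality.

(** * The pairing of mixed-norm spaces *)

Section minkowski.
Context d1 d2 (A : measurableType d1) (B : measurableType d2) (R : realType)
  (mu : probability A R) (nu : probability B R).
Local Open Scope ereal_scope.

(** Only the finiteness part of the Minkowski inequality is needed. *)
Lemma LnormD_lty d (T : measurableType d) (m : {measure set T -> \bar R})
    (u v : T -> \bar R) (p : R) : (1 <= p)%R ->
  measurable_fun setT u -> measurable_fun setT v ->
  (forall x, 0 <= u x) -> (forall x, 0 <= v x) ->
  Lnorm m p%:E u < +oo -> Lnorm m p%:E v < +oo ->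
  Lnorm m p%:E (fun x => u x + v x) < +oo.
Proof.
move=> p1 mu_ mv u0 v0 ufin vfin; have p0 : (0 < p)%R := lt_le_trans ltr01 p1.
have mfu : measurable_fun setT (fine \o u) by exact: measurableT_comp.
have mfv : measurable_fun setT (fine \o v) by exact: measurableT_comp.
have fine_le (h : T -> \bar R) : measurable_fun setT h ->
    Lnorm m p%:E (EFin \o (fine \o h)) <= Lnorm m p%:E h.
  move=> mh; apply: le_Lnorm => //.
    by apply/measurable_EFinP; exact: measurableT_comp.
  by move=> x /=; case: (h x) => [z| |] //=; rewrite normr0 ?leey.
apply: (@le_lt_trans _ _ (Lnorm m p%:E (EFin \o ((fine \o u) \+ (fine \o v))%R))).
  apply: ae_le_Lnorm => //.
  - exact: emeasurable_funD.
  - by apply/measurable_EFinP; exact: measurable_funD.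
  apply: filterS2 (Lnorm_ae_fin p0 mu_ ufin) (Lnorm_ae_fin p0 mv vfin) => x ux vx /=.
  by rewrite -{1}(fineK ux) -{1}(fineK vx) -EFinD.
apply: (le_lt_trans (minkowski_EFin m mfu mfv p1)).
apply: lte_add_pinfty; apply: le_lt_trans; try exact: fine_le; by [].
Qed.

Lemma mnormD_lty (f g : A * B -> R) (p q : R) : (1 <= p)%R -> (1 <= q)%R ->
  measurable_fun setT f -> measurable_fun setT g ->
  mnorm mu nu p q (EFin \o f) < +oo -> mnorm mu nu p q (EFin \o g) < +oo ->
  mnorm mu nu p q (fun z => (f z + g z)%:E) < +oo.
Proof.
move=> p1 q1 mf mg ffin gfin.
have p0 : (0 < p)%R := lt_le_trans ltr01 p1.
have mfE : measurable_fun setT (EFin \o f) by exact/measurable_EFinP.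
have mgE : measurable_fun setT (EFin \o g) by exact/measurable_EFinP.
have mfg : measurable_fun setT (fun z => (f z + g z)%:E).
  by apply/measurable_EFinP; exact: measurable_funD.
apply: le_lt_trans (LnormD_lty p1 (measurable_inner_norm nu q mfE)
  (measurable_inner_norm nu q mgE) (fun=> Lnorm_ge0 _ _ _) (fun=> Lnorm_ge0 _ _ _)
  ffin gfin).
apply: le_Lnorm => //.
- exact: (measurable_inner_norm nu q mfg).
- exact: emeasurable_funD (measurable_inner_norm nu q mfE) (measurable_inner_norm nu q mgE).
move=> a; rewrite !gee0_abs ?adde_ge0 ?Lnorm_ge0//.
apply: (minkowski_EFin nu (f := fun b => f (a, b)) (g := fun b => g (a, b))) => //.
- by apply/measurable_EFinP; exact: measurable_section mfE.
- by apply/measurable_EFinP; exact: measurable_section mgE.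
Qed.

End minkowski.

Section pairing_theory.
Context d1 d2 (A : measurableType d1) (B : measurableType d2) (R : realType)
  (mu : probability A R) (nu : probability B R) (k : scalar_kind).
Context (p q p' q' : R) (p1 : 1 < p) (q1 : 1 < q)
  (pp : p^-1 + p'^-1 = 1) (qq : q^-1 + q'^-1 = 1).
Local Notation P := (mu \x nu)%E.
Local Notation K := (scalar_field R k).
Local Notation N p q f := (mixed_norm mu nu p q (X := K^o) f).
Implicit Types f g h : A * B -> K^o.
Local Notation sm := (strongly_measurable (@measurable _ (A * B)%type)).

Let p0 : 0 < p. Proof. exact: lt_trans p1. Qed.
Let q0 : 0 < q. Proof. exact: lt_trans q1. Qed.
Let p'0 : 0 < p'. Proof. exact: lt_trans (conjugate_gt1 p1 pp). Qed.
Let q'0 : 0 < q'. Proof. exact: lt_trans (conjugate_gt1 q1 qq). Qed.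

Lemma smM d (T : measurableType d) (f g : T -> K^o) :
  strongly_measurable measurable f -> strongly_measurable measurable g ->
  strongly_measurable measurable (fun t => f t * g t : K^o).
Proof. exact: smZ. Qed.

Lemma mixed_norm_lty_fin r s f : (N r s f < +oo)%E -> N r s f \is a fin_num.
Proof. by move=> h; rewrite ge0_fin_numE// mixed_norm_ge0. Qed.

Lemma ae_le_mixed_norm r s f g : 0 < r -> 0 < s -> sm f -> sm g ->
  {ae P, forall z, rnorm (f z) <= rnorm (g z)} -> (N r s f <= N r s g)%E.
Proof.
move=> r0 s0 sf sg fg; rewrite !mixed_normE; apply: ae_le_mnorm => //; try exact: measurable_rnorm_EFin.
by apply: filterS fg => z fg /=; rewrite lee_fin !ger0_norm.
Qed.

Lemma le_mixed_norm r s f g : 0 < r -> 0 < s -> sm f -> sm g ->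
  (forall z, rnorm (f z) <= rnorm (g z)) -> (N r s f <= N r s g)%E.
Proof. by move=> r0 s0 sf sg fg; apply: ae_le_mixed_norm => //; exact: nearW. Qed.

Lemma ae_eq_mixed_norm r s f g : 0 < r -> 0 < s -> sm f -> sm g ->
  f = g %[ae P] -> N r s f = N r s g.
Proof.
move=> r0 s0 sf sg fg; apply/eqP; rewrite eq_le; apply/andP; split;
  apply: ae_le_mixed_norm => //; apply: filterS fg => z /(_ I) -> //.
Qed.

Lemma LpLqD r s (c : K) f g : 1 < r -> 1 < s ->
  LpLq mu nu r s K^o f -> LpLq mu nu r s K^o g ->
  LpLq mu nu r s K^o (fun z => c *: f z + g z).
Proof.
move=> r1 s1 [sf fN] [sg gN].
have r0 : 0 < r := lt_trans ltr01 r1; have s0 : 0 < s := lt_trans ltr01 s1.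
have scf : sm (fun z => c *: f z) by apply: smZ => //; exact: sm_cst.
have cfN : (N r s (fun z => c *: f z)%R < +oo)%E.
  have -> : N r s (fun z => c *: f z)%R = ((rnorm (c : K^o))%:E * N r s f)%E.
    rewrite !mixed_normE -mnormZ//; last exact: measurable_rnorm_EFin.
    by congr mnorm; apply/funext => z /=; rewrite rnormZ EFinM.
  by rewrite lte_mul_pinfty// lee_fin.
split; first exact: smD.
apply: le_lt_trans (mnormD_lty (ltW r1) (ltW s1) (sm_rnorm scf) (sm_rnorm sg) cfN gN).
rewrite mixed_normE; apply: le_mnorm => //.
- by apply: measurable_rnorm_EFin; exact: smD.
- by apply/measurable_EFinP; apply: measurable_funD; exact: sm_rnorm.
- move=> z; rewrite !gee0_abs ?lee_fin ?addr_ge0//; exact: ler_rnormD.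
Qed.

Lemma LpLqB r s f g : 1 < r -> 1 < s ->
  LpLq mu nu r s K^o f -> LpLq mu nu r s K^o g ->
  LpLq mu nu r s K^o (fun z => f z - g z).
Proof.
move=> r1 s1 Vf Vg; have := LpLqD (-1) r1 s1 Vg Vf.
by congr (LpLq _ _ _ _ _ _); apply/funext => z; rewrite scaleN1r addrC.
Qed.

Lemma pairing_integrable f g : LpLq mu nu p q K^o f -> LpLq mu nu p' q' K^o g ->
  bochner_integrable P (fun z => f z * g z : K^o) /\
  (\int[P]_z (rnorm (f z * g z : K^o))%:E <= N p q f * N p' q' g)%E.
Proof.
move=> [sf fN] [sg gN].
have le_fg : (\int[P]_z (rnorm (f z * g z : K^o))%:E <= N p q f * N p' q' g)%E.
  under eq_integral do rewrite rnormM EFinM.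
  rewrite !mixed_normE.
  apply: mnorm_hoelder => //; try exact: measurable_rnorm_EFin;
    by move=> z; rewrite lee_fin.
split=> //; split; first exact: smM.
apply: (le_lt_trans le_fg).
by rewrite -(fineK (mixed_norm_lty_fin fN)) -(fineK (mixed_norm_lty_fin gN)) -EFinM ltry.
Qed.

Lemma le_pairing f g : LpLq mu nu p q K^o f -> LpLq mu nu p' q' K^o g ->
  ((rnorm (pairing mu nu f g))%:E <= N p q f * N p' q' g)%E.
Proof.
move=> Vf Wg; have [bfg le_fg] := pairing_integrable Vf Wg.
exact: (le_trans (le_bochner (@scalar_rcomplete R k) measurableT bfg)).
Qed.

Lemma pairingDl (c : K) f1 f2 g : LpLq mu nu p q K^o f1 ->
  LpLq mu nu p q K^o f2 -> LpLq mu nu p' q' K^o g ->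
  pairing mu nu (fun z => c *: f1 z + f2 z) g =
  c *: pairing mu nu f1 g + pairing mu nu f2 g.
Proof.
move=> V1 V2 Wg; have cK := @scalar_rcomplete R k.
have [b1 _] := pairing_integrable V1 Wg; have [b2 _] := pairing_integrable V2 Wg.
rewrite /pairing -(bochnerZ cK c measurableT b1).
rewrite -(bochnerD cK measurableT (bochner_integrableZ c b1) b2).
congr (bochner _ _ _); apply/funext => z; rewrite mulrDl; congr (_ + _).
exact/esym/mulrA.
Qed.

Lemma pairingDr (c : K) f g1 g2 : LpLq mu nu p q K^o f ->
  LpLq mu nu p' q' K^o g1 -> LpLq mu nu p' q' K^o g2 ->
  pairing mu nu f (fun z => c *: g1 z + g2 z) =
  c *: pairing mu nu f g1 + pairing mu nu f g2.
Proof.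
move=> Vf W1 W2; have cK := @scalar_rcomplete R k.
have [b1 _] := pairing_integrable Vf W1; have [b2 _] := pairing_integrable Vf W2.
rewrite /pairing -(bochnerZ cK c measurableT b1).
rewrite -(bochnerD cK measurableT (bochner_integrableZ c b1) b2).
congr (bochner _ _ _); apply/funext => z; rewrite mulrDr; congr (_ + _).
exact: (@mulrCA K).
Qed.

End pairing_theory.

Section truncation.
Context d1 d2 (A : measurableType d1) (B : measurableType d2) (R : realType)
  (mu : probability A R) (nu : probability B R) (k : scalar_kind)
  (F : set (set (A * B))) (Fs : sigma_algebra [set: A * B] F)
  (FT : F `<=` measurable).
Local Notation P := (mu \x nu)%E.
Local Notation K := (scalar_field R k).
Local Notation N p q f := (mixed_norm mu nu p q (X := K^o) f).
Local Notation sm := (strongly_measurable (@measurable _ (A * B)%type)).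
Local Notation smF := (strongly_measurable F).
Implicit Types f g h : A * B -> K^o.

(** The set on which the norm of f is at most n. *)
Definition small_set f n := [set z | rnorm (f z) <= n%:R].

(** The function f, replaced by zero where its norm exceeds n. *)
Definition trunc f n : A * B -> K^o := patch (cst 0) (small_set f n) f.

Lemma smF_patch (D : set (A * B)) f : F D -> smF f -> smF (patch (cst 0) D f).
Proof.
move=> FD; rewrite !(strongly_measurable_sub Fs) => sf; apply: sm_patch => //.
exact/(sub_measurable_setP Fs).
Qed.

Lemma small_set_sub f n : smF f -> F (small_set f n).
Proof.
rewrite (strongly_measurable_sub Fs) => sf; apply/(sub_measurable_setP Fs).
rewrite -[X in measurable X]setTI; apply: measurable_fun_ler => //.
exact: sm_rnorm.
Qed.

Lemma smF_trunc f n : smF f -> smF (trunc f n).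
Proof. by move=> sf; apply: smF_patch => //; exact: small_set_sub. Qed.

Lemma rnorm_patch (D : set (A * B)) f z : rnorm (patch (cst 0) D f z) <= rnorm (f z).
Proof. by rewrite /patch; case: ifP => // _; rewrite rnorm0. Qed.

Lemma rnorm_trunc f n z : rnorm (trunc f n z) <= n%:R.
Proof. by rewrite /trunc /patch; case: ifPn; rewrite ?inE// rnorm0. Qed.

Lemma trunc_eventually f z : \forall n \near \oo, z \in small_set f n.
Proof.
exists (Num.bound (rnorm (f z))) => // n /= zn; rewrite inE /small_set /=.
apply: ltW; apply: lt_le_trans (archi_boundP (rnorm_ge0 _)) _.
by rewrite ler_nat.
Qed.

(** By monotone convergence, bounds for the truncations are bounds for f, which
    is not assumed to have finite norm. *)
Lemma mixed_norm_trunc_le p q f (M : \bar R) : 0 < p -> 0 < q -> smF f ->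
  (forall n, N p q (trunc f n) <= M)%E -> (N p q f <= M)%E.
Proof.
move=> p0 q0 sf le_M; rewrite mixed_normE.
apply: (mnorm_sup_le (f_ := fun n z => (rnorm (trunc f n z))%:E)) => //.
- move=> n; apply: measurable_rnorm_EFin.
  exact: (strongly_measurable_subW FT (smF_trunc n sf)).
- by move=> n z; rewrite lee_fin.
- move=> z i j ij; rewrite lee_fin /trunc /patch.
  case: ifPn => [|_]; last by rewrite rnorm0.
  rewrite inE /small_set /= => zi; rewrite mem_set//=.
  by rewrite (le_trans zi)// ler_nat.
- move=> z; apply: cvg_EFin; first exact: nearW.
  apply: (@cvg_trans _ (cst (rnorm (f z)) @ \oo)); last exact: cvg_cst.
  apply: near_eq_cvg; apply: filterS (trunc_eventually f z) => n zn /=.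
  by rewrite /trunc /patch zn.
Qed.

Lemma LpLq_le p q f g : 0 < p -> 0 < q -> sm f ->
  (forall z, rnorm (f z) <= rnorm (g z)) -> LpLq mu nu p q K^o g ->
  LpLq mu nu p q K^o f.
Proof.
move=> p0 q0 sf fg [sg gN]; split=> //; apply: le_lt_trans gN.
exact: le_mixed_norm.
Qed.

Lemma LpLq_bounded p q f (M : R) : 0 < p -> 0 < q -> sm f ->
  (forall z, rnorm (f z) <= M) -> LpLq mu nu p q K^o f.
Proof.
move=> p0 q0 sf fM; split=> //.
have M0 : 0 <= M by exact: le_trans (rnorm_ge0 _) (fM point).
rewrite mixed_normE; apply: (@le_lt_trans _ _ (mnorm mu nu p q (cst M%:E))).
  apply: le_mnorm => //; first exact: measurable_rnorm_EFin.
  by move=> z /=; rewrite lee_fin !ger0_norm.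
by rewrite mnorm_cst// ltry.
Qed.

Lemma LpLq_sub_of p q f : smF f -> LpLq mu nu p q K^o f -> LpLq_sub mu nu F p q K^o f.
Proof. by move=> sf Vf; split=> //; exists f => //; exact: aeW. Qed.

Lemma mixed_norm0 p q : 0 < p -> 0 < q -> N p q (cst 0) = 0%E.
Proof.
move=> p0 q0; rewrite mixed_normE -[RHS](@mnorm_cst _ _ _ _ _ mu nu 0 p q)//.
by congr mnorm; apply/funext => z /=; rewrite rnorm0.
Qed.

Lemma smF_cst (x : K^o) : smF (cst x).
Proof. by rewrite (strongly_measurable_sub Fs); exact: sm_cst. Qed.

End truncation.

Section norming.
Context d1 d2 (A : measurableType d1) (B : measurableType d2) (R : realType)
  (mu : probability A R) (nu : probability B R) (k : scalar_kind)
  (F : set (set (A * B))) (Fs : sigma_algebra [set: A * B] F)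
  (FT : F `<=` measurable).
Context (p q p' q' : R) (p1 : 1 < p) (q1 : 1 < q)
  (pp : p^-1 + p'^-1 = 1) (qq : q^-1 + q'^-1 = 1).
Local Notation P := (mu \x nu)%E.
Local Notation K := (scalar_field R k).
Local Notation N p q f := (mixed_norm mu nu p q (X := K^o) f).
Local Notation sm := (strongly_measurable (@measurable _ (A * B)%type)).
Local Notation smF := (strongly_measurable F).
Implicit Types f g h : A * B -> K^o.

Let p0 : 0 < p. Proof. exact: lt_trans p1. Qed.
Let q0 : 0 < q. Proof. exact: lt_trans q1. Qed.
Let p'1 : 1 < p'. Proof. exact: conjugate_gt1 pp. Qed.
Let q'1 : 1 < q'. Proof. exact: conjugate_gt1 qq. Qed.
Let p'0 : 0 < p'. Proof. exact: lt_trans p'1. Qed.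
Let q'0 : 0 < q'. Proof. exact: lt_trans q'1. Qed.
Let p'p : p'^-1 + p^-1 = 1. Proof. by rewrite addrC. Qed.
Let q'q : q'^-1 + q^-1 = 1. Proof. by rewrite addrC. Qed.

(** If the functional represented by a bounded F-measurable function f is
    bounded by M on the F-measurable functions, then norm f <= C * M. The test
    function is the conditional expectation psi of a norming function for |f|,
    multiplied by the conjugate sign of f; its norm is controlled by the bound
    for conditional expectations with the exponents p' and q'. *)
Lemma norming f (n : nat) (C M : R) : 0 <= C -> 0 <= M ->
  rcond_bounded mu nu F p' q' C -> smF f -> (forall z, rnorm (f z) <= n%:R) ->
  (forall h, smF h -> LpLq mu nu p' q' K^o h ->
     (rnorm (pairing mu nu f h))%:E <= M%:E * N p' q' h)%E ->
  (N p q f <= (C * M)%:E)%E.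
Proof.
move=> C0 M0 bC sfF fn fM.
have sf := strongly_measurable_subW FT sfF.
have sfTF := sfF; rewrite (strongly_measurable_sub Fs) in sfTF.
have fnb z : 0 <= rnorm (f z) <= n%:R by rewrite rnorm_ge0 fn.
have [phi [J [mphi phi0 J0 [fphi fN phiN]]]] := @mnorm_extremal _ _ A B R mu nu
  (fun z => rnorm (f z)) n%:R p q p' q' p1 q1 pp qq (sm_rnorm sf) fnb.
have phifin : (mnorm mu nu p' q' (EFin \o phi) < +oo)%E by rewrite phiN ltry.
have [psi psiE] := norm_rcond_exp Fs FT p'1 q'1 p'p q'q mphi phi0 phifin.
have [mpsi psi0 phipsi] := psiE.
have mpsiT := sub_measurableW Fs FT mpsi.
(* The power with exponent -1 is the inverse, with value zero at zero. *)
pose w z := (rnorm (f z) `^ (-1)) * psi z.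
have mw : sub_measurable F w.
  apply: measurable_funM => //.
  apply: (@measurableT_comp _ _ _ _ _ _ (@powR R ^~ (-1))) => //.
  exact: sm_rnorm sfTF.
have fw z : rnorm (f z) * w z = psi z \/ f z = 0.
  have [->|fz] := eqVneq (f z) 0; [by right|left].
  by rewrite /w powR_inv1// mulrA mulfV ?mul1r// rnorm_eq0.
have w0 z : 0 <= w z by rewrite mulr_ge0 ?powR_ge0.
pose h z : K^o := scalar_of_real k (w z) *: (scalar_conj (f z) : K^o).
have shF : smF h.
  rewrite (strongly_measurable_sub Fs); apply: smZ; first exact: sm_sr.
  apply: (@sm_comp _ _ _ _ _ K^o K^o (fun x => scalar_conj x : K^o)) => //.
  move=> u x /rnorm_cvgP ux; apply/rnorm_cvgP.
  by under eq_fun do rewrite -scalar_conjN -scalar_conjD rnorm_conj.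
have sh := strongly_measurable_subW FT shF.
have rh z : rnorm (h z) = rnorm (f z) * w z.
  by rewrite /h rnormZr rnorm_conj ger0_norm// mulrC.
have hpsi : (N p' q' h <= mnorm mu nu p' q' (EFin \o psi))%E.
  rewrite mixed_normE; apply: le_mnorm => //.
  - exact: measurable_rnorm_EFin.
  - exact/measurable_EFinP.
  move=> z /=; rewrite lee_fin !ger0_norm// rh.
  by have [->//|->] := fw z; rewrite rnorm0 mul0r.
have hN : (N p' q' h <= (C * J `^ p'^-1)%:E)%E.
  by apply: (le_trans hpsi); rewrite EFinM -phiN; exact: bC.
have Wh : LpLq mu nu p' q' K^o h by split=> //; rewrite (le_lt_trans hN)// ltry.
rewrite mixed_normE fN lee_fin.
apply: (powR_conjugate_le (p := p')) => //; first by rewrite mulr_ge0.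
have Vf : LpLq mu nu p q K^o f by exact: LpLq_bounded fn.
have [bfh _] := pairing_integrable p1 q1 pp qq Vf Wh.
have fhE z : f z * h z = scalar_of_real k (rnorm (f z) * psi z) *: (1 : K^o).
  rewrite /h [_ *: 1]mulr1 [f z * _]mulrCA mul_conj -srM; congr scalar_of_real.
  have [<-|->] := fw z; first by ring.
  by rewrite rnorm0; ring.
have mr : measurable_fun setT (fun z => rnorm (f z) * psi z).
  by apply: measurable_funM => //; exact: sm_rnorm.
have intr : P.-integrable setT (EFin \o (fun z => rnorm (f z) * psi z)).
  apply/integrableP; split; first exact/measurable_EFinP.
  have [_] := bfh; apply: le_lt_trans; apply: ge0_le_integral => //.
  - by apply: measurableT_comp => //; exact/measurable_EFinP.
  - by apply: measurable_rnorm_EFin; exact: smM.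
  - by move=> z _ /=; rewrite lee_fin fhE rnormZr ler_peMr// /rnorm normr1; case: (k).
have [sr1' sr2] := is_bochner_scale (1 : K^o) intr.
have pE : pairing mu nu f h = scalar_of_real k (fine (\int[P]_z (rnorm (f z) * psi z)%:E)) *: (1 : K^o).
  rewrite /pairing bochner_setT -(Bint_unique sr1' sr2); congr (Bint _ _).
  by apply/funext => z; exact: fhE.
have := fM h shF Wh; rewrite pE rnormZr ger0_norm; last first.
  by apply: fine_ge0; apply: integral_ge0 => z _; rewrite lee_fin mulr_ge0.
have -> : rnorm (1 : K^o) = 1 by rewrite /rnorm normr1; case: (k).
rewrite mulr1 fineK; last exact: integrable_fin_num.
move=> le_int; rewrite -lee_fin.
apply: (@le_trans _ _ (\int[P]_z (rnorm (f z) * psi z)%:E)%E).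
  rewrite -fphi; apply: (le_integral_sub_mul Fs FT) => //.
  - exact: sm_rnorm sfTF.
  - by move=> D FD; rewrite phipsi.
apply: (le_trans le_int).
apply: (@le_trans _ _ (M%:E * (C * J `^ p'^-1)%:E)%E).
  by rewrite lee_wpmul2l// lee_fin.
by rewrite -EFinM lee_fin mulrCA mulrA.
Qed.

End norming.

(** * The lower bound for the canonical map *)

Section lower_bound.
Context d1 d2 (A : measurableType d1) (B : measurableType d2) (R : realType)
  (mu : probability A R) (nu : probability B R) (k : scalar_kind)
  (F : set (set (A * B))) (Fs : sigma_algebra [set: A * B] F)
  (FT : F `<=` measurable).
Context (p q p' q' : R) (p1 : 1 < p) (q1 : 1 < q)
  (pp : p^-1 + p'^-1 = 1) (qq : q^-1 + q'^-1 = 1).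
Local Notation P := (mu \x nu)%E.
Local Notation K := (scalar_field R k).
Local Notation N p q f := (mixed_norm mu nu p q (X := K^o) f).
Local Notation smF := (strongly_measurable F).
Local Notation V := (LpLq_sub mu nu F p q K^o).
Local Notation W := (LpLq_sub mu nu F p' q' K^o).
Local Notation dnorm f := (dual_norm W (mixed_norm mu nu p' q' (X := K^o)) (pairing mu nu f)).
Implicit Types f g h : A * B -> K^o.

Let p0 : 0 < p. Proof. exact: lt_trans p1. Qed.
Let q0 : 0 < q. Proof. exact: lt_trans q1. Qed.
Let p'1 : 1 < p'. Proof. exact: conjugate_gt1 pp. Qed.
Let q'1 : 1 < q'. Proof. exact: conjugate_gt1 qq. Qed.
Let p'0 : 0 < p'. Proof. exact: lt_trans p'1. Qed.
Let q'0 : 0 < q'. Proof. exact: lt_trans q'1. Qed.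

Lemma pairing_ae_eq f1 f2 g1 g2 : LpLq mu nu p q K^o f1 -> LpLq mu nu p q K^o f2 ->
  LpLq mu nu p' q' K^o g1 -> LpLq mu nu p' q' K^o g2 ->
  f1 = f2 %[ae P] -> g1 = g2 %[ae P] -> pairing mu nu f1 g1 = pairing mu nu f2 g2.
Proof.
move=> V1 V2 W1 W2 ef eg.
have [b1 _] := pairing_integrable p1 q1 pp qq V1 W1.
have [b2 _] := pairing_integrable p1 q1 pp qq V2 W2.
apply: (bochner_ae_eq (@scalar_rcomplete R k) measurableT b1 b2).
by apply: filterS2 ef eg => z ef eg zT /=; rewrite ef ?eg.
Qed.

Lemma LpLq_sub_cst0 r s : 0 < r -> 0 < s -> LpLq_sub mu nu F r s K^o (cst 0).
Proof.
move=> r0 s0; have s0F := smF_cst Fs (0 : K^o).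
apply: LpLq_sub_of => //; apply: (LpLq_bounded mu nu (M := 0)) => //.
  exact: (strongly_measurable_subW FT).
by move=> z; rewrite rnorm0.
Qed.

Lemma dual_norm_ge0 f : (0 <= dnorm f)%E.
Proof.
apply: le_trans (ereal_sup_ubound _); last first.
  exists (cst 0); last reflexivity.
  by split; [exact: LpLq_sub_cst0|rewrite mixed_norm0].
by rewrite lee_fin.
Qed.

Lemma dual_norm_le f : LpLq mu nu p q K^o f -> (dnorm f <= N p q f)%E.
Proof.
move=> Vf; apply: ge_ereal_sup => _ [h [[Wh _] hN] <-].
apply: (le_trans (le_pairing p1 q1 pp qq Vf Wh)).
by rewrite -[leRHS]mule1 lee_wpmul2l// mixed_norm_ge0.
Qed.

(** The dual norm is a supremum over the unit ball; any h is scaled to norm one,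
    and an h of norm zero is dealt with by the Hoelder inequality. *)
Lemma pairing_le_dual_norm f (M : R) : LpLq mu nu p q K^o f -> (dnorm f <= M%:E)%E ->
  forall h, W h -> ((rnorm (pairing mu nu f h))%:E <= M%:E * N p' q' h)%E.
Proof.
move=> Vf fM h Wh; have [Wh' [h0 sh0 hh0]] := Wh; have [sh hN] := Wh'.
have := mixed_norm_lty_fin hN; set r := N p' q' h => rfin.
have r0 : (0 <= r)%E by exact: mixed_norm_ge0.
have [rz|rn0] := eqVneq r 0%E.
  by rewrite rz mule0; have := le_pairing p1 q1 pp qq Vf Wh'; rewrite -/r rz mule0.
have fr0 : 0 < fine r by rewrite fine_gt0// lt0e rn0 r0 -ge0_fin_numE.
pose c := scalar_of_real k (fine r)^-1.
have V0 := (LpLq_sub_cst0 p'0 q'0).1.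
pose ch : A * B -> K^o := fun z => c *: h z + cst 0 z.
have Wch : W ch.
  split; first exact: LpLqD.
  exists (fun z => c *: h0 z + cst 0 z).
    move: sh0; rewrite !(strongly_measurable_sub Fs) => sh0.
    by apply: smD; [apply: smZ => //; exact: sm_cst|exact: sm_cst].
  by apply: filterS hh0 => z hh0 zT; rewrite /ch hh0.
have chN : N p' q' ch = 1%E.
  transitivity (((fine r)^-1)%:E * r)%E; last first.
    by rewrite -[X in (_ * X)%E](fineK rfin) -EFinM mulVf// gt_eqF.
  rewrite /r !mixed_normE -mnormZ ?invr_ge0 ?(ltW fr0)//; last exact: measurable_rnorm_EFin.
  congr mnorm; apply/funext => z /=.
  by rewrite /ch addr0 rnormZr ger0_norm ?EFinM// invr_ge0 (ltW fr0).
have : ((rnorm (pairing mu nu f ch))%:E <= M%:E)%E.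
  apply: le_trans fM; apply: ereal_sup_ubound; exists ch => //; split=> //.
  by rewrite chN.
have pf0 : pairing mu nu f (cst 0) = 0.
  apply/eqP; rewrite -rnorm_eq0 eq_le rnorm_ge0 andbT -lee_fin.
  by have := le_pairing p1 q1 pp qq Vf V0; rewrite mixed_norm0// mule0.
rewrite (pairingDr p1 q1 pp qq c Vf Wh' V0) pf0 addr0 rnormZr lee_fin.
rewrite ger0_norm ?invr_ge0 ?(ltW fr0)// ler_pdivrMl// => le_M.
by rewrite -[X in (_ <= _ * X)%E](fineK rfin) -EFinM lee_fin mulrC.
Qed.

Lemma pairing_patch f (D : set (A * B)) h :
  pairing mu nu (patch (cst 0) D f) h = pairing mu nu f (patch (cst 0) D h).
Proof.
congr (bochner _ _ _); apply/funext => z; rewrite /patch.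
by case: ifP; rewrite ?mul0r ?mulr0.
Qed.

(** The functional of a truncation of f is that of f applied to test functions
    restricted to a set of F, hence it is bounded by the dual norm of f. *)
Lemma le_mixed_norm_dual (C : R) f : 0 <= C -> rcond_bounded mu nu F p' q' C ->
  V f -> (N p q f <= C%:E * dnorm f)%E.
Proof.
move=> C0 bC [Vf [f0 sf0 ff0]]; have [sf fN] := Vf.
have sf0T := strongly_measurable_subW FT sf0.
have ffin := mixed_norm_lty_fin fN.
have dfin : dnorm f \is a fin_num.
  rewrite ge0_fin_numE; first exact: le_lt_trans (dual_norm_le Vf) fN.
  exact: dual_norm_ge0.
rewrite (ae_eq_mixed_norm p0 q0 sf sf0T ff0).
have Vf0 : LpLq mu nu p q K^o f0.
  by split=> //; rewrite -(ae_eq_mixed_norm p0 q0 sf sf0T ff0).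
rewrite -(fineK dfin) -EFinM; apply: (mixed_norm_trunc_le Fs FT) => // n.
apply: (norming Fs FT p1 q1 pp qq (n := n)) => //.
- by apply: fine_ge0; exact: dual_norm_ge0.
- exact: smF_trunc.
- exact: rnorm_trunc.
move=> h sh Wh; rewrite /trunc pairing_patch.
have FD := small_set_sub Fs n sf0.
have shp := smF_patch Fs FD sh.
have shpT := strongly_measurable_subW FT shp.
have Whp : LpLq mu nu p' q' K^o (patch (cst 0) (small_set f0 n) h).
  by apply: LpLq_le Wh => // z; exact: rnorm_patch.
rewrite (@pairing_ae_eq f0 f _ (patch (cst 0) (small_set f0 n) h))//; last 2 first.
- by apply: filterS ff0 => z ff0 zT; rewrite ff0.
- exact: aeW.
have dM : (dnorm f <= (fine (dnorm f))%:E)%E by rewrite fineK.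
apply: (le_trans (pairing_le_dual_norm Vf dM (LpLq_sub_of shp Whp))).
rewrite lee_wpmul2l//; first by rewrite lee_fin fine_ge0// dual_norm_ge0.
apply: le_mixed_norm => //; first by case: Wh.
by move=> z; exact: rnorm_patch.
Qed.

Lemma LpLq_subD r s (c : K) f g : 1 < r -> 1 < s -> LpLq_sub mu nu F r s K^o f ->
  LpLq_sub mu nu F r s K^o g -> LpLq_sub mu nu F r s K^o (fun z => c *: f z + g z).
Proof.
move=> r1 s1 [Vf [f0 sf0 ff0]] [Vg [g0 sg0 gg0]]; split; first exact: LpLqD.
exists (fun z => c *: f0 z + g0 z).
  move: sf0 sg0; rewrite !(strongly_measurable_sub Fs) => sf0 sg0.
  by apply: smD => //; apply: smZ => //; exact: sm_cst.
by apply: filterS2 ff0 gg0 => z ff0 gg0 zT; rewrite ff0 ?gg0.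
Qed.

(** Of an isomorphism onto the dual only the lower bound is used. It is applied
    to the truncations of E(f): their pairing with an F-measurable h is bounded
    by the integral of |h| E(f), that is, of |h| f. *)
Lemma iso_rcond_bounded (C : R) :
  (forall f, V f -> N p q f <= C%:E * dnorm f)%E ->
  exists2 C', 0 <= C' & rcond_bounded mu nu F p q C'.
Proof.
move=> hC; exists (Num.max C 0); first by rewrite le_max lexx orbT.
move=> f g mf f0 gE fN; have [mg g0 fg] := gE.
have mgT := sub_measurableW Fs FT mg.
pose G z : K^o := scalar_of_real k (g z).
have rG z : rnorm (G z) = g z by rewrite rnorm_sr ger0_norm.
have sGF : smF G by rewrite (strongly_measurable_sub Fs); exact: sm_sr.
have -> : mnorm mu nu p q (EFin \o g) = N p q G.
  by rewrite mixed_normE; congr mnorm; apply/funext => z /=; rewrite rG.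
apply: (mixed_norm_trunc_le Fs FT) => // n.
have sGn := smF_trunc Fs n sGF; have sGnT := strongly_measurable_subW FT sGn.
have VGn : V (trunc G n).
  apply: LpLq_sub_of => //; apply: (LpLq_bounded mu nu (M := n%:R)) => //.
  exact: rnorm_trunc.
have fge0 : (0 <= mnorm mu nu p q (EFin \o f))%E by exact: mnorm_ge0.
apply: (le_trans (hC _ VGn)).
apply: (@le_trans _ _ ((Num.max C 0)%:E * dnorm (trunc G n))%E).
  by rewrite lee_wpmul2r ?dual_norm_ge0// lee_fin le_max lexx.
rewrite lee_wpmul2l ?lee_fin ?le_max ?lexx ?orbT//.
apply: ge_ereal_sup => _ [h [[Wh [h0 sh0 hh0]] hN] <-].
have [sh _] := Wh; have sh0T := strongly_measurable_subW FT sh0.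
have h0N : (N p' q' h0 <= 1)%E by rewrite -(ae_eq_mixed_norm p'0 q'0 sh sh0T hh0).
have W0 : LpLq mu nu p' q' K^o h0 by split=> //; rewrite (le_lt_trans h0N)// ltry.
rewrite (@pairing_ae_eq (trunc G n) (trunc G n) h h0 VGn.1 VGn.1 Wh W0 _ hh0); last exact: aeW.
have [bi _] := pairing_integrable p1 q1 pp qq VGn.1 W0.
apply: (le_trans (le_bochner (@scalar_rcomplete R k) measurableT bi)).
have sh0F := sh0; rewrite (strongly_measurable_sub Fs) in sh0F.
apply: (@le_trans _ _ (\int[P]_z (rnorm (h0 z) * g z)%:E)%E).
  apply: ge0_le_integral => //.
  - by move=> z _; rewrite lee_fin.
  - by apply: measurable_rnorm_EFin; exact: smM.
  - by apply/measurable_EFinP; apply: measurable_funM => //; exact: sm_rnorm.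
  - move=> z _; rewrite lee_fin rnormM mulrC ler_wpM2l// -[leRHS]rG.
    exact: rnorm_patch.
apply: (@le_trans _ _ (\int[P]_z (rnorm (h0 z) * f z)%:E)%E).
  apply: (le_integral_sub_mul Fs FT) => //; first exact: sm_rnorm sh0F.
  by move=> D FD; rewrite fg.
under eq_integral do rewrite mulrC EFinM.
apply: (@le_trans _ _ (mnorm mu nu p q (EFin \o f) * N p' q' h0)%E).
  rewrite mixed_normE; apply: mnorm_hoelder => //.
  - exact/measurable_EFinP.
  - exact: measurable_rnorm_EFin.
  - by move=> z; rewrite lee_fin.
by rewrite -[leRHS]mule1 lee_wpmul2l.
Qed.

End lower_bound.

(** * Surjectivity of the canonical map *)

Section surjectivity.
Context d1 d2 (A : measurableType d1) (B : measurableType d2) (R : realType)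
  (mu : probability A R) (nu : probability B R) (k : scalar_kind)
  (F : set (set (A * B))) (Fs : sigma_algebra [set: A * B] F)
  (FT : F `<=` measurable).
Context (p q p' q' : R) (p1 : 1 < p) (q1 : 1 < q)
  (pp : p^-1 + p'^-1 = 1) (qq : q^-1 + q'^-1 = 1).
Local Notation P := (mu \x nu)%E.
Local Notation K := (scalar_field R k).
Local Notation N p q f := (mixed_norm mu nu p q (X := K^o) f).
Local Notation TF := (g_sigma_algebraType F).
Local Notation smF := (strongly_measurable F).
Local Notation V := (LpLq_sub mu nu F p q K^o).
Local Notation W := (LpLq_sub mu nu F p' q' K^o).
Implicit Types f g h : A * B -> K^o.

Let p0 : 0 < p. Proof. exact: lt_trans p1. Qed.
Let q0 : 0 < q. Proof. exact: lt_trans q1. Qed.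
Let p'1 : 1 < p'. Proof. exact: conjugate_gt1 pp. Qed.
Let q'1 : 1 < q'. Proof. exact: conjugate_gt1 qq. Qed.
Let p'0 : 0 < p'. Proof. exact: lt_trans p'1. Qed.
Let q'0 : 0 < q'. Proof. exact: lt_trans q'1. Qed.
Let cK := @scalar_rcomplete R k.

(** Two functionals that are Lipschitz for the mixed norm and agree along a
    sequence agree at its limit. *)
Lemma agree_limit (L1 L2 : (A * B -> K^o) -> K^o) (C1 C2 : R)
    (h_ : (A * B -> K^o)^nat) h :
  (forall n, (rnorm (L1 (h_ n) - L1 h))%:E <= C1%:E * N p' q' (fun z => h_ n z - h z)%R)%E ->
  (forall n, (rnorm (L2 (h_ n) - L2 h))%:E <= C2%:E * N p' q' (fun z => h_ n z - h z)%R)%E ->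
  (N p' q' (fun z => h_ n z - h z)%R @[n --> \oo] --> 0)%E ->
  (forall n, L1 (h_ n) = L2 (h_ n)) -> L1 h = L2 h.
Proof.
move=> le1 le2 /ge0_cvge0P hN eqL.
have {}hN := hN (fun n => mixed_norm_ge0 _ _ _ _ _).
have lim0 (L : (A * B -> K^o) -> K^o) (C : R) :
    (forall n, (rnorm (L (h_ n) - L h))%:E <= C%:E * N p' q' (fun z => h_ n z - h z)%R)%E ->
    rnorm (L (h_ n) - L h) @[n --> \oo] --> (0 : R).
  move=> leL; apply/cvgr0Pnorm_le => e e0.
  have C'0 : 0 < `|C| + 1 by rewrite ltr_wpDl.
  have e'0 : 0 < e / (`|C| + 1) by rewrite divr_gt0.
  apply: filterS (hN _ e'0) => n hn; rewrite ger0_norm// -lee_fin.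
  apply: (le_trans (leL n)).
  apply: (@le_trans _ _ ((`|C| + 1)%:E * (e / (`|C| + 1))%:E)%E); last first.
    by rewrite -EFinM mulrC divfK// gt_eqF.
  apply: (@le_trans _ _ ((`|C| + 1)%:E * N p' q' (fun z => h_ n z - h z)%R)%E).
    rewrite lee_wpmul2r ?mixed_norm_ge0// lee_fin.
    by rewrite (le_trans (ler_norm C))// lerDl.
  by rewrite lee_wpmul2l// lee_fin ltW.
apply: (rnorm_cvg_unique (lim0 L1 C1 le1)).
by under eq_fun do rewrite eqL; exact: lim0 le2.
Qed.

Lemma pairing_dist f g h : LpLq mu nu p q K^o f -> LpLq mu nu p' q' K^o g ->
  LpLq mu nu p' q' K^o h -> ((rnorm (pairing mu nu f g - pairing mu nu f h))%:E <=
    (fine (N p q f))%:E * N p' q' (fun z => g z - h z)%R)%E.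
Proof.
move=> Vf Wg Wh; have [_ fN] := Vf; rewrite (fineK (mixed_norm_lty_fin fN)).
have Wd := LpLqB p'1 q'1 Wg Wh.
apply: le_trans (le_pairing p1 q1 pp qq Vf Wd); rewrite lee_fin.
have := pairingDr p1 q1 pp qq (-1) Vf Wh Wg; rewrite scaleN1r addrC => <-.
rewrite le_eqVlt; apply/orP; left; apply/eqP; congr (rnorm (bochner _ _ _)).
by apply/funext => z; rewrite scaleN1r addrC.
Qed.

Section functional.
Context (L : (A * B -> K^o) -> K^o) (CL : R) (CL0 : 0 <= CL)
  (L_lin : forall (c : K) f g, W f -> W g ->
     L (fun z => c *: f z + g z) = c *: L f + L g)
  (L_le : forall g, W g -> ((rnorm (L g))%:E <= CL%:E * N p' q' g)%E).

Let L0 : L (cst 0) = 0.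
Proof.
have W0 := LpLq_sub_cst0 mu nu k Fs FT p'0 q'0.
have := L_lin (-1) W0 W0; rewrite scaleN1r addNr => h; rewrite -[RHS]h; congr L.
by apply/funext => z; rewrite /= scaler0 addr0.
Qed.

Let L_dist g h : W g -> W h ->
  ((rnorm (L g - L h))%:E <= CL%:E * N p' q' (fun z => g z - h z)%R)%E.
Proof.
move=> Wg Wh; have := L_lin (-1) Wh Wg; rewrite scaleN1r [in RHS]addrC.
have -> : (fun z => -1 *: h z + g z) = (fun z => g z - h z).
  by apply/funext => z; rewrite scaleN1r addrC.
move=> <-; apply: L_le.
have := LpLq_subD Fs (-1) p'1 q'1 Wh Wg.
by congr W; apply/funext => z; rewrite scaleN1r addrC.
Qed.

(** The indicator function of D, with values in the scalar field. *)
Let indK (D : set (A * B)) : A * B -> K^o := patch (cst 0) D (cst 1).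

Let smF_indK D : F D -> smF (indK D).
Proof. by move=> FD; apply: (smF_patch Fs) => //; exact: smF_cst. Qed.

Let rnorm1 : rnorm (1 : K^o) = 1.
Proof. by rewrite /rnorm normr1; case: (k). Qed.

Let W_bounded h (M : R) : smF h -> (forall z, rnorm (h z) <= M) -> W h.
Proof.
move=> sh hM; apply: LpLq_sub_of => //.
by apply: (LpLq_bounded mu nu (M := M)) => //; exact: (strongly_measurable_subW FT).
Qed.

Let W_indK D : F D -> W (indK D).
Proof.
move=> FD; apply: (W_bounded (M := 1)); first exact: smF_indK.
by move=> z; rewrite -rnorm1; exact: rnorm_patch.
Qed.

(** For phi the real or the imaginary part, D |-> phi (L(1_D)) is a signed
    measure on F that vanishes on null sets: sigma-additivity is continuity of
    L along the dominated convergence of indicator functions. *)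
Let density (phi : K -> R) : (forall y z, phi (y + z) = phi y + phi z) ->
  (forall z, `|phi z| <= rnorm (z : K^o)) -> (forall z, phi (- z) = - phi z) ->
  exists a : A * B -> R, [/\ sub_measurable F a, P.-integrable setT (EFin \o a) &
    forall D, F D -> ((phi (L (indK D)))%:E = \int[P]_(z in D) (a z)%:E)%E].
Proof.
move=> phiD phi_le phiN; have phi0 : phi 0 = 0 by apply: (addrI (phi 0)); rewrite -phiD !addr0.
have := @Radon_Nikodym_sub _ (A * B)%type R P F Fs FT (fun D => phi (L (indK D))).
apply.
- have -> : indK set0 = cst 0 by apply/funext => z; rewrite /indK /patch in_set0.
  by rewrite L0.
- move=> G FG tG.
  have FU (I : set nat) : F (\bigcup_(i in I) G i).
    apply/(sub_measurable_setP Fs); apply: bigcup_measurable => i _.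
    exact/(sub_measurable_setP Fs).
  pose U n := \bigcup_(i in [set i | (i < n)%N]) G i.
  have indS n : indK (U n.+1) = (fun z => 1 *: indK (G n) z + indK (U n) z).
    apply/funext => z; rewrite scale1r /indK /patch.
    have [zG|zG] := boolP (z \in G n).
      rewrite mem_set; last by exists n => //=; exact: set_mem.
      rewrite memNset ?addr0// => -[i /= ni zi]; move: zG; rewrite inE => zG.
      suff ni' : n = i by rewrite ni' ltnn in ni.
      by apply: (tG n i) => //; exists z.
    rewrite add0r; congr (if _ then _ else _); apply/idP/idP; rewrite !inE.
      move=> [i /=]; rewrite ltnS leq_eqVlt => /predU1P[->|] zi.
        by move: zG; rewrite notin_setE.
      by exists i.
    by move=> [i /= ni zi]; exists i => //=; exact: ltnW.
  have sumE n : \sum_(0 <= i < n) phi (L (indK (G i))) = phi (L (indK (U n))).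
    elim: n => [|n ih].
      have -> : indK (U 0%N) = cst 0.
        by apply/funext => z; rewrite /indK /patch memNset// => -[].
      by rewrite L0 phi0 big_geq.
    rewrite big_nat_recr//= ih indS L_lin ?scale1r ?phiD 1?addrC//.
      exact: W_indK.
    by apply: W_indK; exact: FU.
  under eq_fun do rewrite sumE; apply/subr_cvg0.
  have WU I : W (indK (\bigcup_(i in I) G i)) by apply: W_indK; exact: FU.
  set UU := \bigcup_i G i.
  have dN : (N p' q' (fun z => indK (U n) z - indK UU z)%R @[n --> \oo] --> 0)%E.
    apply: (@mnorm_dominated_cvg0 _ _ A B R mu nu
      (fun n z => (rnorm (indK (U n) z - indK UU z))%:E) (cst 1%E) p' q') => //.
    + move=> n; apply: measurable_rnorm_EFin; apply: smB; [case: (WU [set i | (i < n)%N])|case: (WU setT)]; by case.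
    + move=> n z; rewrite lee_fin rnorm_ge0 lee_fin /indK /patch.
      have [zU|zU] := boolP (z \in U n).
        rewrite mem_set; last by move: zU; rewrite inE => -[i _ zi]; exists i.
        by rewrite subrr rnorm0 /= ler01.
      by rewrite /=; case: ifP => _; rewrite sub0r rnormN ?rnorm1 ?rnorm0 ?ler01.
    + by rewrite mnorm_cst1 ltry.
    + move=> z; apply: cvg_EFin; first exact: nearW.
      apply: (@cvg_trans _ (cst (0 : R) @ \oo)); last exact: cvg_cst.
      apply: near_eq_cvg; have [zU|zU] := boolP (z \in UU).
        move: (zU); rewrite inE => -[i _ zi]; exists i.+1 => // n /= ni.
        by rewrite /indK /patch zU mem_set ?subrr ?rnorm0//; exists i.
      apply: nearW => n /=; rewrite /indK /patch (negbTE zU) memNset ?subrr ?rnorm0//.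
      by move=> [i _ zi]; move: zU; rewrite notin_setE; apply; exists i.
  move/ge0_cvge0P in dN; have {}dN := dN (fun n => mixed_norm_ge0 _ _ _ _ _).
  apply/cvgr0Pnorm_le => e e0.
  have e'0 : 0 < e / (CL + 1) by rewrite divr_gt0// ltr_wpDl.
  apply: filterS (dN _ e'0) => n dn; rewrite -phiN -phiD (le_trans (phi_le _))//.
  rewrite -lee_fin (le_trans (L_dist (WU _) (WU _)))//.
  apply: (@le_trans _ _ ((CL + 1)%:E * (e / (CL + 1))%:E)%E); last first.
    by rewrite -EFinM mulrC divfK// gt_eqF// ltr_wpDl.
  apply: lee_pmul => //; [exact: mixed_norm_ge0|by rewrite lee_fin lerDl].
- move=> D FD PD; apply/eqP; rewrite -normr_eq0 eq_le normr_ge0 andbT.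
  rewrite (le_trans (phi_le _))// -lee_fin (le_trans (L_le (W_indK FD)))//.
  rewrite (@ae_eq_mixed_norm _ _ A B R mu nu k p' q' (indK D) (cst 0))//.
  + by rewrite mixed_norm0// mule0.
  + by case: (W_indK FD) => -[].
  + exact: sm_cst.
  + exists D; split=> //; first exact: FT.
    move=> z /= zD; apply: contrapT => nzD; apply: zD => _.
    by rewrite /indK /patch memNset.
Qed.

(** The Radon-Nikodym density of D |-> L(1_D) represents L on the simple
    functions. *)
Let simple_representation : exists f, [/\ smF f, bochner_integrable P f &
  forall s, simple_fun F s -> L s = pairing mu nu f s].
Proof.
have reN (z : K) : real_of_scalar (- z) = - real_of_scalar z.
  by rewrite -mulN1r -(sr1 R k) -srN re_srM mulN1r.
have imN (z : K) : imag_of_scalar (- z) = - imag_of_scalar z.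
  by rewrite -mulN1r -(sr1 R k) -srN im_srM mulN1r.
have [a [ma inta aE]] := density (@reD R k) (@ler_re_rnorm R k) reN.
have [b [mb intb bE]] := density (@imD R k) (@ler_im_rnorm R k) imN.
pose f z : K^o := scalar_of_real k (a z) *: (1 : K^o) +
  scalar_of_real k (b z) *: (imag_unit R k : K^o).
have bf1 := bochner_integrable_scale (1 : K^o) inta.
have bf2 := bochner_integrable_scale (imag_unit R k : K^o) intb.
have bf : bochner_integrable P f by exact: bochner_integrableD.
have sfF : smF f.
  rewrite (strongly_measurable_sub Fs); apply: smD.
    by apply: smZ; [exact: sm_sr|exact: sm_cst].
  by apply: smZ; [exact: sm_sr|exact: sm_cst].
have fD D : F D -> bochner P D f = L (indK D).
  move=> FD; have mD := FT FD.
  rewrite /f (bochnerD cK mD bf1 bf2) !bochner_scale//.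
  rewrite -(aE D FD) -(bE D FD) /= [in RHS](scalar_decomp (L (indK D))).
  by rewrite [_ *: 1]mulr1 [_ *: imag_unit R k]mulrC.
move: f bf sfF fD => f bf sfF fD {bf1 bf2 aE bE inta intb}.
exists f; split=> // s ss; have [fs ms] := ss.
set r := finmap.enum_fset (fset_set (range s)).
have rP z : s z \in r by rewrite in_fset_set// inE; exists z.
pose I x := indK (s @^-1` [set x]).
have sE : s = (fun z => \sum_(x <- r) x *: I x z).
  apply/funext => z; rewrite (bigD1_seq (s z)) ?finmap.fset_uniq//=.
  rewrite /I /indK /patch mem_set//= [_ *: 1]mulr1 big1_seq ?addr0// => x /andP[xs _].
  rewrite memNset ?scaler0// => /= sx.
  by rewrite sx eqxx in xs.
(* Induction on the list of values: L is only known to be additive and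
   homogeneous, and only on its domain. *)
rewrite sE; elim: r {rP sE} => [|x r].
  have -> : (fun z => \sum_(x <- [::]) x *: I x z) = cst 0.
    by apply/funext => z; rewrite big_nil.
  rewrite L0; apply/esym/eqP; rewrite -rnorm_eq0 eq_le rnorm_ge0 andbT -lee_fin.
  have -> : pairing mu nu f (cst 0) = bochner P setT (cst 0).
    by congr (bochner _ _ _); apply/funext => z; rewrite mulr0.
  have b0 : bochner_integrable P (cst 0 : A * B -> K^o).
    split; first exact: sm_cst.
    by under eq_integral do rewrite rnorm0; rewrite integral0.
  rewrite (le_trans (le_bochner cK measurableT b0))//.
  by under eq_integral do rewrite rnorm0; rewrite integral0.
set hr := fun z => \sum_(x <- r) x *: I x z => ih.
have smI y : smF (I y) by apply: smF_indK; exact: ms.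
have hr_bounded (l : seq K^o) : smF (fun z => \sum_(x <- l) x *: I x z) /\
    exists M, forall z, rnorm (\sum_(x <- l) x *: I x z) <= M.
  elim: l => [|y l [sl [M lM]]].
    split; last by exists 0 => z; rewrite big_nil rnorm0.
    by under eq_fun do rewrite big_nil; exact: smF_cst.
  split.
    under eq_fun do rewrite big_cons.
    have := smI y; move: sl; rewrite !(strongly_measurable_sub Fs) => sl sy.
    by apply: smD => //; apply: smZ => //; exact: sm_cst.
  exists (rnorm y + M) => z; rewrite big_cons (le_trans (ler_rnormD _ _))//.
  rewrite lerD// rnormZ ler_piMr//.
  by rewrite -rnorm1; exact: rnorm_patch.
have [shr [M hrM]] := hr_bounded r.
have bfh (g : A * B -> K^o) (M' : R) : smF g -> (forall z, rnorm (g z) <= M') ->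
    bochner_integrable P (fun z => f z * g z : K^o).
  move=> sg gM.
  have bM := bochner_integrableZ (scalar_of_real k M') bf.
  have M'0 : 0 <= M' by exact: le_trans (rnorm_ge0 _) (gM point).
  apply: (bochner_integrable_le _ bM).
    by apply: smM; [case: bf|exact: (strongly_measurable_subW FT)].
  move=> z; rewrite rnormM rnormZr (ger0_norm M'0) mulrC.
  exact: ler_wpM2r.
have FI y : F (s @^-1` [set y]) by exact: ms.
have -> : (fun z => \sum_(x <- x :: r) x *: I x z) = (fun z => x *: I x z + hr z).
  by apply/funext => z; rewrite big_cons.
rewrite L_lin; [|exact: W_indK|exact: W_bounded hrM].
have bI : bochner_integrable P (fun z => f z * I x z : K^o).
  apply: (bfh _ 1) => // z; rewrite -rnorm1; exact: rnorm_patch.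
have bh := bfh hr M shr hrM.
have -> : pairing mu nu f (fun z => x *: I x z + hr z) =
    bochner P setT (fun z => x *: (f z * I x z : K^o) + (f z * hr z : K^o)).
  congr (bochner _ _ _); apply/funext => z; rewrite mulrDr; congr (_ + _).
  exact: (@mulrCA K).
rewrite (bochnerD cK measurableT (bochner_integrableZ x bI) bh).
rewrite (bochnerZ cK x measurableT bI) ih; congr (_ *: _ + _).
have -> : (fun z => f z * I x z : K^o) = patch (cst 0) (s @^-1` [set x]) f.
  apply/funext => z; rewrite /I /indK /patch; case: ifP => _; first by rewrite mulr1.
  by rewrite mulr0.
by rewrite bochner_setT; exact: esym (fD _ (FI x)).
Qed.

(** The function f that represents L on simple functions is only known to be
    integrable. Its truncations represent the restrictions of L to the sets on
    which f is bounded, on the whole space by density of the simple functions;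
    hence the norming estimate bounds their norms, and f has finite norm. Then
    f represents L, since h restricted to the set where |f| <= n tends to h. *)
Lemma functional_represented (C : R) : 0 <= C -> rcond_bounded mu nu F p' q' C ->
  exists2 f, V f & forall g, W g -> pairing mu nu f g = L g.
Proof.
move=> C0 bC; have [f [sf bf fL]] := simple_representation.
have sfT := strongly_measurable_subW FT sf.
have Vn n : LpLq mu nu p q K^o (trunc f n).
  apply: (LpLq_bounded mu nu (M := n%:R)) => //; last exact: rnorm_trunc.
  exact: (strongly_measurable_subW FT (smF_trunc Fs n sf)).
pose D n := small_set f n.
have FD n : F (D n) by exact: small_set_sub.
have Wpatch n h : smF h -> LpLq mu nu p' q' K^o h -> W (patch (cst 0) (D n) h).
  move=> sh Wh; have shp := smF_patch Fs (FD n) sh; apply: LpLq_sub_of => //.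
  apply: (LpLq_le p'0 q'0 (strongly_measurable_subW FT shp) _ Wh) => z.
  exact: rnorm_patch.
(* The truncation of f represents the restriction of L to D n. *)
have rep n h : smF h -> LpLq mu nu p' q' K^o h ->
    L (patch (cst 0) (D n) h) = pairing mu nu (trunc f n) h.
  move=> sh Wh; have shF := sh; rewrite (strongly_measurable_sub Fs) in shF.
  have [shT hN] := Wh.
  have [s [ss sle sh_]] := sm_dominated shF.
  have ssF m : simple_fun F (s m) by have := ss m; rewrite (measurable_subE Fs).
  have smFs m : smF (s m).
    by rewrite (strongly_measurable_sub Fs); apply: (@sm_simple _ TF).
  have smTs m := strongly_measurable_subW FT (smFs m).
  have h3N : (mnorm mu nu p' q' (fun z => 3%:E * (rnorm (h z))%:E) < +oo)%E.
    rewrite mnormZ//; last exact: measurable_rnorm_EFin.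
    by rewrite lte_mul_pinfty.
  have Ws m : LpLq mu nu p' q' K^o (s m).
    split=> //; apply: le_lt_trans h3N; rewrite mixed_normE; apply: le_mnorm => //.
    - exact: measurable_rnorm_EFin.
    - by under eq_fun do rewrite -EFinM; apply/measurable_EFinP; apply: measurable_funM => //; exact: sm_rnorm.
    - move=> z; rewrite -EFinM !gee0_abs ?lee_fin ?mulr_ge0//.
      by apply: (le_trans (sle m z)); rewrite ler_wpM2r// ler_nat.
  apply: (agree_limit (L1 := fun h => L (patch (cst 0) (D n) h))
    (L2 := pairing mu nu (trunc f n)) (h_ := s) (C1 := CL)).
  - move=> m; apply: (le_trans (L_dist (Wpatch n _ (smFs m) (Ws m)) (Wpatch n _ sh Wh))).
    rewrite lee_wpmul2l// ; apply: le_mixed_norm => //.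
    + apply: smB; apply: sm_patch => //; exact: FT.
    + exact: smB.
    + move=> z; rewrite /patch; case: ifP => // _.
      by rewrite subrr rnorm0.
  - by move=> m; exact: pairing_dist.
  - apply: (@mnorm_dominated_cvg0 _ _ A B R mu nu
      (fun m z => (rnorm (s m z - h z))%:E) (fun z => 3%:E * (rnorm (h z))%:E)%E) => //.
    + by move=> m; apply: measurable_rnorm_EFin; exact: smB.
    + by under eq_fun do rewrite -EFinM; apply/measurable_EFinP; apply: measurable_funM => //; exact: sm_rnorm.
    + move=> m z; rewrite lee_fin rnorm_ge0 -EFinM lee_fin /=.
      rewrite (le_trans (ler_rnormB _ _))//.
      have -> : 3 * rnorm (h z) = 2 * rnorm (h z) + rnorm (h z) by ring.
      by rewrite lerD2r.
    + move=> z; apply: cvg_EFin; first exact: nearW.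
      exact/rnorm_cvgP.
  - move=> m; rewrite fL.
      by rewrite /trunc pairing_patch.
    have [fsm msm] := @simple_if _ TF K^o (D n) (s m) (cst 0)
      ((sub_measurable_setP Fs _).2 (FD n)) (ss m) (simple_cst _ _).
    by split=> // x; apply/(sub_measurable_setP Fs); exact: msm.
have fN : (N p q f <= (C * CL)%:E)%E.
  apply: (mixed_norm_trunc_le Fs FT) => // n.
  apply: (norming Fs FT p1 q1 pp qq (n := n)) => //.
  - exact: smF_trunc.
  - exact: rnorm_trunc.
  move=> h sh Wh; rewrite -rep//.
  have Wp := Wpatch n h sh Wh; apply: (le_trans (L_le Wp)).
  rewrite lee_wpmul2l//; apply: le_mixed_norm => //.
  - by case: Wp => -[].
  - by case: Wh.
  - by move=> z; exact: rnorm_patch.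
have Vf : LpLq mu nu p q K^o f by split=> //; rewrite (le_lt_trans fN)// ltry.
exists f; first exact: LpLq_sub_of.
move=> h Wh; have [Wh1 [h0 sh0 hh0]] := Wh; have [sh hN] := Wh1.
have sh0T := strongly_measurable_subW FT sh0.
have h0N : (N p' q' h0 < +oo)%E by rewrite -(ae_eq_mixed_norm p'0 q'0 sh sh0T hh0).
have W1 : LpLq mu nu p' q' K^o h0 by [].
have W0 : W h0 by exact: LpLq_sub_of.
(* Both functionals depend on the class of h only, so that h may be replaced
   by its F-measurable representative h0. *)
rewrite (pairing_ae_eq p1 q1 pp qq Vf Vf Wh1 W1 _ hh0); last exact: aeW.
have -> : L h = L h0.
  apply/eqP; rewrite -subr_eq0 -rnorm_eq0 eq_le rnorm_ge0 andbT -lee_fin.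
  apply: (le_trans (L_dist Wh W0)).
  rewrite (@ae_eq_mixed_norm _ _ A B R mu nu k p' q' (fun z => h z - h0 z) (cst 0))//.
  - by rewrite mixed_norm0// mule0.
  - exact: smB.
  - exact: sm_cst.
  - by apply: filterS hh0 => z hh0 zT; rewrite hh0//= subrr.
apply/esym; apply: (agree_limit (L1 := L) (L2 := pairing mu nu f)
  (h_ := fun n => patch (cst 0) (D n) h0) (C1 := CL)).
- by move=> n; apply: L_dist => //; exact: Wpatch.
- by move=> n; apply: pairing_dist => //; case: (Wpatch n h0 sh0 W1).
- apply: (@mnorm_dominated_cvg0 _ _ A B R mu nu
    (fun n z => (rnorm (patch (cst 0) (D n) h0 z - h0 z))%:E) (fun z => (rnorm (h0 z))%:E)) => //.
  + move=> n; apply: measurable_rnorm_EFin; apply: smB => //.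
    by case: (Wpatch n h0 sh0 W1) => -[].
  + exact: measurable_rnorm_EFin.
  + move=> n z; rewrite !lee_fin rnorm_ge0 /= /patch.
    by case: ifP => _; rewrite ?subrr ?rnorm0 ?sub0r ?rnormN.
  + move=> z; apply: cvg_EFin; first exact: nearW.
    apply: (@cvg_trans _ (cst (0 : R) @ \oo)); last exact: cvg_cst.
    apply: near_eq_cvg; apply: filterS (trunc_eventually f z) => n zn /=.
    by rewrite /patch zn subrr rnorm0.
- by move=> n; rewrite (rep n h0 sh0 W1); exact: pairing_patch.
Qed.

End functional.

End surjectivity.

(** * Equivalence of the three assertions *)

Section isomorphism.
Context d1 d2 (A : measurableType d1) (B : measurableType d2) (R : realType)
  (mu : probability A R) (nu : probability B R) (k : scalar_kind)
  (F : set (set (A * B))) (Fs : sigma_algebra [set: A * B] F)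
  (FT : F `<=` measurable).
Context (p q p' q' : R) (p1 : 1 < p) (q1 : 1 < q)
  (pp : p^-1 + p'^-1 = 1) (qq : q^-1 + q'^-1 = 1).
Local Notation P := (mu \x nu)%E.
Local Notation K := (scalar_field R k).

(** Contractivity is the Hoelder inequality, and injectivity follows from the
    lower bound. *)
Lemma rcond_bounded_isomorphism (C : R) : 0 <= C -> rcond_bounded mu nu F p' q' C ->
  isomorphism_onto_dual P (pairing mu nu)
    (LpLq_sub mu nu F p q K^o) (mixed_norm mu nu p q)
    (LpLq_sub mu nu F p' q' K^o) (mixed_norm mu nu p' q').
Proof.
move=> C0 bC; have p'1 := conjugate_gt1 p1 pp; have q'1 := conjugate_gt1 q1 qq.
have p0 : 0 < p := lt_trans ltr01 p1; have q0 : 0 < q := lt_trans ltr01 q1.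
pose V := LpLq_sub mu nu F p q K^o; pose W := LpLq_sub mu nu F p' q' K^o.
have PhiD (c : K) f1 f2 g : V f1 -> V f2 -> W g ->
    pairing mu nu (c *: f1 + f2) g = c *: pairing mu nu f1 g + pairing mu nu f2 g.
  move=> [V1 _] [V2 _] [Wg _]; exact: (pairingDl p1 q1 pp qq c V1 V2 Wg).
have lower f : V f -> (mixed_norm mu nu p q f <=
    C%:E * dual_norm W (mixed_norm mu nu p' q') (pairing mu nu f))%E.
  exact: (le_mixed_norm_dual Fs FT p1 q1 pp qq C0 bC).
split; [|split; [|split; [|split; [|split]]]].
- move=> f [Vf _]; split.
    move=> c g h [Wg _] [Wh _]; exact: (pairingDr p1 q1 pp qq c Vf Wg Wh).
  exists (fine (mixed_norm mu nu p q f)) => g [Wg _].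
  have [_ fN] := Vf; rewrite (fineK (mixed_norm_lty_fin fN)).
  exact: (le_pairing p1 q1 pp qq Vf Wg).
- by move=> c f1 f2 V1 V2 g Wg; exact: PhiD.
- move=> f1 f2 V1 V2 eq12.
  have [[sf1 _] _] := V1; have [[sf2 _] _] := V2.
  have Vd : V (fun z => -1 *: f2 z + f1 z) by exact: LpLq_subD.
  have dE : (fun z => -1 *: f2 z + f1 z) = (fun z => f1 z - f2 z).
    by apply/funext => z; rewrite scaleN1r addrC.
  have d0 : (dual_norm W (mixed_norm mu nu p' q')
      (pairing mu nu (fun z => -1 *: f2 z + f1 z)%R) <= 0)%E.
    apply: ge_ereal_sup => _ [g [Wg _] <-].
    have /= -> := PhiD (-1) f2 f1 g V2 V1 Wg.
    by rewrite eq12// scaleN1r addNr rnorm0.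
  apply: ae_eq_of_int_rnorm => //.
  have := lower _ Vd; rewrite dE => le_d.
  have sd : strongly_measurable measurable (fun z => f1 z - f2 z) by exact: smB.
  apply: le_trans (le_trans le_d _).
    rewrite mixed_normE; apply: (@integral_le_mnorm _ _ A B R mu nu _ p q p' q') => //.
    + exact: lt_trans p'1.
    + exact: lt_trans q'1.
    + exact: measurable_rnorm_EFin.
    + by move=> z; rewrite lee_fin.
  by rewrite -dE mule_ge0_le0// lee_fin.
- move=> L [L_lin [CL hL]].
  apply: (functional_represented Fs FT p1 q1 pp qq (CL := Num.max CL 0)) C0 bC.
  + by rewrite le_max lexx orbT.
  + by move=> c f g Wf Wg; exact: L_lin.
  + move=> g Wg; apply: (le_trans (hL g Wg)); rewrite lee_wpmul2r ?mixed_norm_ge0//.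
    by rewrite lee_fin le_max lexx.
- exists 1 => f [Vf _]; rewrite mul1e; exact: (dual_norm_le F p1 q1 pp qq Vf).
- by exists C.
Qed.

End isomorphism.

Theorem theorem2p2 (R : realType) (k : scalar_kind)
    (d1 d2 : measure_display) (A : measurableType d1) (B : measurableType d2)
    (mu : probability A R) (nu : probability B R)
    (F : set (set (A * B)))
    (F_sigma_algebra : sigma_algebra [set: A * B] F)
    (F_sub : F `<=` measurable)
    (p q p' q' : R) (p_gt1 : 1 < p) (q_gt1 : 1 < q)
    (pp' : p^-1 + p'^-1 = 1) (qq' : q^-1 + q'^-1 = 1)
    (X : completeNormedModType (scalar_field R k)) (X_neq0 : exists x : X, x != 0) :
  [<-> restricts_to_bounded_projection (mu \x nu)%E
         (cond_exp (mu \x nu)%E F)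
         (LpLq mu nu p q X) (mixed_norm mu nu p q);
       restricts_to_bounded_projection (mu \x nu)%E
         (cond_exp (mu \x nu)%E F)
         (LpLq mu nu p' q' X) (mixed_norm mu nu p' q');
       isomorphism_onto_dual (mu \x nu)%E (pairing mu nu)
         (LpLq_sub mu nu F p q (scalar_field R k)^o) (mixed_norm mu nu p q)
         (LpLq_sub mu nu F p' q' (scalar_field R k)^o) (mixed_norm mu nu p' q')].

Proof.
have p'1 := conjugate_gt1 p_gt1 pp'; have q'1 := conjugate_gt1 q_gt1 qq'.
have p'p : p'^-1 + p^-1 = 1 by rewrite addrC.
have q'q : q'^-1 + q^-1 = 1 by rewrite addrC.
have cX := @complete_rcomplete R k X.
tfae.
- move=> h.
  have [C C0 bC] := rcond_bounded_projection F_sigma_algebra F_sub cX p_gt1 q_gt1 pp' qq' X_neq0 h.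
  apply: (projection_rcond_dominated F_sigma_algebra F_sub cX p'1 q'1 p'p q'q (C := C)).
  exact: (rcond_bounded_dual F_sigma_algebra F_sub p_gt1 q_gt1 C0 pp' qq' bC).
- move=> h.
  have [C C0 bC] := rcond_bounded_projection F_sigma_algebra F_sub cX p'1 q'1 p'p q'q X_neq0 h.
  exact: (rcond_bounded_isomorphism k F_sigma_algebra F_sub p_gt1 q_gt1 pp' qq' C0 bC).
- move=> [_ [_ [_ [_ [_ [C0 hC0]]]]]].
  have [C C_ge0 bC] := iso_rcond_bounded F_sigma_algebra F_sub p_gt1 q_gt1 pp' qq' hC0.
  have dC := rcond_bounded_dual F_sigma_algebra F_sub p_gt1 q_gt1 C_ge0 pp' qq' bC.
  have bC' := rcond_dominated_bounded dC.
  apply: (projection_rcond_dominated F_sigma_algebra F_sub cX p_gt1 q_gt1 pp' qq' (C := C)).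
  exact: (rcond_bounded_dual F_sigma_algebra F_sub p'1 q'1 C_ge0 p'p q'q bC').
Qed.
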